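(* $(\mathcal{M}(\Omega,\mathbb{S}^n_+),\mathrm{WB}_\Lambda)$ is a complete metric space. Moreover, the topology induced by the metric $\mathrm{WB}_\Lambda$ is stronger than the weak* one, i.e., $\lim_{j\to\infty}\mathrm{WB}_\Lambda(\mathsf{G}^j,\mathsf{G})=0$ implies the weak* convergence of $\mathsf{G}^j$ to $\mathsf{G}$.
   Context: Matrices: $\mathbb{S}^n,\mathbb{S}^n_+,\mathbb{S}^n_{++}$ are the real symmetric, positive semidefinite, positive definite $n\times n$ matrices; $\mathbb{M}^n=\mathbb{R}^{n\times n}$; $A\cdot B=\mathrm{Tr}(A^{\mathrm T}B)$; $A^\dagger$ is the pseudoinverse; $\mathrm{Ran}$ is the range. $\mathcal{M}(\mathcal{X},V)$ denotes finite $V$-valued Radon measures on a compact metric space $\mathcal{X}$; weak* convergence is tested against continuous functions. Weights and action: fix positive integers $n,k,d$ and $\Lambda=(\Lambda_1,\Lambda_2)$ with $\Lambda_1\in\mathbb{S}^k_+$, $\Lambda_2\in\mathbb{S}^n_{++}$. Put $\mathbb{X}=\mathbb{S}^n\times\mathbb{R}^{n\times k}\times\mathbb{M}^n$. Define $J_\Lambda(X,Y,Z)=\frac12(Y\Lambda_1^\dagger)\cdot(X^\dagger Y\Lambda_1^\dagger)+\frac12(Z\Lambda_2^{-1})\cdot(X^\dagger Z\Lambda_2^{-1})$ if $X\in\mathbb{S}^n_+$, $\mathrm{Ran}(Y^{\mathrm T})\subset\mathrm{Ran}(\Lambda_1)$ and $\mathrm{Ran}([Y,Z])\subset\mathrm{Ran}(X)$,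 and $+\infty$ otherwise. For $\mu=(\mathsf{G},\mathsf{q},\mathsf{R})\in\mathcal{M}(\mathcal{X},\mathbb{X})$, $\mathcal{J}_{\Lambda,\mathcal{X}}(\mu)=\int_{\mathcal{X}}J_\Lambda(\frac{\mathrm{d}\mu}{\mathrm{d}\lambda})\,\mathrm{d}\lambda$ for any nonnegative finite Radon $\lambda$ with $|\mu|\ll\lambda$ (independent of $\lambda$). Continuity equation: $\Omega\subset\mathbb{R}^d$ is compact with nonempty interior and smooth boundary; $Q=[0,1]\times\Omega$. $\mathsf{D}^*$ is a first-order constant-coefficient linear differential operator from $\mathbb{S}^n$-valued to $\mathbb{R}^{n\times k}$-valued functions on $\mathbb{R}^d$ with $\mathsf{D}^*(I)=0$; i.e. $\mathsf{D}^*\Phi=L_0(\Phi)+\sum_{j=1}^dL_j(\partial_{x_j}\Phi)$ with linear $L_j:\mathbb{S}^n\to\mathbb{R}^{n\times k}$ and $L_0(I)=0$; on functions of $(t,x)$ it acts in $x$. $C^1(Q,\mathbb{S}^n)$: derivatives exist in the interior and extend continuously to the boundary. $\Phi_t=\Phi(t,\cdot)$. $\mathcal{CE}([0,1];\mathsf{G}_0,\mathsf{G}_1)$ is the set of $\mu=(\mathsf{G},\mathsf{q},\mathsf{R})\in\mathcal{M}(Q,\mathbb{X})$ with $$\int_Q\partial_t\Phi\cdot\mathrm{d}\mathsf{G}+\mathsf{D}^*\Phi\cdot\mathrm{d}\mathsf{q}+\Phi\cdot\mathrm{d}\mathsf{R}=\int_\Omega\Phi_1\cdot\mathrm{d}\mathsf{G}_1-\int_\Omega\Phi_0\cdot\mathrm{d}\mathsf{G}_0\quad\forall\Phi\in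 C^1(Q,\mathbb{S}^n).$$ For $\mathsf{G}_0,\mathsf{G}_1\in\mathcal{M}(\Omega,\mathbb{S}^n_+)$, $\mathrm{WB}_\Lambda(\mathsf{G}_0,\mathsf{G}_1)\ge0$ is defined by $\mathrm{WB}^2_\Lambda(\mathsf{G}_0,\mathsf{G}_1)=\inf\{\mathcal{J}_{\Lambda,Q}(\mu):\mu\in\mathcal{CE}([0,1];\mathsf{G}_0,\mathsf{G}_1)\}$. *)

(* Defs.v *)
From HB Require Import structures.
From mathcomp Require Import all_boot all_order all_algebra.
From mathcomp Require Import all_classical all_reals all_analysis.

Set Implicit Arguments.
Unset Strict Implicit.
Unset Printing Implicit Defensive.
Import Order.TTheory GRing.Theory Num.Theory.
Import numFieldNormedType.Exports.

Local Open Scope classical_set_scope.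
Local Open Scope charge_scope.
Local Open Scope ring_scope.

Section Matrices.
Context {R : realType}.

Definition symm {n} : set 'M[R]_n := [set A | A^T = A].

Definition psd {n} : set 'M[R]_n :=
  [set A | A^T = A /\ forall v : 'cV[R]_n, 0 <= (v^T *m A *m v) 0 0].

Definition posdef {n} : set 'M[R]_n :=
  [set A | A^T = A /\ forall v : 'cV[R]_n, v != 0 -> 0 < (v^T *m A *m v) 0 0].

Definition frob {m n} (A B : 'M[R]_(m, n)) : R := \tr (A^T *m B).

Definition ran {m n} (A : 'M[R]_(m, n)) : set 'cV[R]_m :=
  range (fun v : 'cV[R]_n => A *m v).

Definition moore_penrose {m n} (A : 'M[R]_(m, n)) (B : 'M[R]_(n, m)) : Prop :=
  [/\ A *m B *m A = A, B *m A *m B = B,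
      (A *m B)^T = A *m B & (B *m A)^T = B *m A].

(* The Penrose equations have exactly one solution, so the default is unused.
   This is not [pinvmx], which is only some generalized inverse. *)
Definition pinv {m n} (A : 'M[R]_(m, n)) : 'M[R]_(n, m) :=
  xget 0 [set B | moore_penrose A B].

Definition Jdom {n k} (L1 : 'M[R]_k) (X : 'M[R]_n) (Y : 'M[R]_(n, k))
    (Z : 'M[R]_n) : Prop :=
  [/\ psd X, ran Y^T `<=` ran L1 & ran (row_mx Y Z) `<=` ran X].

Definition J {n k} (L1 : 'M[R]_k) (L2 : 'M[R]_n)
    (X : 'M[R]_n) (Y : 'M[R]_(n, k)) (Z : 'M[R]_n) : \bar R :=
  if `[< Jdom L1 X Y Z >] then
    (2^-1 * frob (Y *m pinv L1) (pinv X *m Y *m pinv L1) +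
     2^-1 * frob (Z *m invmx L2) (pinv X *m Z *m invmx L2))%:E
  else +oo%E.

End Matrices.

Section ChargeIntegral.
Context {d : measure_display} {T : measurableType d} {R : realType}.
Implicit Types nu : {charge set T -> \bar R}.

Lemma hahn_exists nu :
  exists PN : set T * set T, hahn_decomposition nu PN.1 PN.2.
Proof. by have [P [N nuPN]] := Hahn_decomposition nu; exists (P, N). Qed.

(* The Hahn decomposition is unique up to null sets, so the choice made by
   [cid] does not affect the Jordan parts on measurable sets. *)
Definition hahn nu := svalP (cid (hahn_exists nu)).

Definition variation nu : {measure set T -> \bar R} := charge_variation (hahn nu).

Definition charge_integral nu (D : set T) (f : T -> R) : R :=
  \int[jordan_pos (hahn nu)]_(x in D) f x
  - \int[jordan_neg (hahn nu)]_(x in D) f x.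

End ChargeIntegral.

Section TotalVariation.
Context {d : measure_display} {T : measurableType d} {R : realType} {m n : nat}.
Variable mu : 'M[{charge set T -> \bar R}]_(m, n).
Local Open Scope ereal_scope.

(* Sum of the variations of the entries: a finite measure with the same null
   sets as the total variation |mu| computed from any norm on matrices. *)
Definition total_variation (A : set T) : \bar R :=
  \sum_(p : 'I_m * 'I_n) variation (mu p.1 p.2) A.

Let tv0 : total_variation set0 = 0.
Proof. by rewrite /total_variation big1. Qed.

Let tv_ge0 A : 0 <= total_variation A.
Proof. by rewrite /total_variation; apply: sume_ge0. Qed.

Let tv_sigma_additive : semi_sigma_additive total_variation.
Proof.
move=> F mF tF mUF; rewrite [X in _ --> X](_ : _ =
    lim ((fun N => \sum_(0 <= i < N) total_variation (F i)) @ \oo)).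
  by apply: is_cvg_ereal_nneg_natsum => k _; exact: sume_ge0.
rewrite nneseries_sum//; apply: eq_bigr => /= p _.
exact: measure_semi_bigcup.
Qed.

HB.instance Definition _ := isMeasure.Build _ _ _ total_variation
  tv0 tv_ge0 tv_sigma_additive.

Let tv_fin : fin_num_fun total_variation.
Proof.
move=> A mA; rewrite /total_variation sum_fin_num; apply/allP => x /mapP[p _ ->].
by rewrite /variation/= /charge_variation fin_numD !fin_num_measure.
Qed.

HB.instance Definition _ := @Measure_isFinite.Build _ _ _
  total_variation tv_fin.

End TotalVariation.

Definition borel {R : realType} (E : normedModType R) :=
  g_sigma_algebraType (@open E).

Section MatrixMeasures.
Context {R : realType} {E : normedModType R}.

(* Matrix-valued Borel measures on E, given by their entries.  Elements of
   M(K, V), for K compact in a Euclidean space E, are those concentrated on K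
   (see [measures]); finite Borel measures on K are Radon. *)
Definition mxmeasure (m n : nat) := 'M[{charge set (borel E) -> \bar R}]_(m, n).

Definition mval {m n} (mu : mxmeasure m n) (A : set (borel E)) : 'M[R]_(m, n) :=
  \matrix_(i, j) fine (mu i j A).

Definition measures {m n} (K : set E) (V : set 'M[R]_(m, n)) :
    set (mxmeasure m n) :=
  [set mu | forall A : set (borel E), measurable A ->
     V (mval mu A) /\ (A `&` K = set0 -> mval mu A = 0)].

(* Equality as measures.  Leibniz equality of charges is too fine: it also
   compares the junk values on non-measurable sets. *)
Definition eq_mxmeasure {m n} (mu nu : mxmeasure m n) : Prop :=
  forall A : set (borel E), measurable A -> mval mu A = mval nu A.

(* The integral over K of Phi . d mu *)
Definition pairing {m n} (K : set E) (Phi : E -> 'M[R]_(m, n))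
    (mu : mxmeasure m n) : R :=
  \sum_i \sum_j charge_integral (mu i j) K (fun x => Phi x i j).

Definition density {m n} (la : {finite_measure set (borel E) -> \bar R})
    (mu : mxmeasure m n) (x : E) : 'M[R]_(m, n) :=
  \matrix_(i, j) fine (('d (mu i j) '/d la) x).

Definition weak_star {m n} (K : set E) (V : set 'M[R]_(m, n))
    (u : nat -> mxmeasure m n) (mu : mxmeasure m n) : Prop :=
  forall Phi : E -> 'M[R]_(m, n), {within K, continuous Phi} ->
    (forall x, K x -> V (Phi x)) ->
    pairing K Phi (u j) @[j --> \oo] --> pairing K Phi mu.

(* The action does not depend on the reference measure dominating the total
   variation of (G, q, r); it is computed here with the total variation. *)
Definition action {n k} (L1 : 'M[R]_k) (L2 : 'M[R]_n) (K : set E)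
    (mu : mxmeasure n n * mxmeasure n k * mxmeasure n n) : \bar R :=
  let: (G, q, r) := mu in
  let la := total_variation (row_mx G (row_mx q r)) in
  (\int[la]_(x in K) J L1 L2 (density la G x) (density la q x) (density la r x))%E.

End MatrixMeasures.
Arguments mxmeasure {R} E m n.

Section Domain.
Context {R : realType} {d : nat}.

Definition ebase (i : 'I_d) : 'rV[R]_d := delta_mx 0 i.

Definition pderiv (s : seq 'I_d) (g : 'rV[R]_d -> R) : 'rV[R]_d -> R :=
  foldr (fun i f => 'D_(ebase i) f) g s.

Definition smooth_on (U : set 'rV[R]_d) (g : 'rV[R]_d -> R) : Prop :=
  forall (s : seq 'I_d) (x : 'rV[R]_d), U x ->
    {for x, continuous (pderiv s g)} /\
    forall i, derivable (pderiv s g) x (ebase i).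

(* Near each boundary point the (closed) set Om is the sublevel set of a
   C^infinity function with nonvanishing gradient. *)
Definition smooth_boundary (Om : set 'rV[R]_d) : Prop :=
  forall x, (closure Om `\` Om°) x ->
    exists (U : set 'rV[R]_d) (g : 'rV[R]_d -> R),
      [/\ open U, U x, smooth_on U g,
          exists i, 'D_(ebase i) g x != 0 &
          Om `&` U = [set y | U y /\ g y <= 0]].

Definition cylinder (Om : set 'rV[R]_d) : set (R * 'rV[R]_d) :=
  `[0, 1]%classic `*` Om.

(* Phi is in C^1(Q, S^n), with Phit and Phix the continuous extensions to Q of
   the time and space partial derivatives, which exist in the interior. *)
Definition C1 {n} (Q : set (R * 'rV[R]_d)) (Phi Phit : R * 'rV[R]_d -> 'M[R]_n)
    (Phix : 'I_d -> R * 'rV[R]_d -> 'M[R]_n) : Prop :=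
  [/\ forall z, Q z -> symm (Phi z),
      {within Q, continuous Phi},
      {within Q, continuous Phit},
      forall j, {within Q, continuous (Phix j)} &
      forall z, Q° z ->
        is_derive z ((1 : R), (0 : 'rV[R]_d)) Phi (Phit z) /\
        forall j, is_derive z ((0 : R), ebase j) Phi (Phix j z)].

End Domain.

Section Distance.
Context {R : realType} {n k d : nat}.
(* The operator Phi |-> L0 Phi + \sum_j Lx j (d_j Phi); only the values of
   L0 and Lx on symmetric matrices are used. *)
Variables (L0 : {linear 'M[R]_n -> 'M[R]_(n, k)})
          (Lx : 'I_d -> {linear 'M[R]_n -> 'M[R]_(n, k)}).
Variables (L1 : 'M[R]_k) (L2 : 'M[R]_n) (Om : set 'rV[R]_d).

Definition Dstar {E : Type} (Phi : E -> 'M[R]_n) (Phix : 'I_d -> E -> 'M[R]_n)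
    (z : E) : 'M[R]_(n, k) :=
  L0 (Phi z) + \sum_j Lx j (Phix j z).

Let Q : set (R * 'rV[R]_d) := cylinder Om.

Definition CE (G0 G1 : mxmeasure 'rV[R]_d n n) :
    set (mxmeasure (R * 'rV[R]_d)%type n n * mxmeasure (R * 'rV[R]_d)%type n k *
         mxmeasure (R * 'rV[R]_d)%type n n) :=
  [set mu | let: (G, q, r) := mu in
    [/\ measures Q symm G, measures Q setT q, measures Q setT r &
        forall Phi Phit Phix, C1 Q Phi Phit Phix ->
          pairing Q Phit G + pairing Q (Dstar Phi Phix) q + pairing Q Phi r =
          pairing Om (fun x => Phi (1, x)) G1
          - pairing Om (fun x => Phi (0, x)) G0]].

Definition WB (G0 G1 : mxmeasure 'rV[R]_d n n) : \bar R :=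
  sqrte (ereal_inf [set action L1 L2 Q mu | mu in CE G0 G1]).

End Distance.

Section Metric.
Context {R : realType} {T : Type}.
Local Open Scope ereal_scope.

(* eqv plays the role of equality on S. *)
Definition is_metric (S : set T) (eqv : T -> T -> Prop) (dist : T -> T -> \bar R)
    : Prop :=
  [/\ forall x y, S x -> S y -> 0 <= dist x y < +oo,
      forall x y, S x -> S y -> dist x y = 0 <-> eqv x y,
      forall x y, S x -> S y -> dist x y = dist y x &
      forall x y z, S x -> S y -> S z -> dist x z <= dist x y + dist y z].

Definition is_complete (S : set T) (dist : T -> T -> \bar R) : Prop :=
  forall u : nat -> T, (forall j, S (u j)) ->
    (forall e : R, (0 < e)%R -> exists N : nat,
       forall i j : nat, (N <= i)%N -> (N <= j)%N -> dist (u i) (u j) < e%:E) ->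
    exists l, S l /\ dist (u j) l @[j --> \oo] --> 0.

End Metric.

(* Main.v *)
Require Import Defs.
From HB Require Import structures.
From mathcomp Require Import all_boot all_order all_algebra.
From mathcomp Require Import all_classical all_reals all_analysis.
From mathcomp Require Import measurable_realfun ring lra.
Set Implicit Arguments.
Unset Strict Implicit.
Unset Printing Implicit Defensive.
Import Order.TTheory GRing.Theory Num.Theory.
Import numFieldNormedType.Exports.
Local Open Scope classical_set_scope.
Local Open Scope ring_scope.

(* The action density J is a supremum of functions linear in (X, Y, Z), hence the
   action is a supremum of sums of such functions evaluated on the values of the
   measures on disjoint sets.  The quadratic terms of the linear functions bound
   the total variations of q and r by a / s + s c tr G(Q) for every s > 0, where a
   is the action; testing the continuity equation with (1 - t) I bounds tr G(Q), and
   testing it with functions of x alone then shows that the distance controls the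
   integrals of C^1 functions.  Hence distance 0 means equality of measures, and
   convergence in distance implies weak* convergence.

   Affine changes of the time variable followed by concatenation give symmetry and
   the triangle inequality.  The distance to 0 is finite because of the curve
   (1 - t)^2 G_0 with reaction - 2 (1 - t) G_0.

   A Cauchy sequence has bounded masses and convergent integrals of C^1 functions,
   so by the Riesz representation theorem it converges weakly*.  Concatenating
   countably many curves of summable action along a fast subsequence yields a curve
   of small action ending at the weak* limit; no compactness in the space of curves
   is needed. *)

(** * Integration against charges *)

(** The action is defined by Radon-Nikodym densities with respect to a measure that changes with the
    curve, so sums, time changes and limits are awkward to treat directly; in the dual form they
    become statements about values of charges. The condition [L0 1%:M = 0] removes [q] from the mass
    balance, so that masses are controlled by [r], and the part of the bound on [r] that contains
    the mass of [G] can be absorbed. A curve of action a run in time tau has action a / tau. Pieces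
    of duration 2^-(l+1) therefore need costs of order 4^-(l+1), which fixes how fast the
    subsequence of a Cauchy sequence is extracted. The entries of a limit of positive semidefinite
    measures are not positive functionals, but the combinations sum w_i w_j G_ij are: Riesz's
    theorem is applied for each w, and the entries come back by polarization. A test function has
    derivatives only in the interior of the cylinder; the smooth boundary makes the interior of [Om]
    dense in [Om], so time increments are controlled up to the boundary. The profile (1 - t)^2 is
    chosen because w'^2 / w has to be integrable in time. *)

Section ChargeValues.
Context {d} {T : measurableType d} {R : realType}.
Implicit Types (nu : {charge set T -> \bar R}) (K : set T) (f g : T -> R) (M e : R).

Lemma fine_chargeU nu A B : measurable A -> measurable B -> A `&` B = set0 ->
  fine (nu (A `|` B)) = fine (nu A) + fine (nu B).
Proof.
move=> mA mB AB; rewrite chargeU//.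
by rewrite fineD// fin_num_measure.
Qed.

Lemma fine_charge_bigsetU nu (E : nat -> set T) N : (forall i, measurable (E i)) ->
  trivIset setT E ->
  fine (nu (\big[setU/set0]_(i < N) E i)) = \sum_(i < N) fine (nu (E i)).
Proof.
move=> mE tE; rewrite charge_semi_additive//; last exact: bigsetU_measurable.
by rewrite -sum_fine// => i _; rewrite fin_num_measure.
Qed.

(** Uniform approximation by a simple function on a finite measurable partition of [K]. Identities
    between integrals against charges are proved by passing to such sums, where they reduce to
    identities between values on sets. *)
Definition stepping (K : set T) (f : T -> R) (e : R) (N : nat)
    (E : nat -> set T) (c : nat -> R) :=
  [/\ forall i, measurable (E i), trivIset setT E,
      \big[setU/set0]_(i < N) E i = K, measurable_fun K f &
      forall i x, (i < N)%N -> E i x -> `|f x - c i| <= e].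

Lemma stepping_exists K f M e : measurable K -> measurable_fun K f ->
  (forall x, K x -> `|f x| <= M) -> 0 < e ->
  exists N (E : nat -> set T) (c : nat -> R), stepping K f e N E c.
Proof.
move=> mK mf fM e0.
pose E (i : nat) := K `&` f @^-1` `[(-M + i%:R * e)%R, (-M + i.+1%:R * e)%R[.
(* Horizontal bands of height [e] starting at [- M]: the band of [x] has index floor ((f x + M) /
   e), at most floor (2 M / e). *)
exists (Num.truncn ((M + M) / e)).+1, E, (fun i => -M + i%:R * e).
have Etrunc i x : E i x -> Num.truncn ((f x + M) / e) = i.
  move=> [Kx]; rewrite /= in_itv/= => /andP[h1 h2].
  apply/eqP; rewrite truncn_eq; last first.
    by rewrite divr_ge0 ?(ltW e0)//; have := fM _ Kx; rewrite ler_norml; lra.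
  by rewrite ler_pdivlMr// ltr_pdivrMr//; apply/andP; split; lra.
split => //.
- by move=> i; apply: mf.
- apply/trivIsetP => i j _ _ ij; apply/seteqP; split => // x [/Etrunc Ei /Etrunc Ej].
  by move: ij; rewrite -Ei -Ej eqxx.
- apply/seteqP; split => x.
    by rewrite -bigcup_mkord => -[i _ []].
  move=> Kx; rewrite -bigcup_mkord.
  have fx := fM _ Kx; move: (fx); rewrite ler_norml => /andP[fx1 fx2].
  have f0 : 0 <= (f x + M) / e by rewrite divr_ge0 ?(ltW e0)//; lra.
  exists (Num.truncn ((f x + M) / e)) => /=.
    by rewrite ltnS le_truncn// ler_pM2r ?invr_gt0//; lra.
  split => //=; rewrite in_itv/=.
  have := truncn_itv f0; rewrite ler_pdivlMr// ltr_pdivrMr// => /andP[h1 h2].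
  by apply/andP; split; lra.
- move=> i x _ [Kx]; rewrite /= in_itv/= -natr1 => /andP[h1 h2].
  by rewrite ler_norml; apply/andP; split; lra.
Qed.

Lemma stepping_bounded K f e N E c : stepping K f e N E c ->
  exists M, forall x, K x -> `|f x| <= M.
Proof.
move=> [mE tE KE mf fc]; exists (e + \sum_(i < N) `|c i|) => x.
rewrite -KE -bigcup_mkord => -[i /= iN Ex].
rewrite -(subrK (c i) (f x)); apply: (le_trans (ler_normD _ _)).
rewrite lerD ?(fc _ _ iN Ex)//.
by rewrite (bigD1 (Ordinal iN))//= lerDl sumr_ge0.
Qed.

Lemma stepping_measurable K f e N E c : stepping K f e N E c -> measurable K.
Proof. by move=> [mE _ <- _ _]; exact: bigsetU_measurable. Qed.

Lemma integrable_bounded (P : {finite_measure set T -> \bar R}) K f M :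
  measurable K -> measurable_fun K f -> (forall x, K x -> `|f x| <= M) ->
  P.-integrable K (EFin \o f).
Proof.
move=> mK mf fM; apply: measurable_bounded_integrable => //.
  by rewrite ltey_eq fin_num_measure.
exists M; split; first exact: num_real.
by move=> M' MM' x Kx; apply: (le_trans (fM _ Kx)); exact: ltW.
Qed.

Lemma Rintegral_bigsetU (P : {finite_measure set T -> \bar R}) (E : nat -> set T) N f :
  (forall i, measurable (E i)) -> trivIset setT E ->
  P.-integrable (\big[setU/set0]_(i < N) E i) (EFin \o f) ->
  \int[P]_(x in \big[setU/set0]_(i < N) E i) f x = \sum_(i < N) \int[P]_(x in E i) f x.
Proof.
move=> mE tE; elim: N => [|N IH]; first by rewrite !big_ord0 Rintegral_set0.
rewrite !big_ord_recr/= => intf.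
have mU : measurable (\big[setU/set0]_(i < N) E i) by exact: bigsetU_measurable.
rewrite Rintegral_setU// ?IH//.
  by apply: integrableS intf => //; first [exact: subsetUl|exact: measurableU].
apply/disj_setPS => x []; rewrite -bigcup_mkord => -[i /= iN Eix] ENx.
move/trivIsetP : tE => /(_ i N I I); rewrite ltn_eqF// => /(_ isT) iN0.
by have : (E i `&` E N) x by []; rewrite iN0.
Qed.

Lemma Rintegral_stepping (P : {finite_measure set T -> \bar R}) K f e N E c :
  stepping K f e N E c ->
  `|\int[P]_(x in K) f x - \sum_(i < N) c i * fine (P (E i))| <= e * fine (P K).
Proof.
move=> sf; have [M fM] := stepping_bounded sf; have mK := stepping_measurable sf.
move: (sf) => [mE tE KE mf fc].
have intf := integrable_bounded P mK mf fM.
rewrite -KE in intf *; rewrite Rintegral_bigsetU//.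
have -> : fine (P (\big[setU/set0]_(i < N) E i)) = \sum_(i < N) fine (P (E i)).
  by rewrite (fine_charge_bigsetU (charge_of_finite_measure P)).
rewrite -sumrB mulr_sumr (le_trans (ler_norm_sum _ _ _))//.
apply: ler_sum => i _.
have EK : E i `<=` \big[setU/set0]_(i < N) E i.
  by rewrite -bigcup_mkord => x Ex; exists i => /=.
have intfi : P.-integrable (E i) (EFin \o f).
  by apply: integrableS intf => //; exact: bigsetU_measurable.
have intc r : P.-integrable (E i) (EFin \o cst r) by exact: finite_measure_integrable_cst.
rewrite -(Rintegral_cst P (mE i)) -RintegralB//; last exact: intc.
apply: (le_trans (le_normr_Rintegral _ _)) => //.
  exact: (integrableB (mE i) intfi (intc _)).
rewrite -(Rintegral_cst P (mE i)); apply: le_Rintegral => //.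
- exact/integrable_norm/(integrableB (mE i) intfi (intc _)).
- exact: intc.
- by move=> x Ex; exact: fc Ex.
Qed.

Definition tv nu (A : set T) : R := fine (Defs.variation nu A).

Lemma tvE nu A : measurable A ->
  tv nu A = fine (jordan_pos (hahn nu) A) + fine (jordan_neg (hahn nu) A).
Proof. by move=> mA; rewrite /tv /Defs.variation /charge_variation /= fineD// fin_num_measure. Qed.

Lemma fine_jordan nu A : measurable A ->
  fine (nu A) = fine (jordan_pos (hahn nu) A) - fine (jordan_neg (hahn nu) A).
Proof.
move=> mA; rewrite [in LHS](jordan_decomp (hahn nu) mA) /cadd/= cscaleN1.
by rewrite fineB// fin_num_measure.
Qed.

Lemma charge_integral_stepping nu K f e N E c : stepping K f e N E c ->
  `|charge_integral nu K f - \sum_(i < N) c i * fine (nu (E i))| <= e * tv nu K.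
Proof.
move=> sf; have mK := stepping_measurable sf.
have hp := Rintegral_stepping (jordan_pos (hahn nu)) sf.
have hn := Rintegral_stepping (jordan_neg (hahn nu)) sf.
rewrite tvE// /charge_integral mulrDr.
under eq_bigr => i _.
  rewrite fine_jordan; last by case: sf.
  rewrite mulrBr; over.
rewrite sumrB opprB addrACA [X in _ + X]addrC [X in _ + X]addrC.
rewrite addrC [X in X + _]addrC -opprB opprB.
move: hp hn; set a := \int[_]_(_ in _) _; set a' := \int[_]_(_ in _) _.
set b := \sum_(_ < _) _; set b' := \sum_(_ < _) _.
rewrite !ler_norml => /andP[? ?] /andP[? ?].
by apply/andP; split; lra.
Qed.

Lemma tv_ge0 nu A : 0 <= tv nu A.
Proof. exact/fine_ge0/measure_ge0. Qed.

Lemma le_tv nu A B : measurable A -> measurable B -> A `<=` B -> tv nu A <= tv nu B.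
Proof.
move=> mA mB AB; rewrite /tv fine_le//; [exact: fin_num_measure.. |].
by rewrite le_measure// inE.
Qed.

Lemma normr_charge_le_tv nu A : measurable A -> `|fine (nu A)| <= tv nu A.
Proof.
move=> mA; rewrite tvE// fine_jordan//.
have := measure_ge0 (jordan_pos (hahn nu)) A.
have := measure_ge0 (jordan_neg (hahn nu)) A.
move=> /fine_ge0 h1 /fine_ge0 h2; rewrite ler_norml; apply/andP; split; lra.
Qed.

(** The variation is a linear expression in the values on two disjoint sets, so a bound on linear
    functionals of values over disjoint sets bounds the variation. *)
Lemma tv_hahn nu : exists P N, [/\ measurable P, measurable N, P `&` N = set0 &
  forall A, measurable A -> tv nu A = fine (nu (A `&` P)) - fine (nu (A `&` N))].
Proof.
have [[mP _] [mN _] _ PN0] := hahn nu.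
exists (projT1 (cid (hahn_exists nu))).1, (projT1 (cid (hahn_exists nu))).2.
split => // A mA; rewrite tvE// jordan_posE jordan_negE cjordan_posE cjordan_negE.
by rewrite /crestr0 mem_set// /crestr/= fineN.
Qed.

Lemma normr_charge_integral nu K f M : measurable K -> measurable_fun K f ->
  (forall x, K x -> `|f x| <= M) -> `|charge_integral nu K f| <= M * tv nu K.
Proof.
move=> mK mf fM.
have bnd (P : {finite_measure set T -> \bar R}) :
    `|\int[P]_(x in K) f x| <= M * fine (P K).
  have intf := integrable_bounded P mK mf fM.
  apply: (le_trans (le_normr_Rintegral mK intf)).
  rewrite -(Rintegral_cst P mK); apply: le_Rintegral => //.
    exact/integrable_norm.
  exact: finite_measure_integrable_cst.
rewrite tvE// mulrDr /charge_integral.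
by apply: (le_trans (ler_normB _ _)); apply: lerD; exact: bnd.
Qed.

Lemma charge_integralD nu K f g Mf Mg : measurable K -> measurable_fun K f ->
  measurable_fun K g -> (forall x, K x -> `|f x| <= Mf) -> (forall x, K x -> `|g x| <= Mg) ->
  charge_integral nu K (fun x => f x + g x) = charge_integral nu K f + charge_integral nu K g.
Proof.
move=> mK mf mg fM gM; rewrite /charge_integral !RintegralD//;
  first [lra | exact: integrable_bounded fM | exact: integrable_bounded gM].
Qed.

Lemma charge_integralZ nu K f Mf a : measurable K -> measurable_fun K f ->
  (forall x, K x -> `|f x| <= Mf) ->
  charge_integral nu K (fun x => a * f x) = a * charge_integral nu K f.
Proof.
move=> mK mf fM; rewrite /charge_integral !RintegralZl ?mulrBr//;
  exact: integrable_bounded fM.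
Qed.

Lemma charge_integral_cst nu K a : measurable K ->
  charge_integral nu K (fun=> a) = a * fine (nu K).
Proof.
by move=> mK; rewrite /charge_integral !Rintegral_cst// fine_jordan// mulrBr.
Qed.

Lemma eq_charge_integral nu K f g : (forall x, K x -> f x = g x) ->
  charge_integral nu K f = charge_integral nu K g.
Proof.
by move=> fg; rewrite /charge_integral; congr (_ - _);
  apply: eq_Rintegral => x /[!inE]; exact: fg.
Qed.

End ChargeValues.

(** * Duality for the action density *)

Section Frobenius.
Context {R : realType}.

Lemma frobE m n (A B : 'M[R]_(m, n)) : frob A B = \sum_i \sum_j A i j * B i j.
Proof.
rewrite /frob /mxtrace exchange_big/=; apply: eq_bigr => j _.
by rewrite mxE; apply: eq_bigr => i _; rewrite mxE.
Qed.

Lemma frobC m n (A B : 'M[R]_(m, n)) : frob A B = frob B A.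
Proof. by rewrite !frobE; do 2!apply: eq_bigr => ? _; rewrite mulrC. Qed.

Lemma frobDl m n (A A' B : 'M[R]_(m, n)) : frob (A + A') B = frob A B + frob A' B.
Proof. by rewrite /frob linearD/= mulmxDl mxtraceD. Qed.

Lemma frobZl m n a (A B : 'M[R]_(m, n)) : frob (a *: A) B = a * frob A B.
Proof. by rewrite /frob linearZ/= -scalemxAl mxtraceZ. Qed.

Lemma frobNl m n (A B : 'M[R]_(m, n)) : frob (- A) B = - frob A B.
Proof. by rewrite -scaleN1r frobZl mulN1r. Qed.

Lemma frobDr m n (A B B' : 'M[R]_(m, n)) : frob A (B + B') = frob A B + frob A B'.
Proof. by rewrite frobC frobDl !(frobC A). Qed.

Lemma frobZr m n a (A B : 'M[R]_(m, n)) : frob A (a *: B) = a * frob A B.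
Proof. by rewrite frobC frobZl frobC. Qed.

Lemma frobNr m n (A B : 'M[R]_(m, n)) : frob A (- B) = - frob A B.
Proof. by rewrite frobC frobNl frobC. Qed.

Lemma frob0l m n (B : 'M[R]_(m, n)) : frob 0 B = 0.
Proof. by rewrite -(scale0r 0) frobZl mul0r. Qed.

Lemma frob0r m n (B : 'M[R]_(m, n)) : frob B 0 = 0.
Proof. by rewrite frobC frob0l. Qed.

Lemma frob_tr m n (A B : 'M[R]_(m, n)) : frob A^T B^T = frob A B.
Proof. by rewrite /frob trmxK mxtrace_mulC -mxtrace_tr trmx_mul trmxK. Qed.

Lemma frob_mulr m n p (A : 'M[R]_(m, p)) (B : 'M[R]_(m, n)) (C : 'M[R]_(n, p)) :
  frob A (B *m C) = frob (A *m C^T) B.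
Proof. by rewrite /frob trmx_mul trmxK mulmxA mxtrace_mulC mulmxA. Qed.

Lemma frob_mull m n p (A : 'M[R]_(m, p)) (B : 'M[R]_(m, n)) (C : 'M[R]_(n, p)) :
  frob A (B *m C) = frob (B^T *m A) C.
Proof. by rewrite /frob trmx_mul trmxK mulmxA. Qed.

Lemma frob_colrow n k (u : 'cV[R]_n) (w : 'cV[R]_k) (Y : 'M[R]_(n, k)) :
  frob (u *m w^T) Y = (u^T *m Y *m w) 0 0.
Proof.
rewrite /frob trmx_mul trmxK -mulmxA mxtrace_mulC.
by rewrite mulmxA mxtrace_mulC trace_mx11.
Qed.

Lemma quad_scale n (X : 'M[R]_n) (v : 'cV[R]_n) s :
  ((s *: v)^T *m X *m (s *: v)) 0 0 = s ^+ 2 * (v^T *m X *m v) 0 0.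
Proof.
have -> : (s *: v)^T = s *: v^T by apply/matrixP => i j; rewrite !mxE.
by rewrite -!scalemxAl -scalemxAr scalerA mxE.
Qed.

Lemma frob_psd n k (X : 'M[R]_n) (D : 'M[R]_(n, k)) : psd X -> 0 <= frob D (X *m D).
Proof.
move=> [_ Xp]; rewrite /frob /mxtrace; apply: sumr_ge0 => j _.
suff -> : (D^T *m (X *m D)) j j = ((col j D)^T *m X *m col j D) 0 0 by [].
rewrite -mulmxA !mxE; apply: eq_bigr => i _; rewrite !mxE; congr (_ * _).
by apply: eq_bigr => l _; rewrite !mxE.
Qed.

Lemma ran_subset_mul m n p (A : 'M[R]_(m, n)) (B : 'M[R]_(m, p)) :
  ran A `<=` ran B -> exists S, A = B *m S.
Proof.
move=> AB.
have h j : exists v, B *m v = col j A.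
  have [|v _ <-] := AB (col j A); last by exists v.
  by exists (delta_mx j 0) => //; rewrite -colE.
pose s j := projT1 (cid (h j)).
exists (\matrix_(i, j) s j i 0); apply/matrixP => i j; rewrite mxE.
have := congr1 (fun M : 'cV_m => M i 0) (projT2 (cid (h j))).
rewrite !mxE => <-; apply: eq_bigr => l _; by rewrite mxE.
Qed.

(** Fredholm alternative: a column of the cokernel of [A^T] that does not annihilate [y^T]. *)
Lemma notin_ran m n (A : 'M[R]_(m, n)) (y : 'cV[R]_m) : ~ ran A y ->
  exists w : 'cV[R]_m, A^T *m w = 0 /\ (y^T *m w) 0 0 != 0.
Proof.
move=> Ay; have : ~~ (y^T <= A^T)%MS.
  apply/negP => /submxP[D yD]; apply: Ay; exists D^T => //.
  by rewrite -[y]trmxK yD trmx_mul trmxK.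
rewrite submxE => /matrix0Pn[i [j]]; rewrite (ord1 i) => yj.
exists (col j (cokermx A^T)); split.
  by rewrite colE mulmxA mulmx_coker mul0mx.
by rewrite colE mulmxA -colE mxE.
Qed.

(** If [v *m F *m F^T = 0], then the squared norm of [v *m F] vanishes. *)
Lemma row_free_gram m n (F : 'M[R]_(m, n)) : row_free F -> F *m F^T \in unitmx.
Proof.
move=> fF; rewrite -row_free_unit -kermx_eq0 -submx0; apply/row_subP => i.
rewrite submx0; set v := row i _.
have : v *m (F *m F^T) = 0 by rewrite -row_mul mulmx_ker row0.
move=> /(congr1 (fun w => w *m v^T)); rewrite mul0mx mulmxA -mulmxA -trmx_mul.
move=> /(congr1 (fun w : 'M[R]_(1, 1) => w 0 0)); rewrite mxE [RHS]mxE => v0.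
have vF : v *m F = 0.
  apply/matrixP => a b; rewrite (ord1 a) [RHS]mxE.
  have /psumr_eq0P : forall j, true -> 0 <= (v *m F) 0 j * (v *m F)^T j 0.
    by move=> j _; rewrite !mxE -expr2 sqr_ge0.
  move=> /(_ v0 b isT)/eqP; rewrite [X in _ * X]mxE mulf_eq0 orbb => /eqP.
  by [].
by apply/eqP/(row_free_inj fF); rewrite vF mul0mx.
Qed.

(** Explicit pseudoinverse of a full-rank factorization, to be used with [col_base] and
    [row_base]. *)
Lemma moore_penrose_mul m n r (C : 'M[R]_(m, r)) (F : 'M[R]_(r, n)) :
  F *m F^T \in unitmx -> C^T *m C \in unitmx ->
  moore_penrose (C *m F) (F^T *m invmx (F *m F^T) *m invmx (C^T *m C) *m C^T).
Proof.
move=> uF uC; set GF := invmx (F *m F^T); set GC := invmx (C^T *m C).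
have sGF : GF^T = GF by rewrite trmx_inv trmx_mul trmxK.
have sGC : GC^T = GC by rewrite trmx_inv trmx_mul trmxK.
have AB : C *m F *m (F^T *m GF *m GC *m C^T) = C *m GC *m C^T.
  rewrite !mulmxA -(mulmxA C F F^T) -(mulmxA C (F *m F^T) GF).
  by rewrite mulmxV// mulmx1.
have BA : (F^T *m GF *m GC *m C^T) *m (C *m F) = F^T *m GF *m F.
  rewrite !mulmxA -(mulmxA (F^T *m GF *m GC) C^T C).
  by rewrite -(mulmxA (F^T *m GF) GC (C^T *m C)) mulVmx// mulmx1.
split.
- rewrite AB !mulmxA -(mulmxA (C *m GC) C^T C).
  by rewrite -(mulmxA C GC (C^T *m C)) mulVmx// mulmx1.
- rewrite BA !mulmxA -(mulmxA (F^T *m GF) F F^T).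
  by rewrite -(mulmxA F^T GF (F *m F^T)) mulVmx// mulmx1.
- by rewrite AB !trmx_mul trmxK sGC mulmxA.
- by rewrite BA !trmx_mul trmxK sGF mulmxA.
Qed.

Lemma moore_penrose_exists m n (A : 'M[R]_(m, n)) : exists B, moore_penrose A B.
Proof.
have := @moore_penrose_mul _ _ _ (col_base A) (row_base A).
rewrite mulmx_base => h; eexists; apply: h.
  by apply: row_free_gram; exact: row_base_free.
rewrite -{2}[col_base A]trmxK; apply: row_free_gram.
by rewrite /row_free mxrank_tr; exact: col_base_full.
Qed.

Lemma moore_penrose_uniq m n (A : 'M[R]_(m, n)) B C :
  moore_penrose A B -> moore_penrose A C -> B = C.
Proof.
move=> [A1 A2 A3 A4] [C1 C2 C3 C4].
have AE : A *m B = A *m C.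
  by rewrite -A3 -{1}C1 -mulmxA trmx_mul C3 A3 mulmxA A1.
have EA : B *m A = C *m A.
  by rewrite -A4 -{1}C1 -mulmxA mulmxA trmx_mul A4 C4 -mulmxA (mulmxA A) A1.
by rewrite -A2 EA -mulmxA AE mulmxA C2.
Qed.

Lemma pinvP m n (A : 'M[R]_(m, n)) : moore_penrose A (Defs.pinv A).
Proof. by have [B AB] := moore_penrose_exists A; exact: (xgetPex 0 (ex_intro _ B AB)). Qed.

Lemma pinv_sym n (A : 'M[R]_n) : A^T = A -> (Defs.pinv A)^T = Defs.pinv A.
Proof.
move=> sA; have [h1 h2 h3 h4] := pinvP A.
apply: (@moore_penrose_uniq _ _ A); last exact: pinvP; split.
- by rewrite -{1 3}sA -!trmx_mul mulmxA h1 sA.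
- by rewrite -{2}sA -!trmx_mul mulmxA h2.
- have -> : A *m (Defs.pinv A)^T = (Defs.pinv A *m A)^T by rewrite trmx_mul sA.
  by rewrite h4.
- have -> : (Defs.pinv A)^T *m A = (A *m Defs.pinv A)^T by rewrite trmx_mul sA.
  by rewrite h3.
Qed.

Lemma pinv_symC n (A : 'M[R]_n) : A^T = A -> Defs.pinv A *m A = A *m Defs.pinv A.
Proof.
move=> sA; have [_ _ _ <-] := pinvP A.
by rewrite trmx_mul sA pinv_sym.
Qed.

End Frobenius.

Section ActionDensity.
Context {R : realType} {n k : nat}.
Variables (L1 : 'M[R]_k) (L2 : 'M[R]_n).

Definition dual_param : Type := 'M[R]_(n, k) * 'M[R]_n * 'cV[R]_n * 'M[R]_n.

(* [X]-coefficient of the affine minorants of [J]; the [v]-term forces [X] to be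
   positive semidefinite on the effective domain and the [W]-term forces it to
   be symmetric. *)
Definition dual_coef (p : dual_param) : 'M[R]_n :=
  let: (B, C, v, W) := p in
  (W - W^T) - 2^-1 *: (B *m L1 *m (B *m L1)^T + C *m L2 *m (C *m L2)^T + v *m v^T).

Definition Jlin (p : dual_param) (X : 'M[R]_n) (Y : 'M[R]_(n, k)) (Z : 'M[R]_n) : R :=
  frob (dual_coef p) X + frob p.1.1.1 Y + frob p.1.1.2 Z.

Lemma JlinE B C v W X Y Z : Jlin (B, C, v, W) X Y Z =
  frob (W - W^T) X
  + (frob B Y - 2^-1 * frob (B *m L1) (X *m (B *m L1)))
  + (frob C Z - 2^-1 * frob (C *m L2) (X *m (C *m L2)))
  - 2^-1 * (v^T *m X *m v) 0 0.
Proof.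
rewrite /Jlin /= frobDl frobNl frobZl 2!frobDl frob_colrow.
rewrite !frob_mulr frobDl; lra.
Qed.

(** Fenchel-Young inequality: expand the nonnegative quadratic form of [Xm] at
    [B *m L - Xp *m U]. *)
Lemma frob_quad_le (Xm Xp : 'M[R]_n) m (L : 'M[R]_m) (U B : 'M[R]_(n, m)) :
  psd Xm -> L^T = L -> Xm *m Xp *m U = U ->
  frob B (U *m L) - 2^-1 * frob (B *m L) (Xm *m (B *m L)) <=
  2^-1 * frob U (Xp *m U).
Proof.
move=> psX sL XU; set V := Xp *m U.
have XV : Xm *m V = U by rewrite mulmxA.
have sX : Xm^T = Xm by case: psX.
have := frob_psd (B *m L - V) psX.
rewrite mulmxBr !(frobDl, frobDr, frobNl, frobNr) XV.
have -> : frob V (Xm *m (B *m L)) = frob (B *m L) U.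
  by rewrite frob_mull sX XV frobC.
have -> : frob B (U *m L) = frob (B *m L) U by rewrite frob_mulr sL.
rewrite (frobC V U); lra.
Qed.

Hypotheses (sL1 : L1^T = L1) (sL2 : L2^T = L2) (uL2 : L2 \in unitmx).

Lemma Jlin_le p X Y Z : ((Jlin p X Y Z)%:E <= J L1 L2 X Y Z)%E.
Proof.
rewrite /J; case: asboolP => [[psX rY rX]|]; last by rewrite leey.
case: p => [[[B C] v] W]; rewrite lee_fin JlinE.
have [X1 _ _ _] := pinvP X; have [P1 _ _ _] := pinvP L1.
have [S YS] := ran_subset_mul rY; have [S' XS] := ran_subset_mul rX.
have XY : X *m Defs.pinv X *m Y = Y.
  by move: XS; rewrite -[S']hsubmxK mul_mx_row => /eq_row_mx[-> _]; rewrite mulmxA X1.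
have XZ : X *m Defs.pinv X *m Z = Z.
  by move: XS; rewrite -[S']hsubmxK mul_mx_row => /eq_row_mx[_ ->]; rewrite mulmxA X1.
have YL : Y *m Defs.pinv L1 *m L1 = Y.
  rewrite -[Y]trmxK YS trmx_mul sL1 -!mulmxA; congr (_ *m _).
  by rewrite mulmxA P1.
have sX : X^T = X by case: psX.
have hv : 0 <= (v^T *m X *m v) 0 0 by case: psX.
have -> : frob (W - W^T) X = 0.
  by rewrite frobDl frobNl -{2}sX frob_tr subrr.
have /(_ B) := @frob_quad_le X (Defs.pinv X) _ L1 (Y *m Defs.pinv L1) _ psX sL1.
rewrite mulmxA XY YL => /(_ erefl) hY.
have /(_ C) := @frob_quad_le X (Defs.pinv X) _ L2 (Z *m invmx L2) _ psX sL2.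
rewrite mulmxA XZ mulmxKV// => /(_ erefl) hZ.
move: hY hZ; rewrite !mulmxA; lra.
Qed.

Lemma JlinD p X Y Z X' Y' Z' :
  Jlin p (X + X') (Y + Y') (Z + Z') = Jlin p X Y Z + Jlin p X' Y' Z'.
Proof. by rewrite /Jlin !frobDr; lra. Qed.

Definition dual_rescale (c s : R) (p : dual_param) : dual_param :=
  let: (B, C, v, W) := p in ((s * c) *: B, (s * c) *: C, c *: v, (c ^+ 2) *: W).

(** J(c X, s Y, s Z) = J(X, Y, Z) / c for s = 1 or -1, minorant by minorant. This is how the action
    behaves under an affine change of time, with s the direction of time. *)
Lemma Jlin_rescale c s p X Y Z : 0 < c -> s ^+ 2 = 1 ->
  Jlin p (c *: X) (s *: Y) (s *: Z) = c^-1 * Jlin (dual_rescale c s p) X Y Z.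
Proof.
move: p => [[[B C] v] W] c0 s1; rewrite !JlinE.
have -> : frob (c ^+ 2 *: W - (c ^+ 2 *: W)^T) X = c ^+ 2 * frob (W - W^T) X.
  by rewrite linearZ/= -scalerBr frobZl.
have h m (D : 'M[R]_(n, m)) (L : 'M[R]_m) :
    frob ((s * c) *: D *m L) (X *m ((s * c) *: D *m L)) =
    c ^+ 2 * frob (D *m L) (X *m (D *m L)).
  rewrite -scalemxAl -scalemxAr frobZl frobZr mulrA; congr (_ * _).
  by rewrite -expr2 exprMn s1 mul1r.
rewrite !h !frobZl !frobZr -!scalemxAl !frobZr.
rewrite quad_scale.
have -> : (v^T *m (c *: X) *m v) 0 0 = c * (v^T *m X *m v) 0 0.
  by rewrite -scalemxAr -scalemxAl mxE.
field; exact: lt0r_neq0.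
Qed.

Lemma Jlin_unbounded X Y Z a (p : R -> dual_param) b : b != 0 ->
  (forall s, Jlin (p s) X Y Z = s * b) -> exists s, a < Jlin (p s) X Y Z.
Proof.
move=> b0 pE; exists ((a + 1) / b); rewrite pE mulfVK//; lra.
Qed.

(** Each way of leaving the effective domain gives a family of minorants unbounded above: [W]
    detects asymmetry of [X], [v] a negative direction, [B] the range of [Y^T], and [B], [C]
    together the range of [[Y, Z]]. On the domain the supremum is attained. *)
Lemma Jlin_sup X Y Z a : (a%:E < J L1 L2 X Y Z)%E -> exists p, a < Jlin p X Y Z.
Proof.
have lin p b : b != 0 -> (forall s, Jlin (p s) X Y Z = s * b) ->
    exists q, a < Jlin q X Y Z.
  by move=> b0 /(Jlin_unbounded a b0)[s ?]; exists (p s).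
have [sX|/eqP nsX _] := pselect (X^T = X); last first.
  have : X^T - X != 0 by rewrite subr_eq0.
  move=> /matrix0Pn[i [j]]; rewrite !mxE => b0.
  apply: (lin (fun s => (0, 0, 0, s *: delta_mx j i))) b0 _ => s.
  rewrite JlinE !(mul0mx, mulmx0) !frob0l !mxE !(mulr0, subr0, addr0).
  rewrite linearZ/= -scalerBr frobZl; congr (_ * _).
  rewrite trmx_delta frobDl frobNl.
  have fd a' b' : frob (delta_mx a' b') X = X a' b'.
    rewrite frobE (bigD1 a')//= (bigD1 b')//= mxE !eqxx mul1r.
    rewrite big1 ?addr0 => [|b'' /negbTE h]; last by rewrite mxE h andbF mul0r.
    rewrite big1 ?addr0// => a'' /negbTE h; rewrite big1// => b'' _.
    by rewrite mxE h mul0r.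
  by rewrite !fd.
have [psX|npX _] := pselect (psd X); last first.
  have [v Xv] : exists v : 'cV[R]_n, (v^T *m X *m v) 0 0 < 0.
    apply: contrapT => /forallNP h; apply: npX; split => // v.
    by rewrite leNgt; apply/negP; exact: h.
  set q := (v^T *m X *m v) 0 0 in Xv.
  (* As s >= 1, the minorant - s^2 q / 2 is at least - s q / 2 = - q / 2 + |a|, which exceeds
     [a]. *)
  pose s := 1 + 2 * `|a| / (- q).
  have q0 : 0 < - q by lra.
  have hs : 2 * `|a| = (s - 1) * - q by rewrite /s addrC addKr mulfVK// lt0r_neq0.
  have s1 : 1 <= s by rewrite /s lerDl divr_ge0// ?mulr_ge0// ltW.
  exists (0, 0, s *: v, 0); rewrite JlinE !(mul0mx, mulmx0, trmx0, subr0) !frob0l.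
  rewrite quad_scale -/q.
  have hq : s * - q <= s ^+ 2 * - q by rewrite ler_wpM2r ?(ltW q0)// expr2 ler_peMl//; lra.
  by have := ler_norm a; lra.
have [rY|nrY _] := pselect (ran Y^T `<=` ran L1); last first.
  (* With [w] in the kernel of [L1], the parameter [u *m w^T] has no quadratic term, so the minorant
     is linear in [s] with nonzero slope. *)
  have [y [[u _ <-] /notin_ran[w [Lw yw]]]] : exists y, ran Y^T y /\ ~ ran L1 y.
    apply: contrapT => /forallNP h; apply: nrY => y Yy.
    by apply: contrapT => nL; exact: (h y (conj Yy nL)).
  apply: (lin (fun s => (s *: (u *m w^T), 0, 0, 0))) yw _ => s.
  rewrite JlinE !(mul0mx, mulmx0, trmx0, subr0) !frob0l.
  have -> : s *: (u *m w^T) *m L1 = 0.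
    by rewrite -scalemxAl -mulmxA -{1}sL1 -trmx_mul -{1}sL1 Lw trmx0 mulmx0 scaler0.
  rewrite !(mulmx0, frob0l) frobZl frob_colrow trmx_mul trmxK !mxE; lra.
have [rX|nrX _] := pselect (ran (row_mx Y Z) `<=` ran X); last first.
  have [y [[u _ <-] /notin_ran[w [Xw yw]]]] : exists y, ran (row_mx Y Z) y /\ ~ ran X y.
    apply: contrapT => /forallNP h; apply: nrX => y Yy.
    by apply: contrapT => nL; exact: (h y (conj Yy nL)).
  (* [u] is split into its [Y] and [Z] parts; [w] lies in the kernel of [X], so both quadratic terms
     vanish. *)
  pose p s := (s *: (w *m (usubmx u)^T), s *: (w *m (dsubmx u)^T), 0 : 'cV[R]_n, 0 : 'M[R]_n).
  apply: (lin p) yw _ => s.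
  rewrite /p JlinE !(mul0mx, mulmx0, trmx0, subr0) !frob0l.
  have X0 m (D : 'rV[R]_m) (L : 'M[R]_m) : X *m (s *: (w *m D) *m L) = 0.
    by rewrite -scalemxAl -scalemxAr !mulmxA -sX Xw !mul0mx scaler0.
  rewrite !X0 !frob0r !frobZl !frob_colrow !(mulr0, subr0, addr0, add0r) -mulrDr.
  rewrite [X in _ - _ * X]mxE mulr0 subr0; congr (_ * _).
  have -> : ((row_mx Y Z *m u)^T *m w) 0 0 = (w^T *m (row_mx Y Z *m u)) 0 0.
    by rewrite -[in RHS](trmxK (row_mx Y Z *m u)) -trmx_mul [RHS]mxE.
  by rewrite -{3}[u]vsubmxK mul_row_col mulmxDr [RHS]mxE !mulmxA.
rewrite /J asboolT// lte_fin => aJ.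
set Xp := Defs.pinv X in aJ; set P := Defs.pinv L1 in aJ.
(* Equality case of Fenchel-Young: [B *m L1] must be [Xp *m Y *m P], and [C *m L2] must be
   [Xp *m Z *m invmx L2]. *)
exists (Xp *m Y *m P *m P, Xp *m Z *m invmx L2 *m invmx L2, 0, 0).
rewrite JlinE !(mul0mx, mulmx0, trmx0, subr0) !frob0l.
have sP : P^T = P by exact: pinv_sym.
have [_ X2 _ _] := pinvP X; have [_ P2 _ _] := pinvP L1.
have siL2 : (invmx L2)^T = invmx L2 by rewrite trmx_inv sL2.
have PPL : Xp *m Y *m P *m P *m L1 = Xp *m Y *m P.
  by rewrite -!mulmxA (pinv_symC sL1) (mulmxA P) P2.
rewrite PPL mulmxKV//.
have qX m (U : 'M[R]_(n, m)) : frob (Xp *m U) (X *m (Xp *m U)) = frob U (Xp *m U).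
  have sXp : Xp^T = Xp by exact: pinv_sym.
  by rewrite frobC frob_mull sXp !mulmxA X2 frobC.
have -> : frob (Xp *m Y *m P *m P) Y = frob (Y *m P) (Xp *m Y *m P).
  by rewrite -{2}sP -frob_mulr frobC.
have -> : frob (Xp *m Z *m invmx L2 *m invmx L2) Z =
    frob (Z *m invmx L2) (Xp *m Z *m invmx L2).
  by rewrite -{2}siL2 -frob_mulr frobC.
move: aJ; rewrite [X in _ - _ * X]mxE -!(mulmxA Xp) !qX; lra.
Qed.

End ActionDensity.

(** * Charges built from real-valued set functions *)

Section ChargeConstructions.
Context {d} {T : measurableType d} {R : realType}.

Definition sigma_additive_fun (phi : set T -> R) :=
  forall F : nat -> set T, (forall i, measurable (F i)) -> trivIset setT F ->
    \sum_(i < N) phi (F i) @[N --> \oo] --> phi (\bigcup_i F i).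

Section of_fun.
Variable phi : set T -> R.
Hypothesis phi0 : phi set0 = 0.
Hypothesis phi_sigma : sigma_additive_fun phi.

Definition charge_fun (A : set T) : \bar R := (phi A)%:E.

Let charge_fun0 : charge_fun set0 = 0%E. Proof. by rewrite /charge_fun phi0. Qed.

Let charge_fun_fin A : measurable A -> charge_fun A \is a fin_num. Proof. by []. Qed.

Let charge_fun_sigma : semi_sigma_additive charge_fun.
Proof.
move=> F mF tF mUF; rewrite /charge_fun.
under eq_fun do rewrite sumEFin big_mkord.
apply/fine_cvgP; split; first exact: nearW.
exact: phi_sigma.
Qed.

HB.instance Definition _ := isCharge.Build _ _ _ charge_fun
  charge_fun0 charge_fun_fin charge_fun_sigma.

Definition charge_of_fun : {charge set T -> \bar R} := charge_fun.

End of_fun.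

Lemma charge_of_funP (phi : set T -> R) : phi set0 = 0 -> sigma_additive_fun phi ->
  exists nu : {charge set T -> \bar R}, forall A, fine (nu A) = phi A.
Proof. by move=> h0 hs; exists (charge_of_fun h0 hs). Qed.

Lemma charge_sigma_additive_fun (nu : {charge set T -> \bar R}) :
  sigma_additive_fun (fun A => fine (nu A)).
Proof.
move=> F mF tF.
have mUF : measurable (\bigcup_i F i) by exact: bigcup_measurable.
have := @charge_semi_sigma_additive _ _ _ nu F mF tF mUF.
rewrite -[X in _ --> X]fineK ?fin_num_measure// => /fine_cvg.
move=> h; apply: cvg_trans h; apply: near_eq_cvg; apply: nearW => N /=.
by rewrite big_mkord -sum_fine// => i _; rewrite fin_num_measure.
Qed.

(** Finite additivity survives uniform limits; countable additivity then follows by comparing with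
    one [eta J] whose error does not depend on the set. *)
Lemma charge_uniform_limit (eta : nat -> {charge set T -> \bar R}) (phi : set T -> R) :
  (forall e : R, 0 < e -> exists J, forall A, measurable A -> `|phi A - fine (eta J A)| <= e) ->
  phi set0 = 0 /\ sigma_additive_fun phi.
Proof.
move=> H; split.
  apply/eqP; rewrite -normr_le0; apply/ler_addgt0Pr => e e0; rewrite add0r.
  have [J hJ] := H _ e0.
  by have := hJ set0 measurable0; rewrite charge0 subr0.
move=> F mF tF.
have mUF : measurable (\bigcup_i F i) by exact: bigcup_measurable.
have mU N : measurable (\big[setU/set0]_(i < N) F i) by exact: bigsetU_measurable.
have fin_add N : phi (\big[setU/set0]_(i < N) F i) = \sum_(i < N) phi (F i).
  apply/eqP; rewrite -subr_eq0 -normr_le0; apply/ler_addgt0Pr => e e0; rewrite add0r.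
  have N0 : (0 : R) < N.+1%:R by rewrite ltr0n.
  (* The limit is compared with [eta J] on [N.+1] sets: the union and its [N] pieces. *)
  have [J hJ] := H (e / N.+1%:R) (divr_gt0 e0 N0).
  have E := fine_charge_bigsetU (eta J) N mF tF.
  rewrite -(subrK (fine (eta J (\big[setU/set0]_(i < N) F i))) (phi _)).
  rewrite {2}E -addrA -sumrB (le_trans (ler_normD _ _))//.
  have -> : e = e / N.+1%:R + \sum_(i < N) e / N.+1%:R.
    by rewrite sumr_const card_ord -mulrS -[RHS]mulr_natr divfK// lt0r_neq0.
  rewrite lerD ?hJ// (le_trans (ler_norm_sum _ _ _))//.
  by apply: ler_sum => i _; rewrite distrC hJ.
apply/cvgrPdist_le => e e0.
have e30 : 0 < e / 3 by lra.
have [J hJ] := H _ e30.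
have /cvgrPdist_le/(_ _ e30) := @charge_sigma_additive_fun (eta J) F mF tF.
apply: filterS => N hN; rewrite -fin_add.
rewrite -fine_charge_bigsetU// in hN.
have := hJ _ mUF; have := hJ _ (mU N); move: hN.
rewrite !ler_norml => /andP[? ?] /andP[? ?] /andP[? ?].
by apply/andP; split; lra.
Qed.

Lemma charge_lincomb (I : Type) (s : seq I) (a : I -> R)
    (nu : I -> {charge set T -> \bar R}) :
  exists eta : {charge set T -> \bar R}, forall A, measurable A ->
    fine (eta A) = \sum_(i <- s) a i * fine (nu i A).
Proof.
elim: s => [|i s [eta IH]].
  by exists czero => A mA; rewrite big_nil.
exists (cadd (cscale (a i) (nu i)) eta) => A mA.
rewrite big_cons /cadd/= fineD ?fin_num_measure//.
by rewrite fineM ?fin_num_measure// IH.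
Qed.

End ChargeConstructions.

Lemma charge_pushforward d d' (T : measurableType d) (T' : measurableType d')
    (R : realType) (S : T' -> T) (nu : {charge set T' -> \bar R}) : measurable_fun setT S ->
  exists eta : {charge set T -> \bar R}, forall A, measurable A ->
    fine (eta A) = fine (nu (S @^-1` A)).
Proof.
move=> mS; have mSA A : measurable A -> measurable (S @^-1` A).
  by move=> mA; rewrite -[X in measurable X]setTI; exact: mS.
pose phi A := fine (nu (S @^-1` A)).
have phi0 : phi set0 = 0 by rewrite /phi preimage_set0 charge0.
have phis : sigma_additive_fun phi.
  move=> F mF tF; rewrite /phi preimage_bigcup.
  apply: (@charge_sigma_additive_fun _ _ _ nu (fun i => S @^-1` F i)).
    by move=> i; exact: mSA.
  apply/trivIsetP => /= i j _ _ ij; rewrite -preimage_setI.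
  by move/trivIsetP : tF => /(_ _ _ I I ij) ->; rewrite preimage_set0.
by have [eta h] := charge_of_funP phi0 phis; exists eta => A _; exact: h.
Qed.

Section EntrywiseLimits.
Context {R : realType}.

Lemma cvg_sum_ord (N : nat) (F : 'I_N -> nat -> R) (l : 'I_N -> R) :
  (forall i, F i j @[j --> \oo] --> l i) ->
  \sum_i F i j @[j --> \oo] --> \sum_i l i.
Proof.
elim: N F l => [|N IH] F l h.
  by rewrite big_ord0; under eq_fun do rewrite big_ord0; exact: cvg_cst.
rewrite big_ord_recr/=; under eq_fun do rewrite big_ord_recr/=.
by apply: cvgD => //; exact: IH.
Qed.

Definition mxcvg m n (A_ : nat -> 'M[R]_(m, n)) (A : 'M[R]_(m, n)) :=
  forall i j, A_ l i j @[l --> \oo] --> A i j.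

Lemma mxcvg_cst m n (A : 'M[R]_(m, n)) : mxcvg (fun=> A) A.
Proof. by move=> i j; exact: cvg_cst. Qed.

Lemma mxcvg_mul m n p A_ (A : 'M[R]_(m, n)) B_ (B : 'M[R]_(n, p)) :
  mxcvg A_ A -> mxcvg B_ B -> mxcvg (fun l => A_ l *m B_ l) (A *m B).
Proof.
move=> hA hB i j; rewrite mxE; under eq_fun do rewrite mxE.
by apply: cvg_sum_ord => k; exact: cvgM.
Qed.

Lemma mxcvg_tr m n A_ (A : 'M[R]_(m, n)) : mxcvg A_ A -> mxcvg (fun l => (A_ l)^T) A^T.
Proof. by move=> hA i j; rewrite mxE; under eq_fun do rewrite mxE; exact: hA. Qed.

Lemma mxcvg_sub m n A_ (A : 'M[R]_(m, n)) B_ B :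
  mxcvg A_ A -> mxcvg B_ B -> mxcvg (fun l => A_ l - B_ l) (A - B).
Proof.
by move=> hA hB i j; rewrite !mxE; under eq_fun do rewrite !mxE; exact: cvgB.
Qed.

Lemma cvg_frob m n A_ (A : 'M[R]_(m, n)) B_ B :
  mxcvg A_ A -> mxcvg B_ B -> frob (A_ l) (B_ l) @[l --> \oo] --> frob A B.
Proof.
move=> hA hB; rewrite frobE; under eq_fun do rewrite frobE.
by apply: cvg_sum_ord => i; apply: cvg_sum_ord => j; exact: cvgM.
Qed.

Lemma mxrat_cvg m n (A : 'M[R]_(m, n)) :
  exists A_ : nat -> 'M[rat]_(m, n), mxcvg (fun l => map_mx ratr (A_ l)) A.
Proof.
have h (l : nat) i j : exists q : rat, `|A i j - ratr q| < l.+1%:R^-1.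
  have l0 : 0 < l.+1%:R^-1 :> R by rewrite invr_gt0 ltr0n.
  have : A i j < A i j + l.+1%:R^-1 by rewrite ltrDl.
  move=> /rat_in_itvoo[q]; rewrite in_itv/= => /andP[h1 h2]; exists q.
  by rewrite distrC gtr0_norm ?subr_gt0// ltrBlDl.
exists (fun l => \matrix_(i, j) projT1 (cid (h l i j))) => i j.
apply/cvgrPdist_lt => e e0; near=> l.
rewrite !mxE; apply: lt_trans (projT2 (cid (h l i j))) _.
by near: l; exact: near_infty_natSinv_lt (PosNum e0).
Unshelve. all: by end_near.
Qed.

End EntrywiseLimits.

(** * The action as a supremum of finite sums of linear minorants *)

Section ActionDuality.
Context {R : realType} {E : normedModType R} {n k : nat}.
Variables (L1 : 'M[R]_k) (L2 : 'M[R]_n).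
Hypotheses (sL1 : L1^T = L1) (sL2 : L2^T = L2) (uL2 : L2 \in unitmx).
Implicit Types (G : mxmeasure E n n) (q : mxmeasure E n k) (r : mxmeasure E n n).

(** A countable family suffices for the supremum, by continuity of [Jlin] in its parameter and
    density of the rationals; this is what allows monotone convergence. The zero minorant comes
    first so that partial maxima are nonnegative. *)
Lemma Jlin_dense : exists p : nat -> @dual_param R n k,
  (forall X Y Z, Jlin L1 L2 (p 0%N) X Y Z = 0) /\
  (forall X Y Z a, (a%:E < J L1 L2 X Y Z)%E -> exists m, a < Jlin L1 L2 (p m) X Y Z).
Proof.
pose rp (x : 'M[rat]_(n, k) * 'M[rat]_n * 'cV[rat]_n * 'M[rat]_n) : @dual_param R n k :=
  (map_mx ratr x.1.1.1, map_mx ratr x.1.1.2, map_mx ratr x.1.2, map_mx ratr x.2).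
exists (fun m => if m is l.+1 then if unpickle l is Some x then rp x else (0, 0, 0, 0)
  else (0, 0, 0, 0)); split.
  move=> X Y Z; rewrite JlinE !(mul0mx, mulmx0, trmx0, subr0) !frob0l mxE; lra.
move=> X Y Z a /(Jlin_sup sL1 sL2 uL2)[[[[B C] v] W] aJ].
have [B_ hB] := mxrat_cvg B; have [C_ hC] := mxrat_cvg C.
have [v_ hv] := mxrat_cvg v; have [W_ hW] := mxrat_cvg W.
have : Jlin L1 L2 (rp (B_ l, C_ l, v_ l, W_ l)) X Y Z @[l --> \oo] -->
    Jlin L1 L2 (B, C, v, W) X Y Z.
  rewrite JlinE; under eq_fun do rewrite JlinE.
  have hL m (L : 'M[R]_m) D_ (D : 'M[R]_(n, m)) : mxcvg D_ D ->
      mxcvg (fun l => D_ l *m L) (D *m L).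
    by move=> hD; apply: mxcvg_mul => //; exact: mxcvg_cst.
  have hq m (L : 'M[R]_m) D_ (D : 'M[R]_(n, m)) : mxcvg D_ D ->
      2^-1 * frob (D_ l *m L) (X *m (D_ l *m L)) @[l --> \oo] -->
      2^-1 * frob (D *m L) (X *m (D *m L)).
    move=> hD; apply: cvgM; first exact: cvg_cst.
    apply: cvg_frob; first exact: hL.
    by apply: mxcvg_mul; [exact: mxcvg_cst|exact: hL].
  apply: cvgB; first (apply: cvgD; first apply: cvgD).
  - apply: cvg_frob; last exact: mxcvg_cst.
    by apply: mxcvg_sub => //; exact: mxcvg_tr.
  - by apply: cvgB; [apply: cvg_frob => //; exact: mxcvg_cst|exact: hq].
  - by apply: cvgB; [apply: cvg_frob => //; exact: mxcvg_cst|exact: hq].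
  - apply: cvgM; first exact: cvg_cst.
    apply: mxcvg_mul => //; apply: mxcvg_mul; last exact: mxcvg_cst.
    exact: mxcvg_tr.
move=> /cvgr_gt/(_ _ aJ) [l _ /(_ l)/= hl].
by exists (pickle (B_ l, C_ l, v_ l, W_ l)).+1; rewrite pickleK; exact: hl.
Qed.

(* Dual form of a bound on the action.  It only involves linear functions of the
   values of the measures, so subadditivity, rescaling and lower semicontinuity of
   the action are immediate. *)
Definition action_le G q r (a : R) :=
  forall (F : nat -> set (borel E)) (p : nat -> dual_param) N,
  (forall i, measurable (F i)) -> trivIset setT F ->
  \sum_(i < N) Jlin L1 L2 (p i) (mval G (F i)) (mval q (F i)) (mval r (F i)) <= a.

Lemma entry_dominated m l (mu : mxmeasure E m l) i j : mu i j `<< Defs.total_variation mu.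
Proof.
apply/null_content_dominatesP => A mA tvA.
have : Defs.variation (mu i j) A = 0%E.
  apply/eqP; rewrite eq_le measure_ge0 andbT -tvA.
  rewrite [X in (_ <= X)%E](_ : _ = \sum_(p : 'I_m * 'I_l) Defs.variation (mu p.1 p.2) A)%E//.
  rewrite (bigD1 (i, j))//= leeDl// sume_ge0// => p _; exact: measure_ge0.
move=> vA; apply/eqP; rewrite -abse_eq0 eq_le abse_ge0 andbT -vA.
exact: abse_charge_variation.
Qed.

Section FixedMeasure.
Variables (K : set E) (G : mxmeasure E n n) (q : mxmeasure E n k) (r : mxmeasure E n n).
Hypothesis mK : measurable (K : set (borel E)).
Hypotheses (GK : measures K setT G) (qK : measures K setT q) (rK : measures K setT r).

Let la : {finite_measure set (borel E) -> \bar R}   := Defs.total_variation (row_mx G (row_mx q r)).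

Let domG i j : G i j `<< la.
Proof.
by have := @entry_dominated _ _ (row_mx G (row_mx q r)) i (lshift _ j); rewrite row_mxEl.
Qed.

Let domq i j : q i j `<< la.
Proof.
have := @entry_dominated _ _ (row_mx G (row_mx q r)) i (rshift _ (lshift _ j)).
by rewrite row_mxEr row_mxEl.
Qed.

Let domr i j : r i j `<< la.
Proof.
have := @entry_dominated _ _ (row_mx G (row_mx q r)) i (rshift _ (rshift _ j)).
by rewrite !row_mxEr.
Qed.

Let int_frob m l (mu : mxmeasure E m l) (M : 'M[R]_(m, l)) (A : set (borel E)) :
  (forall i j, mu i j `<< la) -> measurable A ->
  la.-integrable A (EFin \o (fun x => frob M (density la mu x))) /\
  \int[la]_(x in A) frob M (density la mu x) = frob M (mval mu A).
Proof.
move=> dom mA.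
(* This predicate is closed under sums, so the claim reduces to single entries, where it is the
   Radon-Nikodym theorem. *)
pose P (g : borel E -> R) v := la.-integrable A (EFin \o g) /\ \int[la]_(x in A) g x = v.
have P0 : P (fun=> 0) 0.
  by split; [exact: finite_measure_integrable_cst|rewrite Rintegral_cst// mul0r].
have PD g h v w : P g v -> P h w -> P (fun x => g x + h x) (v + w).
  by move=> [ig <-] [ih <-]; split; [exact: (integrableD mA ig ih)|rewrite RintegralD].
have Psum (N : nat) (g : 'I_N -> borel E -> R) v : (forall i, P (g i) (v i)) ->
    P (fun x => \sum_i g i x) (\sum_i v i).
  move=> Pg; elim: N g v Pg => [|N IH] g v Pg.
    by rewrite big_ord0; under eq_fun do rewrite big_ord0.
  by rewrite big_ord_recr/=; under eq_fun do rewrite big_ord_recr/=; apply: PD => //; exact: IH.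
have Pd i j : P (fun x => density la mu x i j) (mval mu A i j).
  have E1 : EFin \o (fun x => density la mu x i j) = Radon_Nikodym (mu i j) la.
    apply/funext => x /=; rewrite !mxE fineK//; apply: Radon_Nikodym_fin_num; exact: dom.
  split.
    rewrite E1; apply: (integrableS measurableT) => //.
    exact: Radon_Nikodym_integrable.
  rewrite mxE (Radon_Nikodym_integral (dom i j) mA) /Rintegral; congr fine.
  apply: eq_integral => x _; exact: (congr1 (fun f => f x) E1).
change (P (fun x => frob M (density la mu x)) (frob M (mval mu A))).
rewrite frobE; under [X in P X _]eq_fun do rewrite frobE.
apply: (Psum m (fun i x => \sum_j M i j * density la mu x i j)) => i.
apply: (Psum l (fun j x => M i j * density la mu x i j)) => j.
have [h1 h2] := Pd i j; split; last by rewrite RintegralZl// h2.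
exact: (integrableZl mA _ h1).
Qed.

Let jl p x := Jlin L1 L2 p (density la G x) (density la q x) (density la r x).

Let jl_int p (A : set (borel E)) : measurable A ->
  la.-integrable A (EFin \o jl p) /\
  \int[la]_(x in A) jl p x = Jlin L1 L2 p (mval G A) (mval q A) (mval r A).
Proof.
move=> mA; rewrite /jl /Jlin.
have [iG EG] := int_frob (dual_coef L1 L2 p) domG mA.
have [iq Eq] := int_frob p.1.1.1 domq mA.
have [ir Er] := int_frob p.1.1.2 domr mA.
have iGq := integrableD mA iG iq; split; first exact: (integrableD mA iGq ir).
by rewrite RintegralD// RintegralD// EG Eq Er.
Qed.

Let mjl p : measurable_fun setT (jl p : borel E -> R).
Proof. by have [/measurable_int/measurable_EFinP] := jl_int p measurableT. Qed.

Let mval_restr m l (mu : mxmeasure E m l) (A : set (borel E)) :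
  measures K setT mu -> measurable A -> mval mu A = mval mu (A `&` K).
Proof.
move=> muK mA; have mAK : measurable (A `&` K) by exact: measurableI.
have mAD : measurable (A `\` K) by exact: measurableD.
apply/matrixP => i j; rewrite !mxE -[in LHS](setUIDK A K) fine_chargeU//.
  have [_ /(_ _)] := muK _ mAD.
  have -> : (A `\` K) `&` K = set0 by rewrite setIC setDIK.
  by move=> /(_ erefl)/matrixP/(_ i j); rewrite !mxE => ->; rewrite addr0.
by rewrite setDE setIACA setICr setI0.
Qed.

Let Jx x := J L1 L2 (density la G x) (density la q x) (density la r x).

(** From left to right, a minorant evaluated on the values over a set is the integral of that
    minorant of the densities, hence at most the integral of J over the set. Conversely, J is the
    increasing limit of finite maxima of minorants, and on the set where a given minorant attains
    the maximum the integral is again a minorant evaluated on values. *)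
Lemma action_leP (a : R) :
  (action L1 L2 K (G, q, r) <= a%:E)%E <-> action_le G q r a.
Proof.
have [p [p0 pJ]] := Jlin_dense.
(* Maximum of the first [M.+1] minorants. *)
pose h := fix h M x := if M is M'.+1 then Num.max (h M' x) (jl (p M) x) else jl (p 0%N) x.
have h0 M x : 0 <= h M x.
  elim: M => [|M IH] /=; first by rewrite /jl p0.
  by rewrite le_max IH.
have h_nd x : {homo (fun M => (h M x)%:E) : a b / (a <= b)%N >-> (a <= b)%E}.
  by apply/nondecreasing_seqP => M; rewrite lee_fin /= le_max lexx.
have mh M : measurable_fun setT (h M : borel E -> R).
  elim: M => [|M IH] /=; first exact: mjl.
  exact: measurable_maxr.
have jlh m x : jl (p m) x <= h m x.
  by case: m => //= m; rewrite le_max lexx orbT.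
have hJ M x : ((h M x)%:E <= Jx x)%E.
  elim: M => [|M IH] /=; first exact: Jlin_le.
  by rewrite EFin_max ge_max IH; exact: Jlin_le.
have hcvg x : (h M x)%:E @[M --> \oo] --> Jx x.
  suff <- : ereal_sup (range (fun M => (h M x)%:E)) = Jx x.
    exact: ereal_nondecreasing_cvgn.
  apply/eqP; rewrite eq_le; apply/andP; split.
    by apply: ge_ereal_sup => _ [M _ <-]; exact: hJ.
  set S := ereal_sup _; rewrite leNgt; apply/negP => SJ.
  have hS M : ((h M x)%:E <= S)%E by apply: ereal_sup_ubound; exists M.
  have Sfin : S \is a fin_num.
    rewrite ge0_fin_numE; first exact: lt_le_trans SJ (leey _).
    by apply: le_trans (hS 0%N); rewrite lee_fin.
  move: SJ; rewrite -(fineK Sfin) => /pJ[m]; apply/negP; rewrite -leNgt.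
  by rewrite -lee_fin fineK//; apply: le_trans (hS m); rewrite lee_fin; exact: jlh.
have Jx0 x : (0 <= Jx x)%E by apply: le_trans (hJ 0%N x); rewrite lee_fin.
have mJ : measurable_fun setT (Jx : borel E -> \bar R).
  apply: (@emeasurable_fun_cvg _ (borel E) R setT (fun M => EFin \o h M)).
    by move=> M; exact/measurable_EFinP.
  by move=> x _; exact: hcvg.
have jlJ m (A : set (borel E)) : measurable A ->
    ((Jlin L1 L2 m (mval G A) (mval q A) (mval r A))%:E <= \int[la]_(x in A) Jx x)%E.
  move=> mA; have [ijl <-] := jl_int m mA.
  have [->|intJ] := eqVneq (\int[la]_(x in A) Jx x)%E +oo%E; first by rewrite leey.
  rewrite /Rintegral fineK; last exact: integrable_fin_num.
  apply: le_integral => //; last by move=> x _; exact: Jlin_le.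
  apply/integrableP; split; first exact: measurable_funTS.
  under eq_integral => x _ do rewrite gee0_abs//.
  by rewrite ltey.
change (action L1 L2 K (G, q, r)) with (\int[la]_(x in K) Jx x)%E.
split=> [aJ F m N mF tF|aF].
  rewrite -lee_fin; apply: le_trans aJ; rewrite -sumEFin.
  have mFK i : measurable (F i `&` K : set (borel E)) by exact: measurableI.
  apply: (@le_trans _ _ (\sum_(i < N) \int[la]_(x in F i `&` K) Jx x)%E).
    apply: lee_sum => i _.
    by rewrite (mval_restr GK (mF i)) (mval_restr qK (mF i)) (mval_restr rK (mF i)); exact: jlJ.
  have tFK : trivIset [set` index_enum 'I_N] (fun i : 'I_N => F i `&` K).
    apply/trivIsetP => i j _ _ ij; rewrite setIACA.
    by move/trivIsetP : tF => /(_ i j I I ij) ->; rewrite set0I.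
  rewrite -(@ge0_integral_bigsetU _ _ _ la _ (fun i : 'I_N => F i `&` K))//=.
  - apply: ge0_subset_integral => //.
    + exact: bigsetU_measurable.
    + exact: measurable_funTS.
    + by rewrite -bigcup_seq => x [i _ []].
  - exact: index_enum_uniq.
  - exact: measurable_funTS.
(* The least index attaining the maximum [h M x]: its level sets give the finite partition on which
   the hypothesis is applied. *)
pose s := fix s M x := if M is M'.+1 then if h M' x < jl (p M) x then M else s M' x else 0%N.
have hs M x : h M x = jl (p (s M x)) x.
  elim: M => // M IH; by rewrite [LHS]/= [s _ _]/=; case: ltP.
have sM M x : (s M x <= M)%N.
  by elim: M => // M IH; rewrite /=; case: ifP => // _; exact: leqW.
have mW M : measurable ([set x | h M x < jl (p M.+1) x] : set (borel E)).
  rewrite -[X in measurable X]setTI.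
  have := measurable_fun_ltr (mh M) (mjl (p M.+1)).
  by move=> /(_ measurableT [set true] I); rewrite !setTI.
have ms M i : measurable ([set x | s M x = i] : set (borel E)).
  elim: M => [|M IH].
    have [->|/eqP i0] := eqVneq i 0%N.
      by rewrite (_ : [set _ | _] = setT)//; apply/seteqP; split.
    rewrite (_ : [set _ | _] = set0)//; apply/seteqP; split => // x /= /esym.
    by move/i0.
  rewrite (_ : [set _ | _] = ([set x | h M x < jl (p M.+1) x] `&` (if M.+1 == i then setT else set0))
      `|` (~` [set x | h M x < jl (p M.+1) x] `&` [set x | s M x = i])).
    apply: measurableU; apply: measurableI => //; last exact: measurableC.
    by case: ifP.
  apply/seteqP; split => x /=.
    case: ifPn => hM; first by move=> <-; left; rewrite eqxx.
    by move=> <-; right.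
  by move=> [[-> ]|[/negP/negbTE -> ->]]//; case: eqP.
have <- : (\int[la]_(x in K) limn (fun M => (h M x)%:E) = \int[la]_(x in K) Jx x)%E.
  by apply: eq_integral => x _; exact: cvg_lim.
rewrite monotone_convergence//; last 2 first.
  - by move=> M; apply: measurable_funTS; exact/measurable_EFinP.
  - by move=> M x _; rewrite lee_fin.
apply: lime_le.
  apply: ereal_nondecreasing_is_cvgn; apply/nondecreasing_seqP => M.
  apply: ge0_le_integral => //.
  - by move=> x _; rewrite lee_fin.
  - by apply: measurable_funTS; exact/measurable_EFinP.
  - by apply: measurable_funTS; exact/measurable_EFinP.
  - by move=> x _; exact: h_nd.
apply: nearW => M.
pose F i : set (borel E) := [set x | s M x = i] `&` K.
have mF i : measurable (F i) by exact: measurableI.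
have tF : trivIset setT F.
  apply/trivIsetP => i j _ _ /eqP ij; apply/seteqP; split => // x [[/= si _] [/= sj _]].
  by apply: ij; rewrite -si -sj.
have KF : K = \big[setU/set0]_(i < M.+1) F i.
  apply/seteqP; split => x; rewrite -bigcup_mkord.
    by move=> Kx; exists (s M x); [rewrite /= ltnS|split].
  by move=> [i _ []].
rewrite KF ge0_integral_bigsetU//=.
- apply: le_trans (_ : (\sum_(i < M.+1)
      Jlin L1 L2 (p i) (mval G (F i)) (mval q (F i)) (mval r (F i)))%:E <= a%:E)%E; last first.
    by rewrite lee_fin; exact: aF.
  rewrite -sumEFin; apply: lee_sum => i _.
  have [ijl <-] := jl_int (p i) (mF i).
  rewrite /Rintegral fineK; last exact: integrable_fin_num.
  rewrite le_eqVlt; apply/orP; left; apply/eqP; apply: eq_integral => x.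
  by rewrite inE => -[/= <- _]; rewrite /= hs.
- exact: index_enum_uniq.
- by apply/trivIsetP => i j _ _ ij; move/trivIsetP : tF; apply.
- by apply: measurable_funTS; exact/measurable_EFinP.
- by move=> x _; rewrite lee_fin.
Qed.

End FixedMeasure.
End ActionDuality.

(** * Continuous functions on compact sets and the Riesz representation theorem *)

Section WithinContinuity.
Context {R : realType} {E : normedModType R}.
Implicit Types (K : set E) (f g : E -> R).

Lemma within_continuous_normP {V : normedModType R} K (f : E -> V) :
  {within K, continuous f} <->
  forall x, K x -> forall e : R, 0 < e ->
    exists2 r : R, 0 < r & forall y, K y -> `|x - y| < r -> `|f x - f y| < e.
Proof.
rewrite subspace_continuousP; split=> h x Kx.
  move=> e e0; have := h x Kx => /cvgrPdist_lt/(_ e e0).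
  rewrite /within /= => /nbhs_ballP[r /= r0 hr]; exists r => // y Ky xy.
  by apply: (hr y) => //; rewrite -ball_normE.
apply/cvgrPdist_lt => e e0; have [r r0 hr] := h x Kx e e0.
apply/nbhs_ballP; exists r => //= y; rewrite -ball_normE /= => xy Ky.
exact: hr.
Qed.

Lemma uniform_continuous_compact {V : normedModType R} K (f : E -> V) : compact K ->
  {within K, continuous f} -> forall e : R, 0 < e ->
  exists2 r : R, 0 < r & forall x y, K x -> K y -> `|x - y| < r -> `|f x - f y| < e.
Proof.
move=> /compact_near_coveringP cK /within_continuous_normP cf e e0.
pose P (r : R) x := 0 < r -> K x -> forall y, K y -> `|x - y| < r -> `|f x - f y| < e.
have : \forall r \near (0 : R)^'+, K `<=` P r.
  apply: cK => x Kx.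
  have e20 : 0 < e / 2 by rewrite divr_gt0.
  have [r r0 hr] := cf x Kx _ e20.
  exists (ball x (r / 2), [set s | s < r / 2]) => /=.
    split; first by apply: nbhsx_ballx; rewrite divr_gt0.
    by apply: nbhs_right_lt; rewrite divr_gt0.
  move=> [z s] /= [] ; rewrite -ball_normE /= => xz sr _ Kz y Ky zy.
  have hxz : `|x - z| < r by apply: lt_trans xz _; rewrite ltr_pdivrMr// mulr_natr mulr2n ltrDl.
  have hxy : `|x - y| < r.
    rewrite -(subrK z x) -addrA (le_lt_trans (ler_normD _ _))// [ltRHS]splitr.
    by rewrite ltrD// (lt_trans zy).
  rewrite -(subrK (f x) (f z)) -addrA (le_lt_trans (ler_normD _ _))// [ltRHS]splitr.
  by rewrite ltrD// ?hr// distrC hr.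
move=> H; near (0 : R)^'+ => r; exists r => // x y Kx Ky xy.
have hP : K `<=` P r by near: r.
by apply: (hP x) => //.
Unshelve. all: by end_near.
Qed.

Lemma within_cst K (a : R) : {within K, continuous (fun=> a)}.
Proof. by apply/subspace_continuousP => x _; exact: cvg_cst. Qed.

Lemma withinD K f g : {within K, continuous f} -> {within K, continuous g} ->
  {within K, continuous (fun x => f x + g x)}.
Proof.
move=> /subspace_continuousP cf /subspace_continuousP cg.
by apply/subspace_continuousP => x Kx; apply: cvgD; [exact: cf|exact: cg].
Qed.

Lemma withinM K f g : {within K, continuous f} -> {within K, continuous g} ->
  {within K, continuous (fun x => f x * g x)}.
Proof.
move=> /subspace_continuousP cf /subspace_continuousP cg.
by apply/subspace_continuousP => x Kx; apply: cvgM; [exact: cf|exact: cg].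
Qed.

Lemma withinZ K f a : {within K, continuous f} -> {within K, continuous (fun x => a * f x)}.
Proof. by move=> cf; apply: withinM => //; exact: within_cst. Qed.

Lemma withinN K f : {within K, continuous f} -> {within K, continuous (fun x => - f x)}.
Proof.
move=> /subspace_continuousP cf.
by apply/subspace_continuousP => x Kx; apply: cvgN; exact: cf.
Qed.

Lemma within_sum K (I : Type) (s : seq I) (f : I -> E -> R) :
  (forall i, {within K, continuous (f i)}) -> {within K, continuous (fun x => \sum_(i <- s) f i x)}.
Proof.
move=> cf; elim: s => [|i s IH].
  by under eq_fun do rewrite big_nil; exact: within_cst.
by under eq_fun do rewrite big_cons; exact: withinD.
Qed.

Lemma within_compact_bounded K f : compact K -> {within K, continuous f} ->
  exists M, 0 < M /\ forall x, K x -> `|f x| <= M.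
Proof.
move=> cK cf; have /compact_bounded[M [_ hM]] := continuous_compact cf cK.
exists (`|M| + 1); split=> [|x Kx]; first by rewrite ltr_wpDl.
by apply: hM; [rewrite ltr_pwDr// ler_norm|exists x].
Qed.

Lemma borel_open (U : set (borel E)) : open (U : set E) -> measurable U.
Proof. by move=> oU; exact: sub_gen_smallest. Qed.

Lemma borel_compact (K : set (borel E)) : compact (K : set E) -> measurable K.
Proof.
move=> cK; rewrite -[K]setCK; apply: measurableC; apply: borel_open.
by apply: closed_openC; apply: compact_closed => //; exact: norm_hausdorff.
Qed.

Lemma within_measurable K f : measurable (K : set (borel E)) -> {within K, continuous f} ->
  measurable_fun (K : set (borel E)) (f : borel E -> R).
Proof.
move=> mK /continuousP cf; apply: (measurability _ (RGenOpens.measurableE R)).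
move=> _ [_ [a [b ->] <-]].
have /open_subspaceP[V oV VE] : open (from_subspace K f @^-1` `]a, b[).
  by apply: cf; exact: interval_open.
rewrite [X in measurable X](_ : _ = V `&` K); last by rewrite VE setIC.
by apply: measurableI => //; exact: borel_open.
Qed.

End WithinContinuity.

(** * Continuous functions increasing to the indicator of an open set *)

Section DistanceToComplement.
Context {R : realType} {E : normedModType R}.
Variable U : set E.

(** The element 1 truncates the distance and keeps the infimum over a nonempty set when [U] is the
    whole space. *)
Let S x : set R := [set 1] `|` [set `|x - y| | y in ~` U].

Let S_lb x : has_lbound (S x).
Proof. by exists 0 => _ [->|[y _ <-]]. Qed.

Definition codist x := inf (S x).

Lemma codist_ge0 x : 0 <= codist x.
Proof. by apply: lb_le_inf; [exists 1; left|move=> _ [->|[y _ <-]]]. Qed.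

Lemma codist_out x : ~ U x -> codist x = 0.
Proof.
move=> Ux; apply/eqP; rewrite eq_le codist_ge0 andbT.
by apply: ge_inf => //; right; exists x; rewrite // subrr normr0.
Qed.

Lemma codist_gt0 x : open U -> U x -> 0 < codist x.
Proof.
move=> oU Ux; have /nbhs_ballP[e /= e0 eU] := open_nbhs_nbhs (conj oU Ux).
apply: (@lt_le_trans _ _ (Num.min 1 e)); first by rewrite lt_min ltr01.
apply: lb_le_inf; first by exists 1; left.
move=> _ [->|[y Uy <-]]; first by rewrite ge_min lexx.
rewrite ge_min; apply/orP; right; rewrite leNgt; apply/negP => xy.
by apply: Uy; apply: eU; rewrite -ball_normE.
Qed.

Lemma codist_lip x y : codist x <= codist y + `|x - y|.
Proof.
rewrite -lerBlDr; apply: lb_le_inf; first by exists 1; left.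
move=> _ [->|[z Uz <-]]; rewrite lerBlDr.
  apply: (@le_trans _ _ 1); last by rewrite lerDl.
  by apply: ge_inf => //; left.
apply: (@le_trans _ _ `|x - z|).
  by apply: ge_inf => //; right; exists z.
rewrite [leRHS]addrC; exact: ler_distD.
Qed.

Lemma codist_continuous : continuous codist.
Proof.
move=> x; apply/cvgrPdist_lt => e e0.
apply/nbhs_ballP; exists e => //= y; rewrite -ball_normE /= => xy.
apply: le_lt_trans xy.
rewrite ler_norml; apply/andP; split.
  by have := codist_lip y x; rewrite distrC; lra.
by have := codist_lip x y; lra.
Qed.

(** For open [U] this increases with [m] to the indicator of [U], and is eventually equal to it at
    each point. *)
Definition plateau (m : nat) x := Num.min 1 (m%:R * codist x).

Lemma plateau_continuous m : continuous (plateau m).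
Proof.
move=> x; apply: (@continuous_min _ _ (fun=> 1) (fun x => m%:R * codist x)).
  exact: cvg_cst.
by apply: cvgM; [exact: cvg_cst|exact: codist_continuous].
Qed.

Lemma plateau_ge0 m x : 0 <= plateau m x.
Proof. by rewrite le_min ler01 mulr_ge0// codist_ge0. Qed.

Lemma plateau_le1 m x : plateau m x <= 1.
Proof. by rewrite ge_min lexx. Qed.

Lemma plateau_nd m x : plateau m x <= plateau m.+1 x.
Proof.
rewrite le_min !ge_min lexx/=; apply/orP; right.
by rewrite ler_wpM2r ?codist_ge0// ler_nat.
Qed.

Lemma plateau_out m x : ~ U x -> plateau m x = 0.
Proof. by move=> Ux; rewrite /plateau codist_out// mulr0; apply/min_idPr. Qed.

Lemma plateau_in x : open U -> U x -> exists m0, forall m, (m0 <= m)%N -> plateau m x = 1.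
Proof.
move=> oU Ux; have c0 := codist_gt0 oU Ux.
exists (Num.truncn (codist x)^-1).+1 => m m0; apply/min_idPl.
have : (codist x)^-1 <= m%:R.
  apply: ltW; apply: lt_le_trans (truncnS_gt _) _; by rewrite ler_nat.
by rewrite -(ler_pM2r c0) mulVf// lt0r_neq0.
Qed.

End DistanceToComplement.

(** * The outer measure of a positive functional *)

Section RieszOuterMeasure.
Context {R : realType} {E : normedModType R}.
Variable K : set E.
Hypothesis cK : compact K.

Definition positive_functional (l : (E -> R) -> R) :=
  [/\ forall f g : E -> R, {within K, continuous f} -> {within K, continuous g} ->
        l (fun x => f x + g x) = l f + l g,
      forall a (f : E -> R), {within K, continuous f} -> l (fun x => a * f x) = a * l f &
      forall f : E -> R, {within K, continuous f} -> (forall x, K x -> 0 <= f x) -> 0 <= l f].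

(** The sequence stands for its supremum, a lower semicontinuous function at least 1 on [A]. The
    value 1 need not be attained by a member of the sequence, hence [1 - e]. *)
Definition riesz_cover (l : (E -> R) -> R) (A : set E) (s : R) (f : nat -> E -> R) :=
  [/\ forall n, {within K, continuous (f n)}, forall n x, K x -> 0 <= f n x,
      forall n x, K x -> f n x <= f n.+1 x,
      forall x, K x -> A x -> forall e : R, 0 < e -> exists n, 1 - e <= f n x &
      forall n, l (f n) <= s].

Definition riesz_values l A : set R := [set s | exists f, riesz_cover l A s f].

(* Daniell's construction: increasing sequences of continuous functions instead of
   countable open covers make countable subadditivity a diagonal argument. *)
Definition riesz_outer l (A : set E) : \bar R := (inf (riesz_values l A))%:E.

Variable l : (E -> R) -> R.
Hypothesis lP : positive_functional l.

Let lD (f g : E -> R) : {within K, continuous f} -> {within K, continuous g} ->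
  l (fun x => f x + g x) = l f + l g.
Proof. by case: lP => h _ _; exact: h. Qed.

Let lZ a (f : E -> R) : {within K, continuous f} -> l (fun x => a * f x) = a * l f.
Proof. by case: lP => _ h _; exact: h. Qed.

Let l_ge0 (f : E -> R) : {within K, continuous f} -> (forall x, K x -> 0 <= f x) -> 0 <= l f.
Proof. by case: lP => _ _ h; exact: h. Qed.

Lemma positive_functional_le (f g : E -> R) : {within K, continuous f} -> {within K, continuous g} ->
  (forall x, K x -> f x <= g x) -> l f <= l g.
Proof.
move=> cf cg fg; have := l_ge0 (withinD cg (@withinZ _ _ K f (-1) cf)).
rewrite lD//; last exact: withinZ.
rewrite lZ// => h; rewrite -subr_ge0 -mulN1r; apply: h => x Kx.
by rewrite mulN1r subr_ge0 fg.
Qed.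

Let l0 : l (fun=> 0) = 0.
Proof.
rewrite -[RHS](mul0r (l (fun=> 0))) -lZ; last exact: within_cst.
by congr l; apply/funext => x; rewrite mul0r.
Qed.

Let l_sum (N : nat) (f : nat -> E -> R) : (forall i, {within K, continuous (f i)}) ->
  l (fun x => \sum_(i < N) f i x) = \sum_(i < N) l (f i).
Proof.
move=> cf; elim: N => [|N IH].
  by rewrite big_ord0 -[RHS]l0; congr l; apply/funext => x; rewrite big_ord0.
rewrite big_ord_recr/= -IH -lD//; last exact: within_sum.
by congr l; apply/funext => x; rewrite big_ord_recr.
Qed.

Let l1_ge0 : 0 <= l (fun=> 1).
Proof. by apply: l_ge0 => //; exact: within_cst. Qed.

Let values_lb A : lbound (riesz_values l A) 0.
Proof.
move=> s [f [cf f0 _ _ fs]]; apply: le_trans (fs 0%N).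
by apply: l_ge0 => //; exact: f0.
Qed.

Let values1 A : riesz_values l A (l (fun=> 1)).
Proof.
exists (fun _ _ => 1); split => //.
  by move=> _; exact: within_cst.
by move=> x Kx _ e e0; exists 0%N; lra.
Qed.

Let values_inf A : has_inf (riesz_values l A).
Proof. by split; [exists (l (fun=> 1))|exists 0; exact: values_lb]. Qed.

Let mo A := inf (riesz_values l A).

Let mo_le A s f : riesz_cover l A s f -> mo A <= s.
Proof. by move=> h; apply: ge_inf; [exists 0; exact: values_lb|exists f]. Qed.

Let mo_ge0 A : 0 <= mo A.
Proof. by apply: lb_le_inf; [exists (l (fun=> 1))|exact: values_lb]. Qed.

Let mo_adh A e : 0 < e -> exists s f, riesz_cover l A s f /\ s < mo A + e.
Proof.
by move=> e0; have [s [f hf] hs] := inf_adherent e0 (values_inf A); exists s, f.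
Qed.

Let riesz_outer0 : riesz_outer l set0 = 0%E.
Proof.
congr EFin; apply/eqP; rewrite eq_le mo_ge0 andbT.
apply: (@mo_le _ _ (fun _ _ => 0)); split => // [_|n]; first exact: within_cst.
by rewrite l0.
Qed.

Let riesz_outer_ge0 A : (0 <= riesz_outer l A)%E.
Proof. by rewrite lee_fin; exact: mo_ge0. Qed.

Let riesz_outer_le : {homo riesz_outer l : A B / A `<=` B >-> (A <= B)%E}.
Proof.
move=> A B AB; rewrite lee_fin; apply/ler_addgt0Pr => e e0.
have [s [f [[cf f0 fnd fB fs] /ltW hs]]] := mo_adh B e0.
apply: le_trans hs; apply: (@mo_le _ _ f); split => // x Kx Ax.
exact: fB (AB _ Ax).
Qed.

Let riesz_outer_sigma : sigma_subadditive (riesz_outer l).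
Proof.
move=> A; have [->|fin] := eqVneq (\sum_(0 <= i <oo) riesz_outer l (A i))%E +oo%E.
  by rewrite leey.
set S := (\sum_(0 <= i <oo) _)%E in fin *.
have Sfin : S \is a fin_num.
  rewrite ge0_fin_numE ?ltey//; apply: nneseries_ge0 => i _ _; exact: riesz_outer_ge0.
have sumS N : \sum_(i < N) mo (A i) <= fine S.
  rewrite -lee_fin fineK// -sumEFin -(big_mkord xpredT (fun i => (mo (A i))%:E)).
  by apply: nneseries_lim_ge => i *; rewrite lee_fin; exact: mo_ge0.
rewrite -(fineK Sfin) lee_fin; apply/ler_addgt0Pr => e e0.
have ei0 i : 0 < e / 2 ^+ i.+1 by rewrite divr_gt0// exprn_gt0.
have h i : exists sf : R * (nat -> E -> R),
    riesz_cover l (A i) sf.1 sf.2 /\ sf.1 < mo (A i) + e / 2 ^+ i.+1.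
  by have [s [f hf]] := mo_adh (A i) (ei0 i); exists (s, f).
have [sf hsf] := choice h.
(* Diagonal choice: stage [n] uses the first [n] covers at their [n]-th function, so [g] increases
   and each [l (g n)] is a finite sum. *)
pose g n x := \sum_(i < n) (sf i).2 n x.
have geom n : \sum_(i < n) e / 2 ^+ i.+1 = e - e / 2 ^+ n.
  elim: n => [|n IH]; first by rewrite big_ord0 expr0 divr1 subrr.
  rewrite big_ord_recr/= IH exprS invfM.
  have : 2 ^+ n != 0 :> R by rewrite expf_neq0.
  by move=> ?; field.
apply: (@mo_le _ _ g); split.
- by move=> n; apply: (@within_sum _ _ _ _ _ (fun (i : 'I_n) x => (sf i).2 n x)) => i;
    have [[]] := hsf i.
- by move=> n x Kx; apply: sumr_ge0 => i _; have [[_ h0 _ _ _] _] := hsf i; exact: h0.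
- move=> n x Kx; rewrite /g big_ord_recr/=.
  have [[_ h0 _ _ _] _] := hsf n.
  apply: ler_wpDr; first exact: h0.
  by apply: ler_sum => i _; have [[_ _ hnd _ _] _] := hsf i; exact: hnd.
- move=> x Kx [i _ Aix] e' e'0.
  have [[_ h0 hnd hA _] _] := hsf i; have [n hn] := hA x Kx Aix e' e'0.
  exists (maxn n i.+1).
  have im : (i < maxn n i.+1)%N by rewrite leq_max ltnSn orbT.
  rewrite /g (bigD1 (Ordinal im))//=.
  apply: ler_wpDr; first by apply: sumr_ge0 => j _; have [[_ h0' _ _ _] _] := hsf j; exact: h0'.
  apply: (le_trans hn).
  by apply: (@homo_leq _ (fun n => (sf i).2 n x) (fun a b => a <= b)) => //;
    [exact: le_trans|move=> m; exact: hnd|exact: leq_maxl].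
- move=> n; rewrite (@l_sum n (fun i x => (sf i).2 n x)); last first.
    by move=> i; have [[]] := hsf i.
  apply: (@le_trans _ _ (\sum_(i < n) (mo (A i) + e / 2 ^+ i.+1))).
    apply: ler_sum => i _; have [[_ _ _ _ hs] /ltW h1] := hsf i.
    exact: le_trans (hs n) h1.
  rewrite big_split/= geom lerD//.
    exact: sumS.
  by rewrite lerBlDr lerDl divr_ge0 ?(ltW e0)// exprn_ge0.
Qed.

HB.instance Definition _ := isOuterMeasure.Build R E (riesz_outer l)
  riesz_outer0 riesz_outer_ge0 riesz_outer_le riesz_outer_sigma.

Let mono_nd (u : nat -> R) : (forall n, u n <= u n.+1) -> forall n m, (n <= m)%N -> u n <= u m.
Proof. by move=> h n m nm; apply: (@homo_leq _ u (fun a b => a <= b)) => //; exact: le_trans. Qed.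

(** A cover [f] of [X] splits into [f n * plateau U n], which covers the part in [U], and
    [f n * (1 - plateau U m)] with [m] fixed, which covers the rest. With a varying index the second
    sequence need not be increasing; [m] is chosen so that the first part has nearly reached its
    supremum. *)
Lemma riesz_caratheodory_open (U : set E) : open U -> (riesz_outer l).-caratheodory U.
Proof.
move=> oU; apply: le_caratheodory_measurable => X.
rewrite -EFinD lee_fin; apply/ler_addgt0Pr => e e0.
have e20 : 0 < e / 2 by rewrite divr_gt0.
have [s [f [[cf f0 fnd fX fs] /ltW hs]]] := mo_adh X e20.
have ch m : {within K, continuous (plateau U m)}.
  by apply: continuous_subspaceT; exact: plateau_continuous.
have cfh n m : {within K, continuous (fun x => f n x * plateau U m x)} by exact: withinM.
have fm x : K x -> forall n m, (n <= m)%N -> f n x <= f m x.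
  by move=> Kx; apply: mono_nd => n; exact: fnd.
have hm x : forall n m, (n <= m)%N -> plateau U n x <= plateau U m x.
  by apply: mono_nd => n; exact: plateau_nd.
have fh_le n m x : K x -> (n <= m)%N -> f n x * plateau U n x <= f m x * plateau U m x.
  by move=> Kx nm; rewrite ler_pM ?f0 ?plateau_ge0 ?fm ?hm.
pose a n := l (fun x => f n x * plateau U n x).
have a_le n : a n <= s.
  apply: le_trans (fs n); apply: positive_functional_le => // x Kx.
  by rewrite ler_piMr ?f0 ?plateau_le1.
have sup_a : has_sup (range a).
  by split; [exists (a 0%N), 0%N|exists s => _ [n _ <-]].
have a_sup n : a n <= sup (range a) by apply: ub_le_sup; [case: sup_a|exists n].
have [_ [m _ <-] hm1] := sup_adherent e20 sup_a.
have cover1 : riesz_cover l (X `&` U) (sup (range a)) (fun n x => f n x * plateau U n x).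
  split => // [n x Kx|n x Kx|x Kx [Xx Ux] e' e'0].
  - by rewrite mulr_ge0 ?f0 ?plateau_ge0.
  - exact: fh_le.
  - have [n hn] := fX x Kx Xx e' e'0; have [m0 hm0] := plateau_in oU Ux.
    exists (maxn n m0); rewrite hm0 ?leq_maxr// mulr1 (le_trans hn)//.
    by rewrite fm// leq_maxl.
have c1h : {within K, continuous (fun x => 1 + -1 * plateau U m x)}.
  by apply: withinD; [exact: within_cst|exact: withinZ].
have cover2 : riesz_cover l (X `&` ~` U) (s - sup (range a) + e / 2)
    (fun n x => f n x * (1 + -1 * plateau U m x)).
  have p1 x : 0 <= 1 + -1 * plateau U m x by rewrite mulN1r subr_ge0 plateau_le1.
  split => [n|n x Kx|n x Kx|x Kx [Xx Ux] e' e'0|n].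
  - exact: withinM.
  - by rewrite mulr_ge0 ?f0.
  - by rewrite ler_wpM2r ?fnd.
  - have [n hn] := fX x Kx Xx e' e'0; exists n.
    by rewrite plateau_out// mulr0 addr0 mulr1.
  - apply: (@le_trans _ _ (l (fun x => f (maxn n m) x * (1 + -1 * plateau U m x)))).
      apply: positive_functional_le; [exact: withinM|exact: withinM|move=> x Kx].
      by rewrite ler_wpM2r ?fm ?leq_maxl.
    rewrite [X in l X](_ : _ = fun x => f (maxn n m) x + -1 * (f (maxn n m) x * plateau U m x)); last first.
      by apply/funext => x; lra.
    rewrite lD//; last exact: withinZ.
    rewrite lZ//.
    have : a m <= l (fun x => f (maxn n m) x * plateau U m x).
      apply: positive_functional_le => // x Kx.
      by rewrite ler_wpM2r ?plateau_ge0 ?fm ?leq_maxr.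
    have := fs (maxn n m); lra.
have := mo_le cover1; have := mo_le cover2; rewrite /mo; lra.
Qed.

Lemma riesz_caratheodory (A : set (borel E)) : measurable A -> (riesz_outer l).-caratheodory A.
Proof.
apply: smallest_sub; last exact: riesz_caratheodory_open.
split.
- exact: caratheodory_measurable_set0.
- by move=> B mB; rewrite setTD; exact: caratheodory_measurable_setC.
- by move=> F mF; exact: caratheodory_measurable_bigcup.
Qed.

Definition riesz_measure (A : set (borel E)) : \bar R := riesz_outer l A.

Let rm0 : riesz_measure set0 = 0%E. Proof. exact: riesz_outer0. Qed.

Let rm_ge0 A : (0 <= riesz_measure A)%E. Proof. exact: riesz_outer_ge0. Qed.

Let rm_sigma : semi_sigma_additive riesz_measure.
Proof.
move=> F mF tF mUF.
apply: (@caratheodory_measure_sigma_additive R E (riesz_outer l)) => //.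
- by move=> i; exact: riesz_caratheodory.
- exact: riesz_caratheodory.
Qed.

HB.instance Definition _ := isMeasure.Build _ _ _ riesz_measure rm0 rm_ge0 rm_sigma.

Let rm_fin : fin_num_fun riesz_measure. Proof. by []. Qed.

HB.instance Definition _ := @Measure_isFinite.Build _ _ _ riesz_measure rm_fin.

Definition riesz_fmeasure : {finite_measure set (borel E) -> \bar R} := riesz_measure.

Lemma riesz_fmeasure_le A s f : riesz_cover l A s f -> fine (riesz_fmeasure A) <= s.
Proof. exact: mo_le. Qed.

Lemma riesz_fmeasure_ge A b : (forall s f, riesz_cover l A s f -> b <= s) ->
  b <= fine (riesz_fmeasure A).
Proof.
by move=> h; apply: lb_le_inf; [exists (l (fun=> 1))|move=> s [f]; exact: h].
Qed.

Lemma riesz_measure_setC : riesz_fmeasure (~` K) = 0%E.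
Proof.
congr EFin; apply/eqP; rewrite eq_le mo_ge0 andbT.
apply: (@mo_le _ _ (fun _ _ => 0)); split => // [_|n].
  exact: within_cst.
by rewrite l0.
Qed.

(** Dini's argument: on the compact set an increasing sequence whose supremum is at least 1 is
    eventually uniformly close to 1 from below, and positivity of [l] concludes. *)
Lemma riesz_measureK : riesz_fmeasure K = (l (fun=> 1))%:E.
Proof.
congr EFin; apply/eqP; rewrite eq_le; apply/andP; split.
  by apply: ge_inf; [exists 0; exact: values_lb|exact: values1].
apply: lb_le_inf; first by exists (l (fun=> 1)).
move=> s [f [cf f0 fnd fK fs]]; apply/ler_addgt0Pr => e e0.
(* Chosen so that the loss [2 * e' * l 1] is at most [e]. *)
pose e' := e / (2 * (l (fun=> 1) + 1)).
have l10 : 0 < l (fun=> 1) + 1 by rewrite ltr_wpDl.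
have e'0 : 0 < e' by rewrite divr_gt0// mulr_gt0.
have [n hn] : exists n, forall x, K x -> 1 - 2 * e' <= f n x.
  have fm x : K x -> forall n m, (n <= m)%N -> f n x <= f m x.
    by move=> Kx; apply: mono_nd => n; exact: fnd.
  have : \forall n \near \oo, K `<=` (fun x => K x -> 1 - 2 * e' <= f n x).
    move/compact_near_coveringP : cK; apply => x Kx.
    have [n0 hn0] := fK x Kx Kx e' e'0.
    have /within_continuous_normP/(_ x Kx e' e'0)[r r0 hr] := cf n0.
    exists (ball x r, [set n | (n0 <= n)%N]) => /=.
      by split; [exact: nbhsx_ballx|exact: nbhs_infty_ge].
    move=> [y n] /= []; rewrite -ball_normE /= => xy n0n Ky.
    have := hr y Ky xy; rewrite ltr_norml => /andP[h1 h2].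
    have := fm y Ky n0 n n0n; lra.
  by move=> [n _ /(_ n)/= h]; exists n => x Kx; apply: h.
have hc : l (fun x => (1 - 2 * e') * (fun=> 1) x) <= l (f n).
  apply: positive_functional_le => //; first by apply: withinZ; exact: within_cst.
  by move=> x Kx; rewrite mulr1; exact: hn.
rewrite lZ in hc; last exact: within_cst.
have e'l : 2 * e' * l (fun=> 1) <= e.
  have -> : 2 * e' * l (fun=> 1) = e * (l (fun=> 1) / (l (fun=> 1) + 1)).
    by rewrite /e'; field; rewrite lt0r_neq0.
  by rewrite ler_piMr ?(ltW e0)// ler_pdivrMr// mul1r lerDl.
have := fs n; lra.
Qed.

End RieszOuterMeasure.

Section RieszRepresentation.
Context {R : realType} {E : normedModType R}.
Variables (K : set E) (l : (E -> R) -> R).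
Hypotheses (cK : compact K) (lP : positive_functional K l).

Let lD (f g : E -> R) : {within K, continuous f} -> {within K, continuous g} ->
  l (fun x => f x + g x) = l f + l g.
Proof. by case: lP => h _ _; exact: h. Qed.

Let lZ a (f : E -> R) : {within K, continuous f} -> l (fun x => a * f x) = a * l f.
Proof. by case: lP => _ h _; exact: h. Qed.

Let mu : {finite_measure set (borel E) -> \bar R} := riesz_fmeasure lP.

Let mK : measurable (K : set (borel E)). Proof. exact: borel_compact. Qed.

Let muK : fine (mu K) = l (fun=> 1).
Proof. exact: (congr1 fine (riesz_measureK cK lP)). Qed.

(** Localize: [g] mapped to [l (f * g)] is again positive, and its Riesz measure has total mass
    [l f]. Where [f >= c - e'], dividing its covers by [c - e'] turns them into covers for [mu], so
    this measure dominates [(c - e') * mu]; summing over a step partition of [f] gives the bound. *)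
Let bnd (f : E -> R) : {within K, continuous f} -> (forall x, K x -> 0 <= f x) ->
  \int[mu]_(x in K) f x <= l f.
Proof.
move=> cf f0.
pose lf g := l (fun x => f x * g x).
have lfP : positive_functional K lf.
  split.
  - move=> g h cg ch; rewrite /lf -lD; [|exact: withinM..].
    by congr l; apply/funext => x; rewrite mulrDr.
  - move=> a g cg; rewrite /lf -lZ; last exact: withinM.
    by congr l; apply/funext => x; rewrite mulrCA.
  - move=> g cg g0; case: lP => _ _; apply; first exact: withinM.
    by move=> x Kx; rewrite mulr_ge0 ?f0 ?g0.
pose muf : {finite_measure set (borel E) -> \bar R} := riesz_fmeasure lfP.
have [M [M0 fM]] := within_compact_bounded cK cf.
have mf : measurable_fun (K : set (borel E)) (f : borel E -> R) by exact: within_measurable.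
apply/ler_addgt0Pr => e e0.
have c0 : 0 < 2 * (fine (mu K) + 1).
  by rewrite mulr_gt0// ltr_wpDl// fine_ge0.
pose e' := e / (2 * (fine (mu K) + 1)).
have e'0 : 0 < e' by rewrite divr_gt0.
have [N [F [c sf]]] := stepping_exists mK mf fM e'0.
have [mF tF KF _ fc] := sf.
have := Rintegral_stepping mu sf; rewrite ler_norml => /andP[_ h1].
have mulF i : (i < N)%N -> (c i - e') * fine (mu (F i)) <= fine (muf (F i)).
  move=> iN; have [ce|ce] := leP (c i - e') 0.
    apply: (@le_trans _ _ 0); last exact: fine_ge0.
    by rewrite mulr_le0_ge0// fine_ge0.
  apply: riesz_fmeasure_ge => s g [cg g0 gnd gF gs].
  rewrite -ler_pdivlMl//.
  have cn : 0 <= (c i - e')^-1 by rewrite invr_ge0 ltW.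
  apply: (@riesz_fmeasure_le _ _ _ _ lP _ _ (fun n x => (c i - e')^-1 * (f x * g n x))).
  split.
  - by move=> n; apply: withinZ; exact: withinM.
  - by move=> n x Kx; rewrite mulr_ge0// mulr_ge0 ?f0 ?g0.
  - by move=> n x Kx; rewrite ler_wpM2l// ler_wpM2l ?f0 ?gnd.
  - move=> x Kx Fx d d0; have [n hn] := gF x Kx Fx d d0; exists n.
    have cf1 : c i - e' <= f x.
      by have := fc _ _ iN Fx; rewrite ler_norml => /andP[]; lra.
    rewrite mulrA; apply: (le_trans hn); rewrite ler_peMl ?g0//.
    by rewrite ler_pdivlMl// mulr1.
  - by move=> n; rewrite lZ ?ler_wpM2l ?gs//; exact: withinM.
have sumf : \sum_(i < N) (c i - e') * fine (mu (F i)) <= l f.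
  apply: (@le_trans _ _ (\sum_(i < N) fine (muf (F i)))).
    by apply: ler_sum => i _; exact: mulF.
  rewrite -(fine_charge_bigsetU (charge_of_finite_measure muf))// KF.
  rewrite (_ : fine _ = lf (fun=> 1)); last exact: (congr1 fine (riesz_measureK cK lfP)).
  rewrite /lf.
  by rewrite le_eqVlt; apply/orP; left; apply/eqP; congr l; apply/funext => x; rewrite mulr1.
move: sumf; under eq_bigr do rewrite mulrBl.
rewrite sumrB -mulr_sumr -(fine_charge_bigsetU (charge_of_finite_measure mu))// KF.
rewrite -[fine (charge_of_finite_measure mu K)]/(fine (mu K)).
have muK0 : 0 <= fine (mu K) by exact: fine_ge0.
have e'mu : 2 * e' * fine (mu K) <= e.
  have -> : 2 * e' * fine (mu K) = e * (fine (mu K) / (fine (mu K) + 1)).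
    by rewrite /e'; field; rewrite lt0r_neq0// ltr_wpDl.
  by rewrite ler_piMr ?(ltW e0)// ler_pdivrMr ?mul1r ?lerDl// ltr_wpDl.
move: h1 e'mu; lra.
Qed.

Theorem riesz_representation : exists nu : {finite_measure set (borel E) -> \bar R},
  nu (~` (K : set (borel E))) = 0%E /\
  forall f, {within K, continuous f} -> \int[nu]_(x in K) f x = l f.
Proof.
exists mu; split; first exact: riesz_measure_setC.
(* Adding a constant makes [f] nonnegative, and constants are integrated exactly by
   [riesz_measureK]; the reverse inequality is this one for [- f]. *)
have le_int (f : E -> R) : {within K, continuous f} -> \int[mu]_(x in K) f x <= l f.
  move=> cf; have [M [M0 fM]] := within_compact_bounded cK cf.
  have cc a : {within K, continuous (fun=> a : R)} by exact: within_cst.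
  have := bnd (withinD cf (cc M)).
  rewrite lD// (_ : l (fun=> M) = M * l (fun=> 1)); last first.
    by rewrite -lZ//; congr l; apply/funext => x; rewrite mulr1.
  rewrite RintegralD//; last 2 first.
  - by apply: (@integrable_bounded _ (borel E) _ mu K f M) => //; exact: within_measurable.
  - exact: (@finite_measure_integrable_cst _ (borel E) _ mu K M).
  rewrite Rintegral_cst// muK => h.
  have /h : forall x, K x -> 0 <= f x + M.
    by move=> x /fM; rewrite ler_norml => /andP[]; lra.
  lra.
move=> f cf; apply/eqP; rewrite eq_le le_int//=.
have := le_int _ (@withinZ _ _ K f (-1) cf).
have [M [M0 fM]] := within_compact_bounded cK cf.
rewrite lZ// RintegralZl//; first lra.
by apply: (@integrable_bounded _ (borel E) _ mu K f M) => //; exact: within_measurable.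
Qed.

End RieszRepresentation.

(** * C^1 test functions *)

Section PositivePartSquared.
Context {R : realType}.

(** A C^1 function vanishing on the negative half-line, from which cutoffs are composed. *)
Definition pos2 (s : R) : R := (Num.max s 0) ^+ 2.

Lemma pos2_taylor (s t : R) : `|pos2 (s + t) - pos2 s - 2 * Num.max s 0 * t| <= t ^+ 2.
Proof.
rewrite /pos2; have [s0|s0] := leP s 0; have [st0|st0] := leP (s + t) 0;
  rewrite ler_norml; apply/andP; split; nra.
Qed.

Lemma pos2_le0 s : s <= 0 -> pos2 s = 0.
Proof. by move=> s0; rewrite /pos2; have [_|] := leP s 0; [rewrite expr0n|lra]. Qed.

Lemma pos2_ge0 s : 0 <= pos2 s. Proof. exact: sqr_ge0. Qed.

Lemma pos2_ge1 s : 1 <= s -> 1 <= pos2 s.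
Proof. by move=> s1; rewrite /pos2; have [|_] := leP s 0; [lra|rewrite expr_ge1//; lra]. Qed.

Lemma pos2_le1 s : s <= 1 -> pos2 s <= 1.
Proof.
move=> s1; rewrite /pos2; have [_|s0] := leP s 0; first by rewrite expr0n/= ler01.
by rewrite expr_le1 ?(ltW s0).
Qed.

Lemma pos2_continuous : continuous pos2.
Proof.
have cm : continuous (fun s : R => Num.max s 0).
  move=> s; apply: (@continuous_max _ _ id (fun=> 0)); first exact: cvg_id.
  exact: cvg_cst.
move=> s; rewrite /pos2; under eq_fun do rewrite expr2.
by apply: cvgM; exact: cm.
Qed.

(** A C^1 transition from 0 on s <= 0 to 1 on s >= 1, with values in [0, 1]. *)
Definition smoothstep (s : R) : R := 1 - pos2 (1 - pos2 s).

Lemma smoothstep_le0 s : s <= 0 -> smoothstep s = 0.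
Proof.
move=> s0; rewrite /smoothstep (pos2_le0 s0) subr0.
suff -> : pos2 1 = 1 by rewrite subrr.
by apply/eqP; rewrite eq_le pos2_ge1// pos2_le1.
Qed.

Lemma smoothstep_ge1 s : 1 <= s -> smoothstep s = 1.
Proof. by move=> /pos2_ge1 s1; rewrite /smoothstep (@pos2_le0 (1 - _)) ?subr0//; lra. Qed.

Lemma smoothstep_ge0 s : 0 <= smoothstep s.
Proof. by rewrite /smoothstep subr_ge0 pos2_le1//; have := pos2_ge0 s; lra. Qed.

Lemma smoothstep_le1 s : smoothstep s <= 1.
Proof. by rewrite /smoothstep; have := pos2_ge0 (1 - pos2 s); lra. Qed.

End PositivePartSquared.

Section DifferentiableFunctions.
Context {R : realType}.

Lemma is_derive_normP (V W : normedModType R) (f : V -> W) (x v : V) (df : W) :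
  is_derive x v f df <->
  forall e : R, 0 < e -> exists2 r : R, 0 < r & forall h : R, h != 0 -> `|h| < r ->
    `|f (h *: v + x) - f x - h *: df| <= e * `|h|.
Proof.
have key (h e : R) : h != 0 -> (`|df - h^-1 *: (f (h *: v + x) - f x)| <= e) =
    (`|f (h *: v + x) - f x - h *: df| <= e * `|h|).
  move=> h0; rewrite -ler_pdivrMr ?normr_gt0// mulrC -normfV -normrZ distrC.
  by rewrite [in RHS]scalerBr scalerA mulVf// scale1r.
have lim : is_derive x v f df <-> h^-1 *: (f (h *: v + x) - f x) @[h --> 0^'] --> df.
  split=> [[df1 <-]|h]; first exact: df1.
  by apply: DeriveDef; [apply/cvg_ex; exists df|exact: cvg_lim].
rewrite lim; split=> [/cvgrPdist_le H e e0|H].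
  have := H e e0; rewrite near_withinE => /nbhs_ballP[r /= r0 hr].
  exists r => // h h0 hr'; rewrite -key//; apply: hr => //.
  by rewrite -ball_normE /= sub0r normrN.
apply/cvgrPdist_le => e e0; have [r r0 hr] := H e e0.
rewrite near_withinE; apply/nbhs_ballP; exists r => //= h.
rewrite -ball_normE /= sub0r normrN => hr' h0.
by rewrite key//; exact: hr.
Qed.

Section ContinuousFunctions.
Context {V : normedModType R}.
Implicit Types f g : V -> R.

Lemma continuous_addr f g : continuous f -> continuous g -> continuous (fun x => f x + g x).
Proof. by move=> cf cg x; apply: cvgD; [exact: cf|exact: cg]. Qed.

Lemma continuous_mulr f g : continuous f -> continuous g -> continuous (fun x => f x * g x).
Proof. by move=> cf cg x; apply: cvgM; [exact: cf|exact: cg]. Qed.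

Lemma continuous_maxr0 f : continuous f -> continuous (fun x => Num.max (f x) 0).
Proof.
by move=> cf x; apply: (@continuous_max _ _ f (fun=> 0)); [exact: cf|exact: cvg_cst].
Qed.

End ContinuousFunctions.

Lemma is_derive_pos2 (V : normedModType R) (u : V -> R) (x v : V) (du : R) :
  is_derive x v u du -> is_derive x v (pos2 \o u) (2 * Num.max (u x) 0 * du).
Proof.
move=> /is_derive_normP H; apply/is_derive_normP => e e0.
set m := Num.max (u x) 0.
have m0 : 0 <= m by rewrite le_max lexx orbT.
have m4 : 0 < 4 * (m + 1) by rewrite mulr_gt0// ltr_wpDl.
(* The first-order error is at most [2 * m * e' * |h| <= e / 2 * |h|]; the second-order one is
   [t ^+ 2 <= D ^+ 2 * |h| ^+ 2], made at most [e / 2 * |h|] by the choice of the radius below. *)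
pose e' := Num.min 1 (e / (4 * (m + 1))).
have e'0 : 0 < e' by rewrite lt_min ltr01 divr_gt0.
have e'1 : e' <= 1 by rewrite ge_min lexx.
have e'm : 4 * (m + 1) * e' <= e by rewrite mulrC -ler_pdivlMr// ge_min lexx orbT.
have [r r0 hr] := H _ e'0.
pose D := `|du| + 1.
have D0 : 0 < D by rewrite ltr_wpDl.
have DD : 0 < 2 * D ^+ 2 by rewrite mulr_gt0// exprn_gt0.
exists (Num.min r (e / (2 * D ^+ 2))); first by rewrite lt_min r0 divr_gt0.
move=> h h0; rewrite lt_min => /andP[h1 h2]; have := hr h h0 h1.
rewrite ltr_pdivlMr// in h2.
set t := u (h *: v + x) - u x => ht.
have tD : `|t| <= D * `|h|.
  rewrite -[t](subrK (h *: du)) (le_trans (ler_normD _ _))//.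
  rewrite normrM /D; have : e' * `|h| <= `|h| by rewrite ler_piMl.
  lra.
have t2 : t ^+ 2 <= e / 2 * `|h|.
  rewrite -[t ^+ 2]real_normK ?num_real//.
  apply: (@le_trans _ _ ((D * `|h|) ^+ 2)); first by rewrite lerXn2r ?nnegrE// ?mulr_ge0 ?(ltW D0).
  rewrite exprMn; have := normr_ge0 h; nra.
rewrite -[h *: (2 * m * du)]/(h * (2 * m * du)) [h * _]mulrCA.
have := pos2_taylor (u x) t; rewrite -/m /t [u x + _]addrC subrK -/t => hp.
have -> : 2 * m * (h * du) = 2 * m * t - 2 * m * (t - h * du) by lra.
have ht' : 2 * m * `|t - h * du| <= e / 2 * `|h|.
  apply: (@le_trans _ _ (2 * m * (e' * `|h|))).
    by rewrite ler_wpM2l// mulr_ge0.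
  have := normr_ge0 h; nra.
rewrite opprB addrA addrAC (le_trans (ler_normD _ _))//.
rewrite normrM [X in _ + X * _]ger0_norm ?mulr_ge0//.
lra.
Qed.

Definition C1fun d (f : 'rV[R]_d -> R) :=
  continuous f /\ exists g : 'I_d -> 'rV[R]_d -> R,
    forall j, continuous (g j) /\ forall x, is_derive x (ebase j) f (g j x).

Lemma C1fun_cst d (a : R) : @C1fun d (fun=> a).
Proof.
split; first exact: cst_continuous.
exists (fun _ _ => 0) => j; split; first exact: cst_continuous.
by move=> x; exact: is_derive_cst.
Qed.

Lemma C1fun_coord d (i : 'I_d) : C1fun (fun x : 'rV[R]_d => x 0 i).
Proof.
split; first exact: coord_continuous.
exists (fun j _ => (i == j)%:R) => j; split; first exact: cst_continuous.
move=> x; apply/is_derive_normP => e e0; exists 1 => // h h0 _.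
rewrite !mxE eqxx/= addrK [h *: _]/(h * _) subrr normr0 mulr_ge0// ltW//.
Qed.

Lemma C1funD d (f g : 'rV[R]_d -> R) : C1fun f -> C1fun g -> C1fun (fun x => f x + g x).
Proof.
move=> [cf [f' hf]] [cg [g' hg]]; split; first exact: continuous_addr.
exists (fun j x => f' j x + g' j x) => j; have [cf' df] := hf j; have [cg' dg] := hg j.
split; first exact: continuous_addr.
by move=> x; exact: is_deriveD.
Qed.

Lemma C1funM d (f g : 'rV[R]_d -> R) : C1fun f -> C1fun g -> C1fun (fun x => f x * g x).
Proof.
move=> [cf [f' hf]] [cg [g' hg]]; split; first exact: continuous_mulr.
exists (fun j x => f x * g' j x + g x * f' j x) => j.
have [cf' df] := hf j; have [cg' dg] := hg j; split; last by move=> x; exact: is_deriveM.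
by apply: continuous_addr; exact: continuous_mulr.
Qed.

Lemma C1fun_pos2 d (f : 'rV[R]_d -> R) : C1fun f -> C1fun (fun x => pos2 (f x)).
Proof.
move=> [cf [f' hf]]; split.
  by move=> x; apply: (continuous_comp (cf x)); exact: pos2_continuous.
exists (fun j x => 2 * Num.max (f x) 0 * f' j x) => j; have [cf' df] := hf j.
split; last by move=> x; exact: is_derive_pos2.
apply: continuous_mulr => //; apply: continuous_mulr; first exact: cst_continuous.
exact: continuous_maxr0.
Qed.

Lemma C1funB1 d (f : 'rV[R]_d -> R) : C1fun f -> C1fun (fun x => 1 - f x).
Proof.
move=> cf; have := C1funD (C1fun_cst d 1) (C1funM (C1fun_cst d (-1)) cf).
by under eq_fun do rewrite mulN1r.
Qed.

Lemma C1fun_smoothstep d (f : 'rV[R]_d -> R) : C1fun f -> C1fun (fun x => smoothstep (f x)).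
Proof. by move=> cf; apply: C1funB1; apply: C1fun_pos2; apply: C1funB1; exact: C1fun_pos2. Qed.

Lemma C1fun_prod d (I : Type) (s : seq I) (f : I -> 'rV[R]_d -> R) :
  (forall i, C1fun (f i)) -> C1fun (fun x => \prod_(i <- s) f i x).
Proof.
move=> cf; elim: s => [|i s IH].
  by under eq_fun do rewrite big_nil; exact: C1fun_cst.
by under eq_fun do rewrite big_cons; exact: C1funM.
Qed.

(** A product over coordinates because the norm is the sup norm. The factor 4 / (3 r^2) makes the
    argument reach 1 exactly when the coordinate distance is at most r / 2, and vanish when it is
    r. *)
Definition bump d (r : R) (a x : 'rV[R]_d) : R :=
  \prod_i smoothstep (4 / (3 * r ^+ 2) * (r ^+ 2 - (x 0 i - a 0 i) ^+ 2)).

Lemma coord_le_norm d (x : 'rV[R]_d) i : `|x 0 i| <= `|x|.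
Proof. by rewrite [leRHS]mx_normrE; exact: (le_bigmax _ (fun ij => `|x ij.1 ij.2|) (0, i)). Qed.

Lemma bumpP d r (a : 'rV[R]_d) : 0 < r ->
  [/\ C1fun (bump r a), forall x, 0 <= bump r a x <= 1,
      forall x, `|x - a| <= r / 2 -> bump r a x = 1 &
      forall x, bump r a x != 0 -> `|x - a| < r].
Proof.
move=> r0; have r20 : 0 < r ^+ 2 by rewrite exprn_gt0.
have c0 : 0 < 4 / (3 * r ^+ 2) by rewrite divr_gt0// mulr_gt0.
split.
- apply: C1fun_prod => i; apply: C1fun_smoothstep; apply: C1funM; first exact: C1fun_cst.
  have cB : C1fun (fun x : 'rV[R]_d => x 0 i - a 0 i).
    by apply: C1funD; [exact: C1fun_coord|exact: C1fun_cst].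
  have := C1funD (C1fun_cst d (r ^+ 2)) (C1funM (C1fun_cst d (-1)) (C1funM cB cB)).
  by under eq_fun do rewrite mulN1r -expr2.
- move=> x; rewrite prodr_ge0 => [|i _]; last exact: smoothstep_ge0.
  by rewrite prodr_ile1// => i _; rewrite smoothstep_ge0 smoothstep_le1.
- move=> x xa; rewrite /bump big1// => i _; apply: smoothstep_ge1.
  have : `|x 0 i - a 0 i| <= r / 2.
    by apply: le_trans xa; have := coord_le_norm (x - a) i; rewrite !mxE.
  rewrite ler_norml => /andP[h1 h2].
  rewrite mulrAC ler_pdivlMr ?mul1r; last by rewrite mulr_gt0.
  nra.
- move=> x; apply: contraNT; rewrite -leNgt => xa.
  have [i xi] : exists i, `|x - a| = `|x 0 i - a 0 i|.
    have [|[u i] /= xi] := @mx_norm_neq0 _ _ _ (x - a).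
      by rewrite gt_eqF//; exact: lt_le_trans r0 xa.
    by exists i; rewrite [LHS]xi (ord1 u) !mxE.
  rewrite /bump (bigD1 i)//= smoothstep_le0 ?mul0r//.
  rewrite pmulr_rle0// subr_le0 -[leRHS]real_normK ?num_real// -xi.
  by rewrite lerXn2r ?nnegrE ?(ltW r0).
Qed.

(** Induction on a finite net, replacing [g] by the convex combination [b * f a + (1 - b) * g] with
    [b] the bump at [a]. The support of [b] lies where [f] is close to [f a]; no normalized
    partition of unity is formed. *)
Lemma C1fun_dense d (K : set 'rV[R]_d) (f : 'rV[R]_d -> R) : compact K ->
  {within K, continuous f} -> forall e : R, 0 < e ->
  exists g, C1fun g /\ forall x, K x -> `|f x - g x| <= e.
Proof.
move=> cK cf e e0.
have [r r0 hr] := uniform_continuous_compact cK cf e0.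
have [s hs] : exists s : seq 'rV[R]_d, (forall a, a \in s -> K a) /\
    forall x, K x -> exists2 a, a \in s & `|x - a| <= r / 2.
  have r20 : 0 < r / 2 by rewrite divr_gt0.
  move: cK; rewrite compact_cover => /(_ _ K (fun a => ball a (r / 2))).
  case=> [a _|x Kx|D DK KD]; first exact: ball_open.
    by exists x => //; exact: ballxx.
  exists (finmap.enum_fset D); split=> [a aD|x Kx]; first by have := DK a aD; rewrite inE.
  have [a aD] := KD x Kx; rewrite -ball_normE /= => ax.
  by exists a => //; rewrite distrC ltW.
have {hs} [sK hs] := hs.
suff [g [cg hg]] : exists g, C1fun g /\ forall x, K x ->
    (exists2 a, a \in s & `|x - a| <= r / 2) -> `|f x - g x| <= e.
  by exists g; split => // x Kx; apply: hg => //; exact: hs.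
elim: s sK {hs} => [|a s IH] sK.
  by exists (fun=> 0); split; [exact: C1fun_cst|move=> x _ []].
have [|g [cg hg]] := IH; first by move=> b bs; apply: sK; rewrite inE bs orbT.
have [cb b01 b1 b0] := bumpP a r0.
exists (fun x => bump r a x * f a + (1 - bump r a x) * g x); split.
  apply: C1funD; apply: C1funM => //; [exact: C1fun_cst|exact: C1funB1].
move=> x Kx xs; have /andP[bx0 bx1] := b01 x.
have Ka : K a by apply: sK; rewrite inE eqxx.
have hfa : bump r a x * `|f x - f a| <= bump r a x * e.
  have [->|bn0] := eqVneq (bump r a x) 0; first by rewrite !mul0r.
  by rewrite ler_wpM2l// ltW// hr// b0.
have -> : f x - (bump r a x * f a + (1 - bump r a x) * g x) =
    bump r a x * (f x - f a) + (1 - bump r a x) * (f x - g x) by lra.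
apply: (le_trans (ler_normD _ _)).
rewrite !normrM (ger0_norm bx0) [`|1 - _|]ger0_norm ?subr_ge0//.
(* Where the bump is 1 the older approximation has weight 0; elsewhere [x] is not within [r / 2] of
   [a], so it is close to another point of the net and the induction hypothesis applies. *)
have [bE|bN] := eqVneq (bump r a x) 1.
  by move: hfa; rewrite bE subrr mul0r addr0 !mul1r.
have hgx : `|f x - g x| <= e.
  apply: hg => //; case: xs => b; rewrite inE => /predU1P[-> xa|bs xb]; last by exists b.
  by rewrite b1 ?eqxx in bN.
have : (1 - bump r a x) * `|f x - g x| <= (1 - bump r a x) * e.
  by rewrite ler_wpM2l// subr_ge0.
lra.
Qed.

End DifferentiableFunctions.

Lemma eq_small_dist (R : realType) (x y C : R) :
  (forall e : R, 0 < e -> `|x - y| <= e * C) -> x = y.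
Proof.
move=> h; apply/eqP; rewrite -subr_eq0 -normr_eq0 eq_le normr_ge0 andbT.
have C0 : 0 <= C by have := h 1 ltr01; rewrite mul1r; exact: le_trans.
apply/ler_addgt0Pr => e e0; rewrite add0r.
have C10 : 0 < C + 1 by rewrite ltr_wpDl.
apply: (le_trans (h _ (divr_gt0 e0 C10))).
by rewrite mulrAC ler_pdivrMr// ler_wpM2l ?(ltW e0)// lerDl.
Qed.

Section ChargeIntegralLinear.
Context {d} {T : measurableType d} {R : realType}.
Implicit Types (K : set T) (f : T -> R).

(** The Jordan decomposition is not linear in the charge, so linearity is proved on step functions,
    from the values on sets. *)
Lemma charge_integral_lincomb (I : Type) (s : seq I) (a : I -> R)
    (nu : I -> {charge set T -> \bar R}) (eta : {charge set T -> \bar R}) K f M :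
  (forall A, measurable A -> fine (eta A) = \sum_(i <- s) a i * fine (nu i A)) ->
  measurable K -> measurable_fun K f -> (forall x, K x -> `|f x| <= M) ->
  charge_integral eta K f = \sum_(i <- s) a i * charge_integral (nu i) K f.
Proof.
move=> h mK mf fM.
apply: (@eq_small_dist _ _ _ (tv eta K + \sum_(i <- s) `|a i| * tv (nu i) K)) => e e0.
have [N [E [c sf]]] := stepping_exists mK mf fM e0.
have [mE _ _ _ _] := sf.
have heta := charge_integral_stepping eta sf.
have hsum : \sum_(k < N) c k * fine (eta (E k)) =
    \sum_(i <- s) a i * \sum_(k < N) c k * fine (nu i (E k)).
  under eq_bigr => k _ do rewrite h// mulr_sumr.
  rewrite exchange_big/=; apply: eq_bigr => i _; rewrite mulr_sumr.
  by apply: eq_bigr => k _; rewrite mulrCA.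
rewrite -(subrK (\sum_(k < N) c k * fine (eta (E k))) (charge_integral eta K f)).
rewrite -addrA {2}hsum -sumrB mulrDr (le_trans (ler_normD _ _))// lerD//.
rewrite (le_trans (ler_norm_sum _ _ _))// mulr_sumr; apply: ler_sum => i _.
rewrite -mulrBr normrM mulrCA ler_wpM2l// distrC.
exact: charge_integral_stepping.
Qed.

Lemma charge_integral_eq_charge (nu1 nu2 : {charge set T -> \bar R}) K f M :
  measurable K -> measurable_fun K f -> (forall x, K x -> `|f x| <= M) ->
  (forall A, measurable A -> fine (nu1 A) = fine (nu2 A)) ->
  charge_integral nu1 K f = charge_integral nu2 K f.
Proof.
move=> mK mf fM nuE; have := @charge_integral_lincomb unit [:: tt] (fun=> 1)
  (fun=> nu2) nu1 K f M _ mK mf fM.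
rewrite !big_cons !big_nil mul1r addr0; apply => A mA.
by rewrite big_cons big_nil mul1r addr0 nuE.
Qed.

Lemma charge_integral_ge0 (nu : {charge set T -> \bar R}) K f M :
  measurable K -> measurable_fun K f -> (forall x, K x -> `|f x| <= M) ->
  (forall A, measurable A -> 0 <= fine (nu A)) -> (forall x, K x -> 0 <= f x) ->
  0 <= charge_integral nu K f.
Proof.
move=> mK mf fM nu0 f0.
have C0 : 0 < tv nu K + fine (nu K) + 1 by rewrite ltr_wpDl// addr_ge0 ?tv_ge0 ?nu0.
apply/ler_addgt0Pr => e e0.
have [N [E [c sf]]] := stepping_exists mK mf fM (divr_gt0 e0 C0).
set e' := e / _ in sf; have e'0 : 0 < e' by rewrite divr_gt0.
have := charge_integral_stepping nu sf; rewrite ler_norml => /andP[h1 _].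
have [mE tE KE _ fc] := sf.
have h2 : - e' * fine (nu K) <= \sum_(k < N) c k * fine (nu (E k)).
  rewrite -KE fine_charge_bigsetU// mulr_sumr; apply: ler_sum => k _.
  (* On a nonempty piece [f >= 0] forces [c k >= - e']; an empty piece says nothing about [c k] but
     has charge 0. *)
  have [->|/set0P[x Ex]] := eqVneq (E k) set0; first by rewrite charge0 !mulr0.
  rewrite ler_wpM2r ?nu0//; have := fc _ _ (ltn_ord k) Ex; rewrite ler_norml => /andP[_].
  have : 0 <= f x by apply: f0; rewrite -KE -bigcup_mkord; exists k => /=.
  lra.
have : e' * (tv nu K + fine (nu K)) <= e.
  by rewrite /e' mulrAC ler_pdivrMr// ler_wpM2l ?(ltW e0)// lerDl.
rewrite mulrDr; move: h1 h2; lra.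
Qed.

Lemma charge_integral_finite_measure (mu : {finite_measure set T -> \bar R}) K f M :
  measurable K -> measurable_fun K f -> (forall x, K x -> `|f x| <= M) ->
  charge_integral (charge_of_finite_measure mu) K f = \int[mu]_(x in K) f x.
Proof.
move=> mK mf fM.
apply: (@eq_small_dist _ _ _ (tv (charge_of_finite_measure mu) K + fine (mu K))) => e e0.
have [N [E [c sf]]] := stepping_exists mK mf fM e0.
have h1 := charge_integral_stepping (charge_of_finite_measure mu) sf.
have h2 := Rintegral_stepping mu sf.
apply: (le_trans (ler_distD (\sum_(i < N) c i * fine (mu (E i))) _ _)).
by rewrite mulrDr lerD// distrC.
Qed.

Definition concentrated (nu : {charge set T -> \bar R}) K :=
  forall A, measurable A -> A `&` K = set0 -> fine (nu A) = 0.

Lemma concentrated_setI nu K A : measurable K -> concentrated nu K -> measurable A ->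
  fine (nu (A `&` K)) = fine (nu A).
Proof.
move=> mK nuK mA; rewrite -[in RHS](setUIDK A K) fine_chargeU//; first last.
- by rewrite setDE setIACA setICr setI0.
- exact: measurableD.
- exact: measurableI.
rewrite (nuK (A `\` K)) ?addr0//; first exact: measurableD.
by rewrite setIC setDIK.
Qed.

Lemma concentrated_tv nu K : measurable K -> concentrated nu K -> tv nu K = tv nu setT.
Proof.
move=> mK nuK; have [P [N [mP mN _ h]]] := tv_hahn nu.
rewrite !h// !setTI (setIC K) (setIC K) !concentrated_setI//.
Qed.

End ChargeIntegralLinear.

(** * Charges are determined by their integrals of continuous functions *)

Section Uniqueness.
Context {R : realType} {E : normedModType R}.

(** The two Jordan parts restricted to [K] give equal integrals to the plateau functions, hence
    agree on open sets by monotone convergence; open sets form a generating pi-system. *)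
Lemma charge_null (eta : {charge set (borel E) -> \bar R}) (K : set (borel E)) :
  compact (K : set E) -> concentrated eta K ->
  (forall f : E -> R, continuous f -> charge_integral eta K f = 0) ->
  forall A, measurable A -> fine (eta A) = 0.
Proof.
move=> cK etaK int0 A mA; have mK := borel_compact cK.
rewrite -(concentrated_setI mK etaK mA) fine_jordan; last exact: measurableI.
apply/eqP; rewrite subr_eq0; apply/eqP; congr fine.
pose P := mrestr (jordan_pos (hahn eta)) mK; pose N := mrestr (jordan_neg (hahn eta)) mK.
suff : P A = N A by [].
apply: (@measure_unique _ _ (borel E) open (fun=> setT)) => //.
- by move=> U V; exact: openI.
- by move=> _; exact: openT.
- by rewrite bigcup_const.
- move=> U oU.
  have lim (mu : {finite_measure set (borel E) -> \bar R}) :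
      (\int[mu]_(x in K) (plateau U m x)%:E)%E @[m --> \oo] --> mu (U `&` K).
    rewrite -(integral_indic mu mK (borel_open oU)).
    rewrite (_ : (\int[mu]_(x in K) (\1_U x)%:E)%E =
        (\int[mu]_(x in K) (limn (fun m => (plateau U m x)%:E)))%E); last first.
      apply: eq_integral => x _; apply/esym/cvg_lim => //.
      apply: cvg_near_cst; rewrite indicE; have [Ux|Ux] := boolP (x \in U).
        rewrite inE in Ux; have [m0 hm0] := plateau_in oU Ux.
        by near=> m; rewrite hm0//; near: m; exact: nbhs_infty_ge.
      by apply: nearW => m; rewrite plateau_out// => Ux'; rewrite mem_set in Ux.
    apply: (@cvg_monotone_convergence _ (borel E) R mu K mK (fun m x => (plateau U m x)%:E)).
    - move=> m; apply/measurable_EFinP; apply: within_measurable => //.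
      by apply: continuous_subspaceT; exact: plateau_continuous.
    - by move=> m x _; rewrite lee_fin plateau_ge0.
    - by move=> x _; apply/nondecreasing_seqP => m; rewrite lee_fin plateau_nd.
  have eqm m : (\int[jordan_pos (hahn eta)]_(x in K) (plateau U m x)%:E)%E =
      (\int[jordan_neg (hahn eta)]_(x in K) (plateau U m x)%:E)%E.
    have := int0 _ (@plateau_continuous _ _ U m); rewrite /charge_integral => /eqP.
    rewrite subr_eq0 => /eqP heq.
    have fn (mu : {finite_measure set (borel E) -> \bar R}) :
        (\int[mu]_(x in K) (plateau U m x)%:E)%E \is a fin_num.
      apply: integrable_fin_num => //.
      apply: (@integrable_bounded _ (borel E) _ mu K (plateau U m) 1) => //.
        by apply: within_measurable => //; apply: continuous_subspaceT; exact: plateau_continuous.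
      by move=> x _; rewrite ger0_norm ?plateau_ge0 ?plateau_le1.
    by rewrite -(fineK (fn (jordan_pos (hahn eta)))) -(fineK (fn (jordan_neg (hahn eta)))); congr EFin.
  have := lim (jordan_pos (hahn eta)); under eq_fun do rewrite eqm.
  move=> h1; exact: (cvg_unique _ h1 (lim (jordan_neg (hahn eta)))).
- by move=> _; rewrite /P /mrestr ltey_eq fin_num_measure//; exact: measurableI.
Unshelve. all: by end_near.
Qed.

Lemma charge_unique (nu1 nu2 : {charge set (borel E) -> \bar R}) (K : set (borel E)) :
  compact (K : set E) -> concentrated nu1 K -> concentrated nu2 K ->
  (forall f : E -> R, continuous f -> charge_integral nu1 K f = charge_integral nu2 K f) ->
  forall A, measurable A -> fine (nu1 A) = fine (nu2 A).
Proof.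
move=> cK nu1K nu2K h A mA; have mK := borel_compact cK.
have [eta heta] := @charge_lincomb _ _ R bool [:: true; false]
  (fun b => if b then 1 else -1) (fun b => if b then nu1 else nu2).
have hE B : measurable B -> fine (eta B) = fine (nu1 B) - fine (nu2 B).
  by move=> mB; rewrite heta// !big_cons big_nil mul1r mulN1r addr0.
apply/eqP; rewrite -subr_eq0 -hE//; apply/eqP.
apply: (charge_null cK) => //.
  by move=> B mB BK; rewrite hE// nu1K// nu2K// subrr.
move=> f cf; have wf := @continuous_subspaceT E R (K : set E) f cf.
have [M [_ fM]] := within_compact_bounded cK wf.
rewrite (charge_integral_lincomb heta mK (within_measurable mK wf) fM).
by rewrite !big_cons big_nil mul1r mulN1r addr0 h// subrr.
Qed.

End Uniqueness.

Section Density.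
Context {R : realType} {d : nat}.
Let E := ('rV[R]_d)%type.

(** Extension from C^1 to continuous functions under a common mass bound. The filter is arbitrary so
    that it serves both for convergence along a sequence and for the Cauchy property, along a
    product filter on pairs of indices. *)
Lemma C1fun_small (I : Type) (F : set_system I) {FF : Filter F}
    (nu1 nu2 : I -> {charge set (borel E) -> \bar R}) (K : set (borel E)) (M : R) :
  compact (K : set E) -> (forall i, tv (nu1 i) K <= M) -> (forall i, tv (nu2 i) K <= M) ->
  (forall g : E -> R, C1fun g -> forall e : R, 0 < e -> \forall i \near F,
     `|charge_integral (nu1 i) K g - charge_integral (nu2 i) K g| <= e) ->
  forall f : E -> R, {within (K : set E), continuous f} -> forall e : R, 0 < e ->
  \forall i \near F, `|charge_integral (nu1 i) K f - charge_integral (nu2 i) K f| <= e.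
Proof.
move=> cK M1 M2 hg f cf e e0; have mK := borel_compact cK.
have M10 : 0 < 4 * (`|M| + 1) by rewrite mulr_gt0// ltr_wpDl.
have e'0 : 0 < e / (4 * (`|M| + 1)) by rewrite divr_gt0.
have [g [Cg fg]] := C1fun_dense cK cf e'0.
have cg : {within (K : set E), continuous g} by apply: continuous_subspaceT; case: Cg.
have e20 : 0 < e / 2 by rewrite divr_gt0.
have close nu : tv nu K <= M -> `|charge_integral nu K f - charge_integral nu K g| <= e / 4.
  move=> nuM; have [Mf [_ fM]] := within_compact_bounded cK cf.
  have [Mg [_ gM]] := within_compact_bounded cK cg.
  have mf := within_measurable mK cf; have mg := within_measurable mK cg.
  have -> : charge_integral nu K f - charge_integral nu K g =
      charge_integral nu K (fun x => f x + -1 * g x).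
    rewrite (@charge_integralD _ _ _ nu K f (fun x => -1 * g x) Mf Mg)//.
    - by rewrite (charge_integralZ _ _ mK mg gM) mulN1r.
    - by apply: measurable_funM => //.
    - by move=> x Kx; rewrite mulN1r normrN gM.
  have := @normr_charge_integral _ _ _ nu K (fun x => f x + -1 * g x) _ mK _ _.
  move=> /(_ (e / (4 * (`|M| + 1)))) h.
  apply: le_trans (h _ _) _.
  - by apply: measurable_funD => //; exact: measurable_funM.
  - by move=> x Kx; rewrite mulN1r fg.
  - apply: (@le_trans _ _ (e / (4 * (`|M| + 1)) * (`|M| + 1))).
      by rewrite ler_wpM2l ?(ltW e'0)// (le_trans nuM)// (le_trans (ler_norm M))// lerDl.
    rewrite le_eqVlt; apply/orP; left; apply/eqP; field.
    by rewrite lt0r_neq0// ltr_wpDl.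
have := hg g Cg _ e20; apply: filterS => i hi.
have := close _ (M1 i); have := close _ (M2 i); move: hi.
rewrite !ler_norml => /andP[? ?] /andP[? ?] /andP[? ?].
by apply/andP; split; lra.
Qed.

End Density.

Section WeakCompactness.
Context {R : realType} {d n : nat}.
Let E := ('rV[R]_d)%type.

(** Test the quadratic form on e_i + e_j and e_i - e_j. *)
Lemma psd_entry (A : 'M[R]_n) i j : psd A -> `|A i j| <= \tr A.
Proof.
move=> [sA pA].
pose q (u v : 'cV[R]_n) := (u^T *m A *m v) 0 0.
have trD (u v : 'cV[R]_n) : (u + v)^T = u^T + v^T by apply/matrixP => ? ?; rewrite !mxE.
have trN (u : 'cV[R]_n) : (- u)^T = - u^T by apply/matrixP => ? ?; rewrite !mxE.
have qDl (u v w : 'cV[R]_n) : q (u + v) w = q u w + q v w.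
  by rewrite /q trD 2!mulmxDl mxE.
have qDr (u v w : 'cV[R]_n) : q w (u + v) = q w u + q w v by rewrite /q mulmxDr mxE.
have qe u v : q (delta_mx u 0) (delta_mx v 0) = A u v.
  by rewrite /q trmx_delta -rowE -colE !mxE.
have qN (u v : 'cV[R]_n) : q (- u) v = - q u v.
  by rewrite /q trN 2!mulNmx mxE.
have qNr (u v : 'cV[R]_n) : q u (- v) = - q u v by rewrite /q mulmxN mxE.
have Aji : A j i = A i j by rewrite -[in LHS]sA mxE.
have diag u : 0 <= A u u.
  by have := pA (delta_mx u 0); rewrite -/(q _ _) qe.
have tr1 u v : u != v -> A u u + A v v <= \tr A.
  move=> uv; rewrite /mxtrace (bigD1 u)//= (bigD1 v) 1?eq_sym//= addrA lerDl.
  exact: sumr_ge0.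
have tr0 u : A u u <= \tr A by rewrite /mxtrace (bigD1 u)//= lerDl sumr_ge0.
have [<-|ij] := eqVneq i j; first by rewrite ger0_norm.
have := pA (delta_mx i 0 + delta_mx j 0); have := pA (delta_mx i 0 - delta_mx j 0).
rewrite -!/(q _ _) !(qDl, qDr, qN, qNr, qe) Aji; have := tr1 i j ij.
have := diag i; have := diag j.
by rewrite ler_norml => ? ? ? ? ?; apply/andP; split; lra.
Qed.

End WeakCompactness.

Lemma measures_concentrated (R : realType) (E : normedModType R) m n (K : set E)
  (V : set 'M[R]_(m, n)) (mu : mxmeasure E m n) i j :
  measures K V mu -> concentrated (mu i j) K.
Proof. by move=> muK A mA AK; have [_ /(_ AK)/matrixP/(_ i j)] := muK A mA; rewrite !mxE. Qed.

Lemma psd_diag (R : realType) n (A : 'M[R]_n) i : psd A -> 0 <= A i i.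
Proof.
by move=> [_ /(_ (delta_mx i 0))]; rewrite trmx_delta -rowE -colE !mxE.
Qed.

(** * Weak limits of matrix measures *)

Section MatrixMeasureValues.
Context {R : realType} {E : normedModType R} {n : nat}.
Implicit Types mu : mxmeasure E n n.

Lemma mvalU m (nu : mxmeasure E m n) (A B : set (borel E)) : measurable A -> measurable B ->
  A `&` B = set0 -> mval nu (A `|` B) = mval nu A + mval nu B.
Proof. by move=> mA mB AB; apply/matrixP => i j; rewrite !mxE fine_chargeU. Qed.

Lemma trace_mval_mono mu (A B : set (borel E)) : (forall C, measurable C -> psd (mval mu C)) ->
  measurable A -> measurable B -> A `<=` B -> \tr (mval mu A) <= \tr (mval mu B).
Proof.
move=> pm mA mB AB; rewrite -[B](setDUK AB) mvalU//.
- rewrite mxtraceD lerDl; have [sD pD] := pm _ (measurableD mB mA).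
  apply: sumr_ge0 => i _; have := pD (delta_mx i 0).
  by rewrite trmx_delta -rowE -colE !mxE.
- exact: measurableD.
- by rewrite setDIK.
Qed.

Lemma tv_le_trace mu i j : (forall A, measurable A -> psd (mval mu A)) ->
  tv (mu i j) setT <= \tr (mval mu setT).
Proof.
move=> pm; have [P [N [mP mN PN h]]] := tv_hahn (mu i j).
rewrite h// !setTI.
apply: (@le_trans _ _ (\tr (mval mu P) + \tr (mval mu N))).
  have := psd_entry i j (pm P mP); have := psd_entry i j (pm N mN).
  by rewrite !mxE !ler_norml => /andP[? _] /andP[_ ?]; lra.
rewrite -mxtraceD -mvalU//; apply: trace_mval_mono => //; exact: measurableU.
Qed.

End MatrixMeasureValues.

Lemma quad_sum (R : realType) n (A : 'M[R]_n) (w : 'cV[R]_n) :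
  (w^T *m A *m w) 0 0 = \sum_(p : 'I_n * 'I_n) w p.1 0 * w p.2 0 * A p.1 p.2.
Proof.
rewrite -(pair_bigA _ (fun i j => w i 0 * w j 0 * A i j))/= mxE exchange_big/=.
apply: eq_bigr => j _; rewrite !mxE mulr_suml; apply: eq_bigr => i _.
by rewrite !mxE; ring.
Qed.

Lemma cvg_sum_fin (R : realType) (I : finType) (F : I -> nat -> R) (l : I -> R) :
  (forall i, F i j @[j --> \oo] --> l i) ->
  \sum_i F i j @[j --> \oo] --> \sum_i l i.
Proof.
move=> h; elim: (index_enum I) => [|i s IH].
  by rewrite big_nil; under eq_fun do rewrite big_nil; exact: cvg_cst.
by rewrite big_cons; under eq_fun do rewrite big_cons; exact: cvgD.
Qed.

Section WeakLimits.
Context {R : realType} {d n : nat}.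
Let E := ('rV[R]_d)%type.
Variable K : set E.
Hypothesis cK : compact K.

Let mK : measurable (K : set (borel E)). Proof. exact: borel_compact. Qed.

(** Convergence on C^1 functions and the mass bound give limit functionals for all entries. For each
    vector [w] the combination with weights w_i w_j is positive and has a Riesz measure; the entries
    of [G] are obtained from these measures by polarization. *)
Lemma measures_limit (u : nat -> mxmeasure E n n) (M : R) :
  (forall k, measures K psd (u k)) -> (forall k, \tr (mval (u k) setT) <= M) ->
  (forall i j (g : E -> R), C1fun g -> cvgn (fun k => charge_integral (u k i j) K g)) ->
  exists G, measures K psd G /\ forall i j (f : E -> R), {within K, continuous f} ->
    charge_integral (u k i j) K f @[k --> \oo] --> charge_integral (G i j) K f.
Proof.
move=> uK uM ucvg.
have psdu k A : measurable A -> psd (mval (u k) A) by move=> mA; have [] := uK k A mA.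
have tvu k i j : tv (u k i j) K <= M.
  apply: le_trans (uM k); apply: le_trans (tv_le_trace i j (psdu k)).
  exact: le_tv.
have lcvg i j (f : E -> R) : {within K, continuous f} ->
    cvgn (fun k => charge_integral (u k i j) K f).
  move=> cf; apply/cauchy_cvgP/cauchy_ballP => e e0.
  have e20 : 0 < e / 2 by rewrite divr_gt0.
  rewrite near_map2 /=.
  have := @C1fun_small R d (nat * nat)%type (filter_prod \oo \oo) _
    (fun p => u p.1 i j) (fun p => u p.2 i j) K M cK (fun p => tvu p.1 i j)
    (fun p => tvu p.2 i j) _ f cf (e / 2) e20.
  have hg g : C1fun g -> forall e' : R, 0 < e' -> \forall p \near filter_prod \oo \oo,
     `|charge_integral (u p.1 i j) K g - charge_integral (u p.2 i j) K g| <= e'.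
    move=> Cg e' e'0; have /cauchy_cvgP/cauchy_ballP/(_ e' e'0) := ucvg i j g Cg.
    rewrite near_map2 /=; apply: filterS => -[a b] /=.
    by rewrite -ball_normE /= => /ltW.
  have FF : Filter (filter_prod \oo \oo : set_system (nat * nat)) by exact: filter_prod_filter.
  move=> /(_ FF hg); apply: filterS => -[a b] /=; rewrite -ball_normE /= => h.
  by apply: le_lt_trans h _; rewrite ltr_pdivrMr// mulr_natr mulr2n ltrDl.
pose ell i j (f : E -> R) : R := limn (fun k => charge_integral (u k i j) K f).
have ellP i j (f : E -> R) : {within K, continuous f} ->
  charge_integral (u k i j) K f @[k --> \oo] --> ell i j f by move=> cf; exact: lcvg.
have sym_int k i j (f : E -> R) : {within K, continuous f} ->
    charge_integral (u k i j) K f = charge_integral (u k j i) K f.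
  move=> cf; have [Mf [_ fM]] := within_compact_bounded cK cf.
  apply: (charge_integral_eq_charge mK (within_measurable mK cf) fM) => A mA.
  by have [/matrixP/(_ j i)] := psdu k A mA; rewrite !mxE.
have ell_sym i j (f : E -> R) : {within K, continuous f} -> ell i j f = ell j i f.
  by move=> cf; rewrite /ell; congr (limn _); apply/funext => k; exact: sym_int.
have bnd (f : E -> R) : {within K, continuous f} -> measurable_fun (K : set (borel E)) (f : borel E -> R) /\
    exists Mf, forall x, K x -> `|f x| <= Mf.
  move=> cf; split; first exact: within_measurable.
  by have [Mf [_ ?]] := within_compact_bounded cK cf; exists Mf.
have ellD i j (f g : E -> R) : {within K, continuous f} -> {within K, continuous g} ->
    ell i j (fun x => f x + g x) = ell i j f + ell i j g.
  move=> cf cg; apply: cvg_lim => //.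
  have [mf [Mf fM]] := bnd f cf; have [mg [Mg gM]] := bnd g cg.
  under eq_fun => k do rewrite (charge_integralD _ mK mf mg fM gM).
  by apply: cvgD; exact: ellP.
have ellZ i j a (f : E -> R) : {within K, continuous f} ->
    ell i j (fun x => a * f x) = a * ell i j f.
  move=> cf; apply: cvg_lim => //; have [mf [Mf fM]] := bnd f cf.
  under eq_fun => k do rewrite (charge_integralZ _ _ mK mf fM).
  by apply: cvgM; [exact: cvg_cst|exact: ellP].
pose ellw (w : 'cV[R]_n) (f : E -> R) : R := \sum_(p : 'I_n * 'I_n) w p.1 0 * w p.2 0 * ell p.1 p.2 f.
have ellwP (w : 'cV[R]_n) (f : E -> R) : {within K, continuous f} ->
    \sum_(p : 'I_n * 'I_n) w p.1 0 * w p.2 0 * charge_integral (u k p.1 p.2) K f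
    @[k --> \oo] --> ellw w f.
  move=> cf; apply: cvg_sum_fin => p.
  by apply: cvgM; [exact: cvg_cst|exact: ellP].
have ellw_pos w : positive_functional K (ellw w).
  split.
  - move=> f g cf cg; rewrite /ellw -big_split/=; apply: eq_bigr => p _.
    by rewrite ellD// mulrDr.
  - move=> a f cf; rewrite /ellw mulr_sumr; apply: eq_bigr => p _.
    by rewrite ellZ// mulrCA.
  - move=> f cf f0; rewrite -(cvg_lim _ (ellwP w f cf))//; apply: limr_ge.
      by apply/cvg_ex; exists (ellw w f); exact: ellwP.
    apply: nearW => k.
    have [mf [Mf fM]] := bnd f cf.
    have [eta heta] := charge_lincomb (index_enum ('I_n * 'I_n)%type)
      (fun p => w p.1 0 * w p.2 0) (fun p => u k p.1 p.2).
    rewrite -(charge_integral_lincomb heta mK mf fM).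
    apply: (charge_integral_ge0 mK mf fM) => // A mA.
    have [_ /(_ w)] := psdu k A mA; rewrite heta// quad_sum; congr (_ <= _).
    by apply: eq_bigr => p _; rewrite mxE.
have [mu hmu] := choice (fun w => riesz_representation cK (ellw_pos w)).
have muK w A : measurable A -> A `&` (K : set (borel E)) = set0 -> mu w A = 0%E.
  move=> mA AK; have [mu0 _] := hmu w; apply/eqP; rewrite eq_le measure_ge0 andbT -mu0.
  rewrite le_measure ?inE//; first exact: measurableC.
  by move=> x Ax Kx; have : (A `&` K) x by []; rewrite AK.
have muI w (f : E -> R) : {within K, continuous f} ->
    charge_integral (charge_of_finite_measure (mu w)) K f = ellw w f.
  move=> cf; have [mf [Mf fM]] := bnd f cf.
  by rewrite (charge_integral_finite_measure _ mK mf fM); have [_ ->] := hmu w.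
pose e i : 'cV[R]_n := delta_mx i 0.
pose a (b : 'I_3) : R := if b == 0 then 2^-1 else - 2^-1.
(* Polarization: G_ij is half of the measure of e_i + e_j minus those of e_i and e_j. *)
pose w3 i j (b : 'I_3) : 'cV[R]_n := if b == 0 then e i + e j else if b == 1 then e i else e j.
have hG i j := charge_lincomb (index_enum 'I_3) a (fun b => charge_of_finite_measure (mu (w3 i j b))).
pose G : mxmeasure E n n := \matrix_(i, j) projT1 (cid (hG i j)).
have GE i j A : measurable A -> fine (G i j A) = 2^-1 * fine (mu (e i + e j) A)
    - 2^-1 * fine (mu (e i) A) - 2^-1 * fine (mu (e j) A).
  move=> mA; rewrite mxE (projT2 (cid (hG i j)))// !big_ord_recl big_ord0 /a /w3 /=.
  by rewrite addr0 addrA !mulNr.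
have GI i j (f : E -> R) : {within K, continuous f} -> charge_integral (G i j) K f = ell i j f.
  move=> cf; have [mf [Mf fM]] := bnd f cf.
  rewrite mxE (charge_integral_lincomb (projT2 (cid (hG i j))) mK mf fM).
  rewrite !big_ord_recl big_ord0 /a /w3 /= !muI//.
  pose A : 'M[R]_n := \matrix_(p, q) ell p q f.
  have ellwA w : ellw w f = (w^T *m A *m w) 0 0.
    by rewrite quad_sum; apply: eq_bigr => p _; rewrite mxE.
  have ellwE (p q : 'I_n) : ellw (e p + e q) f = ell p p f + ell q q f + ell p q f + ell q p f.
    have tD (x y : 'cV[R]_n) : (x + y)^T = x^T + y^T by apply/matrixP => a' b'; rewrite !mxE.
    rewrite ellwA tD /e mulmxDr !mulmxDl !trmx_delta -!rowE -!colE !mxE.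
    by move: (ell p p f) (ell q q f) (ell p q f) (ell q p f) => z1 z2 z3 z4; ring.
  have ellwe (p : 'I_n) : ellw (e p) f = ell p p f.
    by rewrite ellwA /e trmx_delta -rowE -colE !mxE.
  rewrite ellwE !ellwe (ell_sym j i)//.
  by move: (ell i i f) (ell j j f) (ell i j f) => z1 z2 z3; lra.
exists G; split; last by move=> i j f cf; rewrite GI//; exact: ellP.
move=> A mA; split; last first.
  move=> AK; apply/matrixP => i j; rewrite mxE GE// !muK//= mxE; lra.
have conc i j : concentrated (G i j) K.
  by move=> B mB BK; rewrite GE// !muK//=; lra.
split.
  apply/matrixP => i j.
  have -> : (mval G A)^T i j = fine (G j i A) by rewrite /mval 2![in LHS]mxE.
  have -> : mval G A i j = fine (G i j A) by rewrite /mval [in LHS]mxE.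
  by rewrite GE// GE// (addrC (e j)); lra.
(* Only finitely many vectors entered the definition of [G]; for arbitrary [w] the combination of
   entries has the same integrals as the positive measure [mu w], hence equals it. *)
move=> w; have [eta heta] := charge_lincomb (index_enum ('I_n * 'I_n)%type)
  (fun p => w p.1 0 * w p.2 0) (fun p => G p.1 p.2).
have -> : (w^T *m mval G A *m w) 0 0 = fine (eta A).
  by rewrite heta// quad_sum; apply: eq_bigr => p _; rewrite mxE.
rewrite (@charge_unique _ _ eta (charge_of_finite_measure (mu w)) K)//.
- exact: fine_ge0.
- move=> B mB BK; rewrite heta// big1// => p _.
  by rewrite conc// mulr0.
- by move=> B mB BK; rewrite [fine _]/(fine (mu w B)) muK.
- move=> f cf; have wf := @continuous_subspaceT E R K f cf.
  have [mf [Mf fM]] := bnd f wf.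
  rewrite (charge_integral_lincomb heta mK mf fM) muI//.
  by apply: eq_bigr => p _; rewrite GI.
Qed.

End WeakLimits.

(** * Estimates along curves of finite action *)

Section TestFunctions.
Context {R : realType} {n d : nat}.
Implicit Types (Q : set (R * 'rV[R]_d)) (g : 'rV[R]_d -> R).

(** These products, affine in time, are the test functions of all the estimates below. *)
Lemma C1_affine_mul Q g (g' : 'I_d -> 'rV[R]_d -> R) (S : 'M[R]_n) (a b : R) :
  continuous g ->
  (forall j, continuous (g' j) /\ forall x, is_derive x (ebase j) g (g' j x)) ->
  S^T = S ->
  C1 Q (fun z => ((a + b * z.1) * g z.2) *: S) (fun z => (b * g z.2) *: S)
    (fun j z => ((a + b * z.1) * g' j z.2) *: S).
Proof.
move=> cg hg' sS.
have cZ (f : R * 'rV[R]_d -> R) : continuous f -> continuous (fun z => f z *: S).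
  by move=> cf z; apply: cvgZr_tmp; exact: cf.
have c2 (f : 'rV[R]_d -> R) : continuous f -> continuous (fun z : R * 'rV[R]_d => f z.2).
  by move=> cf z; apply: (@continuous_comp _ _ _ snd f z); [exact: cvg_snd|exact: cf].
have ca : continuous (fun z : R * 'rV[R]_d => a + b * z.1).
  move=> z; apply: cvgD; first exact: cvg_cst.
  by apply: cvgM; [exact: cvg_cst|exact: cvg_fst].
split.
- by move=> z _; rewrite /symm /= linearZ /= sS.
- by apply: continuous_subspaceT; apply: cZ; apply: continuous_mulr => //; exact: c2.
- apply: continuous_subspaceT; apply: cZ; apply: continuous_mulr.
    exact: cst_continuous.
  exact: c2.
- move=> j; have [cg' _] := hg' j.
  by apply: continuous_subspaceT; apply: cZ; apply: continuous_mulr => //; exact: c2.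
- move=> z _; split.
    apply/is_derive_normP => e e0; exists 1 => // h h0 _.
    rewrite /= -!scalerBl scalerA -scalerBl scaler0 add0r.
    rewrite (_ : _ - _ = 0) ?scale0r ?normr0 ?mulr_ge0 ?(ltW e0)//.
    have -> : h%:A = h by exact: mulr1.
    by ring.
  move=> j; have [_ /(_ z.2)/is_derive_normP dg'] := hg' j.
  apply/is_derive_normP => e e0.
  pose C := `|a + b * z.1| * `|S| + 1.
  have C0 : 0 < C by rewrite ltr_wpDl// mulr_ge0.
  have [r r0 hr] := dg' _ (divr_gt0 e0 C0); exists r => // h h0 hr'.
  rewrite /= scaler0 add0r -scalerBl scalerA -scalerBl.
  have -> : (a + b * z.1) * g (h *: ebase j + z.2) - (a + b * z.1) * g z.2 -
    h * ((a + b * z.1) * g' j z.2) =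
    (a + b * z.1) * (g (h *: ebase j + z.2) - g z.2 - h *: g' j z.2).
    have -> : h *: g' j z.2 = h * g' j z.2 by [].
    ring.
  rewrite normrZ normrM mulrAC.
  apply: (@le_trans _ _ (C * (e / C * `|h|))).
    by rewrite ler_pM ?hr ?mulr_ge0//; rewrite lerDl.
  by rewrite mulrA mulrCA mulfV ?mulr1// lt0r_neq0.
Qed.

End TestFunctions.

Lemma within_entry (R : realType) (E : normedModType R) m n (K : set E)
    (Phi : E -> 'M[R]_(m, n)) i j :
  {within K, continuous Phi} -> {within K, continuous (fun x => Phi x i j)}.
Proof.
move=> cP x; exact: (@continuous_comp (subspace K) _ _ Phi (fun M : 'M[R]_(m, n) => M i j) x (cP x)
  (@coord_continuous R m n i j _)).
Qed.

Section Pairing.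
Context {R : realType} {E : normedModType R} {m n : nat}.
Implicit Types (mu : mxmeasure E m n) (K : set E) (V : set 'M[R]_(m, n)).

Lemma normr_pairing_le K V mu (Phi : E -> 'M[R]_(m, n)) B : compact K ->
  measures K V mu -> (forall i j, {within K, continuous (fun x => Phi x i j)}) ->
  (forall x i j, K x -> `|Phi x i j| <= B) ->
  `|pairing K Phi mu| <= B * \sum_i \sum_j tv (mu i j) setT.
Proof.
move=> cK muK cP PB; have mK := borel_compact cK.
rewrite mulr_sumr; apply: le_trans (ler_norm_sum _ _ _) _.
apply: ler_sum => i _; rewrite mulr_sumr; apply: le_trans (ler_norm_sum _ _ _) _.
apply: ler_sum => j _.
have <- := concentrated_tv mK (@measures_concentrated _ _ _ _ K V mu i j muK).
apply: normr_charge_integral => //; last by move=> x Kx; exact: PB.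
exact: within_measurable.
Qed.

Lemma pairing_cst K V mu (S : 'M[R]_(m, n)) : compact K -> measures K V mu ->
  pairing K (fun=> S) mu = frob S (mval mu setT).
Proof.
move=> cK muK; have mK := borel_compact cK.
rewrite frobE /pairing; do 2!apply: eq_bigr => ? _.
rewrite mxE charge_integral_cst// -[X in fine (_ X)](setTI K) concentrated_setI//.
exact: measures_concentrated muK.
Qed.

End Pairing.

Section ActionBounds.
Context {R : realType} {E : normedModType R} {n k : nat}.
Variables (L1 : 'M[R]_k) (L2 : 'M[R]_n).
Implicit Types (G r : mxmeasure E n n) (q : mxmeasure E n k).

Lemma action_le_ge0 G q r a : action_le L1 L2 G q r a -> 0 <= a.
Proof.
move=> /(_ (fun=> set0) (fun=> (0, 0, 0, 0)) 0%N); rewrite big_ord0; apply => //.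
exact: trivIset_set0.
Qed.

Lemma action_le1 G q r a p (A : set (borel E)) : action_le L1 L2 G q r a -> measurable A ->
  Jlin L1 L2 p (mval G A) (mval q A) (mval r A) <= a.
Proof.
move=> h mA; have := h (fun i => if i == 0%N then A else set0) (fun=> p) 1%N.
rewrite big_ord_recl big_ord0 addr0 /=; apply.
  by move=> [|i] //=; exact: measurable0.
by move=> [|i] [|j] _ _ //= -[x []].
Qed.

Lemma action_le2 G q r a p p' (A B : set (borel E)) : action_le L1 L2 G q r a ->
  measurable A -> measurable B -> A `&` B = set0 ->
  Jlin L1 L2 p (mval G A) (mval q A) (mval r A) +
  Jlin L1 L2 p' (mval G B) (mval q B) (mval r B) <= a.
Proof.
move=> h mA mB AB; have := h (fun i => if i == 0%N then A else if i == 1%N then B else set0)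
  (fun i => if i == 0%N then p else p') 2%N.
rewrite !big_ord_recl big_ord0 addr0 /=; apply.
  by move=> [|[|i]] //=; exact: measurable0.
by move=> [|[|i]] [|[|j]] _ _ //= []; rewrite ?(setIC B) ?AB => x [].
Qed.

Lemma action_le_psd G q r a (A : set (borel E)) :
  action_le L1 L2 G q r a -> measurable A -> symm (mval G A) -> psd (mval G A).
Proof.
move=> h mA sG; split=> // v; rewrite leNgt; apply/negP => qv.
set x := (_ *m v) 0 0 in qv; have a0 := action_le_ge0 h.
(* With s >= 1 the minorant - s^2 x / 2 is at least a - x / 2, which is more than [a] when x < 0. *)
pose s := 1 + 2 * a / - x.
have := action_le1 (0, 0, s *: v, 0) h mA.
rewrite JlinE quad_scale -/x trmx0 subrr !mul0mx !frob0l.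
have s1 : 1 <= s by rewrite lerDl mulr_ge0 ?mulr_ge0// invr_ge0 oppr_ge0 ltW.
have hs : s * - x = - x + 2 * a.
  by rewrite /s mulrDl mul1r mulrVK// unitfE oppr_eq0 lt_eqF.
have : s * - x <= s ^+ 2 * - x.
  by rewrite ler_wpM2r ?oppr_ge0 ?(ltW qv)// expr2 ler_peMr// (le_trans ler01).
by lra.
Qed.

Lemma frob_delta_quad m (X : 'M[R]_n) (L : 'M[R]_m) i j : psd X ->
  frob (delta_mx i j *m L) (X *m (delta_mx i j *m L)) <= \tr X * frob L L.
Proof.
move=> pX; have dL (a : 'I_n) (b : 'I_m) : (delta_mx i j *m L) a b = (a == i)%:R * L j b.
  rewrite mxE (bigD1 j)//= big1 ?addr0 ?mxE ?eqxx ?andbT// => l lj.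
  by rewrite mxE (negPf lj) andbF mul0r.
have -> : frob (delta_mx i j *m L) (X *m (delta_mx i j *m L)) = X i i * \sum_b L j b * L j b.
  rewrite frobE (bigD1 i)//= [X in _ + X]big1 ?addr0; last first.
    by move=> l li; rewrite big1// => b _; rewrite dL (negPf li) !mul0r.
  rewrite mulr_sumr; apply: eq_bigr => b _; rewrite dL eqxx mul1r mxE (bigD1 i)//= big1 ?addr0.
    by rewrite dL eqxx mul1r mulrCA.
  by move=> l li; rewrite dL (negPf li) mul0r mulr0.
have dX l : 0 <= X l l.
  have [_ /(_ (delta_mx l 0))] := pX.
  by rewrite trmx_delta -rowE -colE !mxE.
have sL l : 0 <= \sum_b L l b * L l b by apply: sumr_ge0 => b _; rewrite -expr2 sqr_ge0.
apply: ler_pM => //.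
- by rewrite /mxtrace (bigD1 i)//= lerDl sumr_ge0.
- by rewrite frobE [leRHS](bigD1 j)//= lerDl sumr_ge0.
Qed.

Lemma frob_delta m l (A : 'M[R]_(m, l)) i j : frob (delta_mx i j) A = A i j.
Proof.
rewrite frobE (bigD1 i)//= (bigD1 j)//= mxE !eqxx mul1r.
rewrite big1 ?addr0 => [|b bj]; last by rewrite mxE (negPf bj) andbF mul0r.
rewrite big1 ?addr0// => c ci; rewrite big1// => b _.
by rewrite mxE (negPf ci) mul0r.
Qed.

Let cL := frob L1 L1 + frob L2 L2.

Lemma frob_ge0 m l (A : 'M[R]_(m, l)) : 0 <= frob A A.
Proof. by rewrite frobE; do 2!(apply: sumr_ge0 => ? _); rewrite -expr2 sqr_ge0. Qed.

(** Take the Hahn sets of an entry and the parameters [s] and [- s] times the elementary matrix on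
    them: the linear terms add up to [s] times the variation, and the quadratic terms are at most of
    order [s ^+ 2] times the trace. Then divide by [s]. *)
Lemma action_le_tv G q r a s : (forall A, measurable A -> psd (mval G A)) ->
  action_le L1 L2 G q r a -> 0 < s ->
  (forall i j, tv (q i j) setT <= a / s + s * cL * \tr (mval G setT)) /\
  (forall i j, tv (r i j) setT <= a / s + s * cL * \tr (mval G setT)).
Proof.
move=> pG h s0; have cL1 := frob_ge0 L1; have cL2 := frob_ge0 L2.
have cL0 : 0 <= cL by rewrite /cL addr_ge0.
have key x (P N : set (borel E)) c : measurable P -> measurable N -> P `&` N = set0 ->
    0 <= c -> c <= cL ->
    s * x - 2^-1 * (s ^+ 2 * (\tr (mval G P) * c)) - 2^-1 * (s ^+ 2 * (\tr (mval G N) * c)) <= a ->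
    x <= a / s + s * cL * \tr (mval G setT).
  move=> mP mN PN c0 cc hx.
  have hT : \tr (mval G P) + \tr (mval G N) <= \tr (mval G setT).
    rewrite -mxtraceD -mvalU//; apply: trace_mval_mono => //; exact: measurableU.
  have T0 (B : set (borel E)) : measurable B -> 0 <= \tr (mval G B).
    move=> mB; apply: sumr_ge0 => i _; have [_ /(_ (delta_mx i 0))] := pG B mB.
    by rewrite trmx_delta -rowE -colE !mxE.
  have TP := T0 _ mP; have TN := T0 _ mN; have TT := T0 _ measurableT.
  have hc : (\tr (mval G P) + \tr (mval G N)) * c <= \tr (mval G setT) * cL.
    by apply: ler_pM => //; rewrite addr_ge0.
  rewrite -(ler_pM2l s0) mulrDr mulrCA mulfV ?mulr1 ?lt0r_neq0//.
  have s2 : 0 <= s ^+ 2 by exact: sqr_ge0.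
  have := ler_wpM2l s2 hc.
  have : 0 <= s ^+ 2 * (\tr (mval G setT) * cL) by apply: mulr_ge0 => //; exact: mulr_ge0.
  move: hx.
  set tP := \tr (mval G P); set tN := \tr (mval G N); set tT := \tr (mval G setT).
  lra.
split=> i j.
- have [P [N [mP mN PN ->//]]] := tv_hahn (q i j); rewrite !setTI.
  apply: (key _ P N (frob L1 L1)) => //; first by rewrite /cL lerDl.
  apply: le_trans (action_le2 (s *: delta_mx i j, 0, 0, 0) (- s *: delta_mx i j, 0, 0, 0) h mP mN PN).
  rewrite !JlinE trmx0 subrr !mulmx0 !mul0mx !frob0l -!scalemxAl -!scalemxAr !frobZl !frobZr !frob_delta !mxE.
  have := frob_delta_quad L1 i j (pG P mP); have := frob_delta_quad L1 i j (pG N mN).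
  have s2 : 0 <= s ^+ 2 by exact: sqr_ge0.
  move=> /(ler_wpM2l s2) + /(ler_wpM2l s2); rewrite !expr2; lra.
- have [P [N [mP mN PN ->//]]] := tv_hahn (r i j); rewrite !setTI.
  apply: (key _ P N (frob L2 L2)) => //; first by rewrite /cL lerDr.
  apply: le_trans (action_le2 (0, s *: delta_mx i j, 0, 0) (0, - s *: delta_mx i j, 0, 0) h mP mN PN).
  rewrite !JlinE trmx0 subrr !mulmx0 !mul0mx !frob0l -!scalemxAl -!scalemxAr !frobZl !frobZr !frob_delta !mxE.
  have := frob_delta_quad L2 i j (pG P mP); have := frob_delta_quad L2 i j (pG N mN).
  have s2 : 0 <= s ^+ 2 by exact: sqr_ge0.
  move=> /(ler_wpM2l s2) + /(ler_wpM2l s2); rewrite !expr2; lra.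
Qed.

End ActionBounds.

Lemma sum2_const (R : realType) m k (x : R) :
  \sum_(i < m) \sum_(j < k) x = m%:R * k%:R * x.
Proof. by rewrite !sumr_const !card_ord -mulrA !mulr_natl. Qed.

Section MatrixFields.
Context {R : realType} {E : normedModType R}.
Implicit Types K : set E.

Lemma within_linear K n m k (L : {linear 'M[R]_n -> 'M[R]_(m, k)}) (Phi : E -> 'M[R]_n) :
  (forall i j, {within K, continuous (fun x => Phi x i j)}) ->
  forall i j, {within K, continuous (fun x => L (Phi x) i j)}.
Proof.
move=> cP i j.
rewrite (_ : (fun x => _) = fun x => \sum_a \sum_b L (delta_mx a b) i j * Phi x a b).
  by apply: within_sum => a; apply: within_sum => b; exact: withinZ.
apply/funext => x; rewrite {1}(matrix_sum_delta (Phi x)) linear_sum summxE.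
apply: eq_bigr => a _; rewrite linear_sum summxE; apply: eq_bigr => b _.
by rewrite linearZ mxE mulrC.
Qed.

Lemma within_Dstar K n k d (L0 : {linear 'M[R]_n -> 'M[R]_(n, k)})
    (Lx : 'I_d -> {linear 'M[R]_n -> 'M[R]_(n, k)}) 
    (Phi : E -> 'M[R]_n) (Phix : 'I_d -> E -> 'M[R]_n) :
  (forall i j, {within K, continuous (fun x => Phi x i j)}) ->
  (forall l i j, {within K, continuous (fun x => Phix l x i j)}) ->
  forall i j, {within K, continuous (fun x => Dstar L0 Lx Phi Phix x i j)}.
Proof.
move=> cP cPx i j; under eq_fun => x do rewrite /Dstar mxE summxE.
apply: withinD; first exact: within_linear.
by apply: within_sum => l; apply: within_linear => //; exact: cPx.
Qed.

Lemma within_mx_bounded K m k (Phi : E -> 'M[R]_(m, k)) : compact K ->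
  (forall i j, {within K, continuous (fun x => Phi x i j)}) ->
  exists2 B, 0 < B & forall x i j, K x -> `|Phi x i j| <= B.
Proof.
move=> cK cP.
have [M hM] := choice (fun p : 'I_m * 'I_k => within_compact_bounded cK (cP p.1 p.2)).
exists (1 + \sum_p M p) => [|x i j Kx].
  by rewrite ltr_pwDl// sumr_ge0// => p _; have [/ltW] := hM p.
have [_ /(_ _ Kx)/= h] := hM (i, j); apply: le_trans h _.
rewrite (bigD1 (i, j))//= addrCA lerDl addr_ge0// sumr_ge0// => p _.
by have [/ltW] := hM p.
Qed.

End MatrixFields.

Section ContinuityEquation.
Context {R : realType} {n k d : nat}.
Variables (L0 : {linear 'M[R]_n -> 'M[R]_(n, k)})
          (Lx : 'I_d -> {linear 'M[R]_n -> 'M[R]_(n, k)}).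
Variables (L1 : 'M[R]_k) (L2 : 'M[R]_n) (Om : set 'rV[R]_d).
Hypotheses (L0_id : L0 1%:M = 0) (cOm : compact Om).
Let E := (R * 'rV[R]_d)%type.
Let Q : set E := cylinder Om.
Implicit Types (G r : mxmeasure E n n) (q : mxmeasure E n k).
Let mOm := mxmeasure 'rV[R]_d n n.

Lemma compact_cylinder : compact Q.
Proof. by apply: compact_setX => //; exact: segment_compact. Qed.
Let cQ := compact_cylinder.

Lemma CE_affine (G0 G1 : mOm) G q r (a b : R) g g' (S : 'M[R]_n) : CE L0 Lx Om G0 G1 (G, q, r) ->
  continuous g -> (forall j, continuous (g' j) /\ forall x, is_derive x (ebase j) g (g' j x)) ->
  S^T = S ->
  pairing Q (fun z => (b * g z.2) *: S) G
  + pairing Q (Dstar L0 Lx (fun z => ((a + b * z.1) * g z.2) *: S)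
      (fun j z => ((a + b * z.1) * g' j z.2) *: S)) q
  + pairing Q (fun z => ((a + b * z.1) * g z.2) *: S) r
  = pairing Om (fun x => ((a + b) * g x) *: S) G1 - pairing Om (fun x => (a * g x) *: S) G0.
Proof.
move=> [_ _ _ h] cg hg' sS; rewrite (h _ _ _ (C1_affine_mul _ a b cg hg' sS)).
by rewrite /= mulr1 mulr0 addr0.
Qed.

(** Test with (1 - t) I, whose time derivative gives the trace of [G], and with I. [Dstar] vanishes
    on both since it annihilates constants times the identity. *)
Lemma CE_mass (G0 G1 : mOm) G q r : measures Om psd G0 -> measures Om psd G1 ->
  CE L0 Lx Om G0 G1 (G, q, r) ->
  `|\tr (mval G setT) - \tr (mval G0 setT)| <= \sum_i \sum_j tv (r i j) setT /\
  `|\tr (mval G1 setT) - \tr (mval G0 setT)| <= \sum_i \sum_j tv (r i j) setT.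
Proof.
move=> m0 m1 hCE; have [mG _ mr _] := hCE.
have c1 : continuous (fun _ : 'rV[R]_d => 1 : R) by exact: cst_continuous.
have c0 (j : 'I_d) : continuous (fun _ : 'rV[R]_d => 0 : R) /\
    forall x, is_derive x (ebase j) (fun _ : 'rV[R]_d => 1 : R) 0.
  by split=> [|x]; [exact: cst_continuous|exact: is_derive_cst].
have D0 a b : Dstar L0 Lx (fun z : E => ((a + b * z.1) * 1) *: (1%:M : 'M[R]_n))
      (fun j z => ((a + b * z.1) * 0) *: (1%:M : 'M[R]_n)) = fun=> 0.
  apply/funext => z; rewrite /Dstar linearZ/= L0_id scaler0 add0r big1// => j _.
  by rewrite mulr0 scale0r linear0.
have mq : measures Q setT q by have [_ ? _ _] := hCE.
have q0 : pairing Q (fun=> 0) q = 0.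
  by rewrite (pairing_cst _ cQ mq) frob0l.
have frob1 c (X : 'M[R]_n) : frob (c *: 1%:M) X = c * \tr X.
  by rewrite frobZl /frob trmx1 mul1mx.
have rbound a b : (forall t, 0 <= t <= 1 -> `|a + b * t| <= 1) ->
   `|pairing Q (fun z => ((a + b * z.1) * 1) *: (1%:M : 'M[R]_n)) r| <=
   \sum_i \sum_j tv (r i j) setT.
  move=> hab; rewrite -[leRHS]mul1r; apply: (normr_pairing_le cQ mr).
    move=> i j; under eq_fun do rewrite !mxE mulr1.
    apply: withinM; last exact: within_cst.
    apply: withinD; first exact: within_cst.
    apply: withinZ; apply: continuous_subspaceT => z; exact: cvg_fst.
  move=> [t x] i j [/= t01 _]; rewrite !mxE mulr1 normrM.
  rewrite -[leRHS]mulr1; apply: ler_pM => //; last by case: (i == j); rewrite ?normr1 ?normr0.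
  by apply: hab; move: t01; rewrite /= in_itv.
have := CE_affine 1 (-1) hCE c1 c0 (trmx1 _ _).
have := CE_affine 1 0 hCE c1 c0 (trmx1 _ _).
rewrite !D0 !q0 !(pairing_cst _ cQ mG) !(pairing_cst _ cOm m0) !(pairing_cst _ cOm m1).
rewrite !frob1 !mulr1 !mul0r !addr0 !mul1r subrr mul0r !add0r => h1 h2.
have b1 : `|pairing Q (fun z => ((1 + 0 * z.1) * 1) *: (1%:M : 'M[R]_n)) r| <=
   \sum_i \sum_j tv (r i j) setT.
  by apply: rbound => t _; rewrite mul0r addr0 normr1.
have b2 : `|pairing Q (fun z => ((1 + -1 * z.1) * 1) *: (1%:M : 'M[R]_n)) r| <=
   \sum_i \sum_j tv (r i j) setT.
  by apply: rbound => t /andP[t0 t1]; rewrite ler_norml; apply/andP; split; lra.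
split.
  by move: b2; congr (`| _ | <= _); lra.
by move: b1; congr (`| _ | <= _); lra.
Qed.

Lemma action_le_curve_psd (G0 G1 : mOm) G q r a (A : set (borel E)) : CE L0 Lx Om G0 G1 (G, q, r) ->
  action_le L1 L2 G q r a -> measurable A -> psd (mval G A).
Proof.
by move=> [mG _ _ _] h mA; apply: (action_le_psd h mA); have [] := mG A mA.
Qed.

Let cL := frob L1 L1 + frob L2 L2.

Lemma CE_mass_le : exists2 C, 0 < C & forall (G0 G1 : mOm) G q r a, measures Om psd G0 ->
  measures Om psd G1 -> CE L0 Lx Om G0 G1 (G, q, r) -> action_le L1 L2 G q r a ->
  \tr (mval G setT) <= 2 * \tr (mval G0 setT) + C * a /\
  \tr (mval G1 setT) <= C * (\tr (mval G0 setT) + a).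
Proof.
have cL0 : 0 <= cL by rewrite /cL addr_ge0 ?frob_ge0.
pose N := (n%:R * n%:R : R) + 1.
have N0 : 0 <= n%:R * n%:R :> R by rewrite mulr_ge0.
have N1 : 0 < N by rewrite ltr_wpDl.
have cL1 : 0 < cL + 1 by rewrite ltr_wpDl.
(* Chosen so that the variations of [r] sum to at most N a / s plus half the trace of [G]; this half
   is absorbed by the left-hand side. *)
pose s := (2 * N * (cL + 1))^-1.
have s0 : 0 < s by rewrite invr_gt0 !mulr_gt0.
have hs : s * (N * (cL + 1)) = 2^-1.
  rewrite /s -(mulrA 2) invfM -mulrA mulVf ?mulr1//.
  by rewrite mulf_neq0// lt0r_neq0.
exists (2 * N / s + 2 + N / s) => [|G0 G1 G q r a m0 m1 hCE ha].
  by rewrite !addr_gt0// !mulr_gt0// invr_gt0.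
have [t0 t1] := CE_mass m0 m1 hCE.
have pG A : measurable A -> psd (mval G A) by move=> mA; exact: (action_le_curve_psd hCE ha mA).
have [_ hr] := action_le_tv pG ha s0.
have a0 := action_le_ge0 ha.
have T0 : 0 <= \tr (mval G setT).
  by apply: sumr_ge0 => i _; have := psd_diag i (pG _ measurableT).
have H : \sum_i \sum_j tv (r i j) setT <= N * (a / s) + 2^-1 * \tr (mval G setT).
  apply: (@le_trans _ _ (\sum_(i < n) \sum_(j < n) (a / s + s * cL * \tr (mval G setT)))).
    by apply: ler_sum => i _; apply: ler_sum => j _; exact: hr.
  rewrite sum2_const -/cL -hs.
  have as0 : 0 <= a / s by rewrite divr_ge0// ltW.
  move: (a / s) (\tr (mval G setT)) as0 T0 => x T x0 T0.
  have h1 : n%:R * n%:R * (x + s * cL * T) <= N * (x + s * cL * T).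
    by rewrite ler_wpM2r ?lerDl// addr_ge0// !mulr_ge0// ltW.
  apply: le_trans h1 _; rewrite mulrDr lerD2l.
  have -> : N * (s * cL * T) = s * N * T * cL by ring.
  have -> : s * (N * (cL + 1)) * T = s * N * T * (cL + 1) by ring.
  by rewrite ler_wpM2l ?lerDl// !mulr_ge0// ltW.
have m00 : 0 <= \tr (mval G0 setT).
  by apply: sumr_ge0 => i _; have [h _] := m0 _ measurableT; have := psd_diag i h.
have Nas : 0 <= N * (a / s) by rewrite mulr_ge0 ?divr_ge0// ltW.
have e1 : (2 * N / s + 2 + N / s) * a = 3 * (N * (a / s)) + 2 * a by ring.
have Nm : 0 <= N / s * \tr (mval G0 setT).
  by rewrite mulr_ge0// divr_ge0// ltW.
move: t0 t1; rewrite !ler_norml => /andP[_ t0] /andP[_ t1]; split.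
  rewrite e1; lra.
rewrite mulrDr e1.
have -> : (2 * N / s + 2 + N / s) * \tr (mval G0 setT) =
  3 * (N / s * \tr (mval G0 setT)) + 2 * \tr (mval G0 setT) by ring.
lra.
Qed.

(** The test function does not depend on time, so the time-derivative term vanishes and the
    increment is carried by [q] and [r]. *)
Lemma CE_pairing_le (S : 'M[R]_n) g : S^T = S -> C1fun g -> exists2 C, 0 < C &
  forall (G0 G1 : mOm) G q r a s, CE L0 Lx Om G0 G1 (G, q, r) -> action_le L1 L2 G q r a -> 0 < s ->
  `|pairing Om (fun x => g x *: S) G1 - pairing Om (fun x => g x *: S) G0| <=
  C * (a / s + s * cL * \tr (mval G setT)).
Proof.
move=> sS [cg [g' hg']].
have wS (f : E -> R) : {within Q, continuous f} ->
    forall i j, {within Q, continuous (fun z => (f z *: S) i j)}.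
  move=> cf i j; under eq_fun do rewrite mxE.
  by apply: withinM => //; exact: within_cst.
pose P (z : E) := ((1 + 0 * z.1) * g z.2) *: S.
pose Px (j : 'I_d) (z : E) := ((1 + 0 * z.1) * g' j z.2) *: S.
have c2 (f : 'rV[R]_d -> R) : continuous f ->
    {within Q, continuous (fun z : E => (1 + 0 * z.1) * f z.2)}.
  move=> cf; apply: withinM.
    by under eq_fun do rewrite mul0r addr0; exact: within_cst.
  apply: continuous_subspaceT => z.
  by apply: (@continuous_comp _ _ _ snd f z); [exact: cvg_snd|exact: cf].
have wP : forall i j, {within Q, continuous (fun z => P z i j)} by apply: wS; exact: c2.
have wPx l : forall i j, {within Q, continuous (fun z => Px l z i j)}.
  by apply: wS; apply: c2; have [] := hg' l.
have wD := @within_Dstar _ _ _ _ _ _ L0 Lx _ _ wP wPx.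
have [B1 B10 hB1] := within_mx_bounded cQ wD.
have [B2 B20 hB2] := within_mx_bounded cQ wP.
exists (B1 * (n%:R * k%:R) + B2 * (n%:R * n%:R) + 1).
  by rewrite ltr_wpDl// addr_ge0// !mulr_ge0// ltW.
move=> G0 G1 G q r a s hCE ha s0; have [mG mq mr _] := hCE.
have pG A : measurable A -> psd (mval G A) by move=> mA; exact: (action_le_curve_psd hCE ha mA).
have [hq hr] := action_le_tv pG ha s0; rewrite -/cL in hq hr.
have := CE_affine 1 0 hCE cg hg' sS.
rewrite -/P -/Px (_ : (fun z : E => (0 * g z.2) *: S) = fun=> 0); last first.
  by apply/funext => z; rewrite mul0r scale0r.
rewrite (pairing_cst _ cQ mG) frob0l add0r addr0.
under [X in pairing Om X G1]eq_fun do rewrite mul1r.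
under [X in pairing Om X G0]eq_fun do rewrite mul1r.
move=> <-; apply: le_trans (ler_normD _ _) _.
have := normr_pairing_le cQ mq wD hB1; have := normr_pairing_le cQ mr wP hB2.
set x := a / s + _ in hq hr *.
have hq' : \sum_i \sum_j tv (q i j) setT <= n%:R * k%:R * x.
  apply: (@le_trans _ _ (\sum_(i < n) \sum_(j < k) x)).
    by apply: ler_sum => i _; apply: ler_sum => j _; exact: hq.
  by rewrite sum2_const.
have hr' : \sum_i \sum_j tv (r i j) setT <= n%:R * n%:R * x.
  apply: (@le_trans _ _ (\sum_(i < n) \sum_(j < n) x)).
    by apply: ler_sum => i _; apply: ler_sum => j _; exact: hr.
  by rewrite sum2_const.
have x0 : 0 <= x.
  rewrite addr_ge0// ?divr_ge0 ?(action_le_ge0 ha)// ?(ltW s0)//.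
  rewrite !mulr_ge0 ?(ltW s0)//; first by rewrite /cL addr_ge0 ?frob_ge0.
  by apply: sumr_ge0 => i _; have := psd_diag i (pG _ measurableT).
have := ler_wpM2l (ltW B10) hq'; have := ler_wpM2l (ltW B20) hr'.
lra.
Qed.

Lemma CE_close (g : 'rV[R]_d -> R) (i j : 'I_n) (m e : R) : C1fun g -> 0 < e -> exists2 dl, 0 < dl &
  forall (G0 G1 : mOm) mu, measures Om psd G0 -> measures Om psd G1 -> \tr (mval G0 setT) <= m ->
  CE L0 Lx Om G0 G1 mu -> action_le L1 L2 mu.1.1 mu.1.2 mu.2 dl ->
  `|charge_integral (G1 i j) Om g - charge_integral (G0 i j) Om g| <= e.
Proof.
(* Test functions must be symmetric; pairing with this [S] yields twice the entry. *)
move=> Cg e0; pose S : 'M[R]_n := delta_mx i j + delta_mx j i.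
have sS : S^T = S.
  by apply/matrixP => a b; rewrite !mxE addrC ![(b == _) && _]andbC.
have [C C0 hC] := CE_pairing_le sS Cg; have [C' C'0 hC'] := CE_mass_le.
have cL0 : 0 <= cL by rewrite /cL addr_ge0 ?frob_ge0.
pose B := 2 * `|m| + C'.
have B0 : 0 < B by rewrite ltr_wpDl// mulr_ge0.
pose D := C * (cL + 1) * B.
have D0 : 0 < D by rewrite !mulr_gt0// ltr_wpDl.
(* First [s] makes the term proportional to the trace, bounded by [B], at most [e]; then the action
   bound is taken small enough for C a / s to be at most [e]. The sum 2 e matches the factor 2 from
   symmetrization. *)
pose s := e / D.
have s0 : 0 < s by rewrite divr_gt0.
exists (Num.min 1 (e * s / C)) => [|G0 G1 [[G q] r] m0 m1 hm hCE ha].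
  by rewrite lt_min ltr01 divr_gt0// mulr_gt0.
have [hT _] := hC' _ _ _ _ _ _ m0 m1 hCE ha.
set dl := Num.min _ _ in ha hT.
have dl1 : dl <= 1 by rewrite ge_min lexx.
have dle : dl <= e * s / C by rewrite ge_min lexx orbT.
have TB : \tr (mval G setT) <= B.
  apply: le_trans hT _; rewrite /B lerD//.
    by rewrite ler_pM2l//; apply: le_trans hm _; exact: ler_norm.
  by rewrite -[leRHS]mulr1 ler_pM2l.
have := hC _ _ _ _ _ _ s hCE ha s0.
have pairS (H : mxmeasure 'rV[R]_d n n) : measures Om psd H ->
    pairing Om (fun x => g x *: S) H = 2 * charge_integral (H i j) Om g.
  move=> mH; have mO := borel_compact cOm; have [cg _] := Cg.
  have wg := @continuous_subspaceT _ R Om g cg.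
  have mg := within_measurable mO wg; have [M [_ gM]] := within_compact_bounded cOm wg.
  pose I : 'M[R]_n := \matrix_(a, b) charge_integral (H a b) Om g.
  have -> : pairing Om (fun x => g x *: S) H = frob S I.
    have IE a b : I a b = charge_integral (H a b) Om g by rewrite mxE.
    rewrite frobE; do 2!(apply: eq_bigr => ? _).
    rewrite IE -(charge_integralZ _ _ mO mg gM).
    by congr charge_integral; apply/funext => x; rewrite mxE mulrC.
  rewrite frobDl !frob_delta !mxE.
  have -> : charge_integral (H j i) Om g = charge_integral (H i j) Om g;
    last by rewrite mulr2n mulrDl mul1r.
  apply: (charge_integral_eq_charge mO mg gM) => A mA; have [[/matrixP/(_ j i) + _] _] := mH A mA.
  by rewrite !mxE.
rewrite !pairS// -mulrBr normrM ger0_norm// => h.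
have h1 : C * (dl / s) <= e.
  rewrite mulrA ler_pdivrMr// mulrC -ler_pdivlMr//.
have h2 : C * (s * cL * \tr (mval G setT)) <= e.
  have : s * D = e by rewrite /s divfK// lt0r_neq0.
  move=> <-; rewrite /D.
  have -> : s * (C * (cL + 1) * B) = C * (s * (cL + 1) * B) by ring.
  rewrite ler_pM2l//.
  apply: (@le_trans _ _ (s * cL * B)).
    by rewrite ler_wpM2l// mulr_ge0// ltW.
  by rewrite ler_pM2r// ler_pM2l// lerDl.
by rewrite mulrDr in h; lra.
Qed.

End ContinuityEquation.

(** * Reparametrization and gluing of curves *)

Lemma charge_integral_pushforward {d} {T : measurableType d} {R : realType} (S : T -> T)
    (nu eta : {charge set T -> \bar R}) (K : set T) (f : T -> R) M :
  measurable_fun setT S -> (forall x, K x -> K (S x)) -> concentrated nu K ->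
  (forall A, measurable A -> fine (eta A) = fine (nu (S @^-1` A))) ->
  measurable K -> measurable_fun K f -> (forall x, K x -> `|f x| <= M) ->
  charge_integral eta K f = charge_integral nu K (f \o S).
Proof.
move=> mS SK nuK etaE mK mf fM.
have mSA A : measurable A -> measurable (S @^-1` A).
  by move=> mA; rewrite -[X in measurable X]setTI; exact: mS.
apply: (@eq_small_dist _ _ _ (tv eta K + tv nu K)) => e e0.
have [N [E [c sf]]] := stepping_exists mK mf fM e0.
have [mE tE UE _ fE] := sf.
have sfS : stepping K (f \o S) e N (fun i => S @^-1` E i `&` K) c.
  split.
  - by move=> i; apply: measurableI => //; exact: mSA.
  - by move=> i j _ _ [x [[Ei _] [Ej _]]]; apply: (tE i j) => //; exists (S x).
  - rewrite -(bigcup_mkord N (fun i => S @^-1` (E i) `&` K)); 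
      apply/seteqP; split=> [x [i _ []]//|x Kx].
    have : K (S x) by exact: SK.
    by rewrite -{1}UE -(bigcup_mkord N E) => -[i iN Ei]; exists i.
  - apply: (measurable_comp mK) => //; first by move=> _ [x Kx <-]; exact: SK.
    exact: measurable_funS mS.
  - by move=> i x iN [Ei _]; exact: (fE i (S x)).
have h1 := charge_integral_stepping eta sf; have := charge_integral_stepping nu sfS.
rewrite (_ : \sum_(i < N) _ = \sum_(i < N) c i * fine (eta (E i))); last first.
  apply: eq_bigr => i _; rewrite etaE// concentrated_setI//; exact: mSA.
move=> h2; rewrite mulrDr; apply: le_trans (ler_distD _ _ _) (lerD h1 _).
by rewrite distrC.
Qed.

Section Reparam.
Context {R : realType} {d : nat}.
Let E := (R * 'rV[R]_d)%type.

Definition reparam (p c : R) (z : E) : E := (p + c * z.1, z.2).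

Lemma reparam_continuous (p c : R) : continuous (reparam p c).
Proof.
move=> z; apply: (@cvg_pair _ _ _ _ (nbhs (p + c * z.1)) (nbhs z.2) _ _ _
  (fun z => p + c * z.1) (fun z => z.2)); last exact: cvg_snd.
apply: cvgD; first exact: cvg_cst.
by apply: cvgM; [exact: cvg_cst|exact: cvg_fst].
Qed.

Lemma reparam_measurable (p c : R) :
  measurable_fun setT (reparam p c : borel E -> borel E).
Proof.
apply: (@measurability _ _ (borel E) (borel E) _ _ (@open E)) => //.
move=> _ [B oB <-]; rewrite setTI; apply: borel_open.
by move: (@reparam_continuous p c) => /continuousP; exact.
Qed.

End Reparam.

Section Curves.
Context {R : realType} {n k d : nat}.
Variables (L0 : {linear 'M[R]_n -> 'M[R]_(n, k)})
          (Lx : 'I_d -> {linear 'M[R]_n -> 'M[R]_(n, k)}).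
Variables (L1 : 'M[R]_k) (L2 : 'M[R]_n) (Om : set 'rV[R]_d).
Hypotheses (cOm : compact Om).
Let E := (R * 'rV[R]_d)%type.
Let Q : set E := cylinder Om.
Let cQ : compact Q := compact_cylinder cOm.
Let mQ : measurable (Q : set (borel E)) := borel_compact cQ.
Let mOm := mxmeasure 'rV[R]_d n n.
Let mCurve := (mxmeasure E n n * mxmeasure E n k * mxmeasure E n n)%type.

(* [mu] solves the continuity equation on [s, t] instead of [0, 1], extended by
   zero outside. *)
Definition CE_on (s t : R) (H H' : mOm) (mu : mCurve) :=
  [/\ measures Q symm mu.1.1, measures Q setT mu.1.2, measures Q setT mu.2 &
    forall Phi Phit Phix, C1 Q Phi Phit Phix ->
      pairing Q Phit mu.1.1 + pairing Q (Dstar L0 Lx Phi Phix) mu.1.2 + pairing Q Phi mu.2 =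
      pairing Om (fun x => Phi (t, x)) H' - pairing Om (fun x => Phi (s, x)) H].

Lemma CE_onE (H H' : mOm) mu : CE L0 Lx Om H H' mu <-> CE_on 0 1 H H' mu.
Proof. by case: mu => [[G q] r]. Qed.

Lemma reparam_cylinder (p c : R) z : 0 <= p <= 1 -> 0 <= p + c <= 1 -> Q z -> Q (reparam p c z).
Proof.
move=> /andP[p0 p1] /andP[pc0 pc1] [/=]; rewrite in_itv/= => /andP[t0 t1] Omz.
split=> //=; rewrite in_itv/=; move: z.1 t0 t1 => t t0 t1; apply/andP; split; nra.
Qed.

Lemma reparam_interior (p c : R) z : 0 <= p <= 1 -> 0 <= p + c <= 1 -> c != 0 ->
  Q° z -> Q° (reparam p c z).
Proof.
move=> hp hpc c0 /nbhs_ballP[r /= r0 rQ].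
have c1 : 0 < Num.min 1 `|c| by rewrite lt_min ltr01 normr_gt0.
apply/nbhs_ballP; exists (r * Num.min 1 `|c|); first exact: mulr_gt0.
move=> y [/=]; rewrite -!ball_normE /= => hy1 hy2.
(* The time change is invertible, so a point near the image is the image of a point near [z]. *)
have -> : y = reparam p c (c^-1 * (y.1 - p), y.2).
  by case: y {hy1 hy2} => y1 y2; rewrite /reparam /= mulVKf// addrC subrK.
apply: reparam_cylinder => //; apply: rQ; split; rewrite /= -ball_normE /=.
  rewrite -(ltr_pM2l (x := `|c|)) ?normr_gt0// -normrM mulrBr mulVKf//.
  have -> : c * z.1 - (y.1 - p) = p + c * z.1 - y.1 by ring.
  apply: lt_le_trans hy1 _; rewrite mulrC ler_pM2r//.
  by rewrite ge_min lexx orbT.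
by apply: lt_le_trans hy2 _; rewrite -[leRHS]mulr1 ler_pM2l// ge_min lexx.
Qed.

Lemma C1_reparam (p c : R) (Phi Phit : E -> 'M[R]_n) (Phix : 'I_d -> E -> 'M[R]_n) :
  0 <= p <= 1 -> 0 <= p + c <= 1 -> c != 0 ->
  C1 Q Phi Phit Phix ->
  C1 Q (Phi \o reparam p c : E -> 'M[R]_n) (fun z => c *: Phit (reparam p c z))
    (fun j => Phix j \o reparam p c).
Proof.
move=> hp hpc c0 [sP cP cPt cPx dP].
have wS (V : normedModType R) (f : E -> V) :
    {within Q, continuous f} -> {within Q, continuous (f \o reparam p c)}.
  move=> /within_continuous_normP h; apply/within_continuous_normP => x Qx e e0.
  have [r r0 hr] := h _ (reparam_cylinder hp hpc Qx) e e0.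
  have c1 : `|c| <= 1.
    by move: hp hpc => /andP[? ?] /andP[? ?]; rewrite ler_norml; apply/andP; split; lra.
  exists r => // y Qy xy; apply: hr; first exact: reparam_cylinder.
  apply: le_lt_trans xy; rewrite !prod_normE /= ge_max !le_max; apply/andP; split; last first.
    by rewrite lexx orbT.
  rewrite -[X in X <= _]/(`|p + c * x.1 - (p + c * y.1)|).
  have -> : p + c * x.1 - (p + c * y.1) = c * (x.1 - y.1) by ring.
  by rewrite normrM ler_piMl.
split.
- by move=> z Qz; apply: sP; exact: reparam_cylinder.
- exact: wS.
- move=> /= z; apply: cvgZl_tmp; exact: (wS _ _ cPt).
- by move=> j; exact: wS.
- move=> z Qz; have [dt dx] := dP _ (reparam_interior hp hpc c0 Qz); split.
    move: dt => /is_derive_normP dt; apply/is_derive_normP => e e0.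
    have c0' : 0 < `|c| by rewrite normr_gt0.
    have [r r0 hr] := dt _ (divr_gt0 e0 c0').
    exists (r / `|c|) => [|h h0 hr']; first exact: divr_gt0.
    have e1 : reparam p c (h *: (1, 0) + z) = (h * c) *: (1, 0) + reparam p c z.
      apply/pair_equal_spec; split; rewrite /= ?scaler0//.
      have -> : h *: (1 : R) = h by exact: mulr1.
      have -> : (h * c) *: (1 : R) = h * c by exact: mulr1.
      ring.
    have hc : `|h * c| < r by rewrite normrM -ltr_pdivlMr.
    rewrite /= e1 scalerA; apply: le_trans (hr _ (mulf_neq0 h0 c0) hc) _.
    by rewrite normrM mulrCA divfK ?lt0r_neq0// mulrC.
  move=> j; move: (dx j) => /is_derive_normP dxj; apply/is_derive_normP => e e0.
  have [r r0 hr] := dxj _ e0; exists r => // h h0 hr'.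
  have e1 : reparam p c (h *: (0, ebase j) + z) = h *: (0, ebase j) + reparam p c z.
    by apply/pair_equal_spec; split; rewrite /= ?scaler0 ?add0r.
  by rewrite /= e1; exact: hr.
Qed.

End Curves.

Section ChargeLimit.
Context {d} {T : measurableType d} {R : realType}.

Lemma pow2_half_sum (J : nat) : 2^-1 ^+ J = 2 * 2^-1 ^+ J.+1 :> R.
Proof. by rewrite exprS mulVKf// pnatr_eq0. Qed.

Lemma geometric_cauchy (u : nat -> R) C :
  (forall J, `|u J.+1 - u J| <= C * 2^-1 ^+ J) ->
  cvgn u /\ forall J, `|limn u - u J| <= 2 * C * 2^-1 ^+ J.
Proof.
move=> hu.
have C0 : 0 <= C by have := hu 0%N; rewrite expr0 mulr1; exact: le_trans.
have step J m : `|u (J + m)%N - u J| <= 2 * C * 2^-1 ^+ J - 2 * C * 2^-1 ^+ (J + m).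
  elim: m => [|m IH]; first by rewrite addn0 !subrr normr0.
  rewrite addnS; apply: le_trans (ler_distD (u (J + m)%N) _ _) _.
  apply: le_trans (lerD (hu _) IH) _.
  rewrite (pow2_half_sum (J + m)); set x := 2^-1 ^+ (J + m).+1; lra.
have step' J m : `|u (J + m)%N - u J| <= 2 * C * 2^-1 ^+ J.
  by apply: le_trans (step J m) _; rewrite lerBlDr lerDl !mulr_ge0// exprn_ge0.
have x0 : (2 * C) * 2^-1 ^+ J @[J --> \oo] --> (0 : R).
  rewrite -[X in _ --> X](mulr0 (2 * C)); apply: cvgM; first exact: cvg_cst.
  by apply: cvg_expr; rewrite ger0_norm// invf_lt1// ltr1n.
have cu : cvgn u.
  (* Adding this tail makes the sequence nonincreasing, because 2 C 2^-J decreases by exactly C 2^-J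
     at each step. *)
  have cv : cvgn (fun J => u J + 2 * C * 2^-1 ^+ J).
    apply: nonincreasing_is_cvgn.
      apply/nonincreasing_seqP => J; have /ler_normlP[_] := hu J.
      by rewrite (pow2_half_sum J); set x := 2^-1 ^+ J.+1; lra.
    exists (u 0%N - 2 * C) => _ [J _ <-]; have := step' 0%N J.
    rewrite add0n expr0 mulr1 => /ler_normlP[h _].
    have : 0 <= 2 * C * 2^-1 ^+ J by rewrite !mulr_ge0// exprn_ge0.
    by lra.
  rewrite (_ : u = fun J => (u J + 2 * C * 2^-1 ^+ J) - 2 * C * 2^-1 ^+ J); last first.
    by apply/funext => J; rewrite addrK.
  by apply: is_cvgB => //; apply/cvg_ex; exists 0.
split=> // J; rewrite ler_norml lerBlDr lerBrDr; apply/andP; split.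
  apply: limr_ge => //; exists J => // l /= Jl; have := step' J (l - J)%N.
  by rewrite subnKC// => /ler_normlP[h _]; lra.
apply: limr_le => //; exists J => // l /= Jl; have := step' J (l - J)%N.
by rewrite subnKC// => /ler_normlP[_ h]; lra.
Qed.

Lemma half_pow_small (C e : R) : 0 < e -> exists J, C * 2^-1 ^+ J <= e.
Proof.
move=> e0; have : C * 2^-1 ^+ J @[J --> \oo] --> (0 : R).
  rewrite -[X in _ --> X](mulr0 C); apply: cvgM; first exact: cvg_cst.
  by apply: cvg_expr; rewrite ger0_norm// invf_lt1// ltr1n.
by move=> /cvgr_le/(_ _ e0)[J _ /(_ J (leqnn J))]; exists J.
Qed.

Lemma charge_geometric_limit (nu : nat -> {charge set T -> \bar R}) C :
  (forall J A, measurable A -> `|fine (nu J.+1 A) - fine (nu J A)| <= C * 2^-1 ^+ J) ->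
  exists eta : {charge set T -> \bar R}, forall J A, measurable A ->
    `|fine (eta A) - fine (nu J A)| <= 2 * C * 2^-1 ^+ J.
Proof.
move=> h; pose phi A := limn (fun J => fine (nu J A)).
have hphi J A : measurable A -> `|phi A - fine (nu J A)| <= 2 * C * 2^-1 ^+ J.
  by move=> mA; have [_] := @geometric_cauchy (fun J => fine (nu J A)) C (fun J => h J A mA).
have C0 : 0 <= C by have := h 0%N set0 measurable0; rewrite expr0 mulr1; exact: le_trans.
have [phi0 phis] : phi set0 = 0 /\ sigma_additive_fun phi.
  apply: (charge_uniform_limit (eta := nu)) => e /half_pow_small-/(_ (2 * C))[J hJ].
  exists J => A mA.
  by apply: le_trans hJ; exact: hphi.
have [eta etaE] := charge_of_funP phi0 phis.
by exists eta => J A mA; rewrite etaE; exact: hphi.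
Qed.

End ChargeLimit.

Section MatrixMeasureOps.
Context {R : realType} {E : normedModType R} {m l : nat}.
Variable K : set E.
Hypothesis cK : compact K.
Let mK : measurable (K : set (borel E)) := borel_compact cK.
Let entries_within (Phi : E -> 'M[R]_(m, l)) :=
  forall i j, {within K, continuous (fun x => Phi x i j)}.

Lemma mxmeasure_choice (P : 'I_m -> 'I_l -> {charge set (borel E) -> \bar R} -> Prop) :
  (forall i j, exists nu, P i j nu) -> exists mu : mxmeasure E m l, forall i j, P i j (mu i j).
Proof.
move=> h; exists (\matrix_(i, j) projT1 (cid (h i j))) => i j.
by rewrite mxE; exact: projT2 (cid (h i j)).
Qed.

Lemma within_bounded_measurable (f : E -> R) : {within K, continuous f} ->
  measurable_fun (K : set (borel E)) (f : borel E -> R) /\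
  exists M, forall x, K x -> `|f x| <= M.
Proof.
move=> cf; split; first exact: within_measurable.
by have [M [_ ?]] := within_compact_bounded cK cf; exists M.
Qed.

Lemma pairingZ (mu : mxmeasure E m l) a Phi : entries_within Phi ->
  pairing K (fun x => a *: Phi x) mu = a * pairing K Phi mu.
Proof.
move=> cP; rewrite /pairing !mulr_sumr; apply: eq_bigr => i _.
rewrite mulr_sumr; apply: eq_bigr => j _.
have [mf [M fM]] := within_bounded_measurable (cP i j).
rewrite -(charge_integralZ _ _ mK mf fM); apply: eq_charge_integral => x _.
by rewrite mxE.
Qed.

Lemma mxmeasure_add (mu mu' : mxmeasure E m l) : exists nu : mxmeasure E m l,
  (forall A : set (borel E), measurable A -> mval nu A = mval mu A + mval mu' A) /\
  forall Phi, entries_within Phi -> pairing K Phi nu = pairing K Phi mu + pairing K Phi mu'.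
Proof.
have [nu hnu] := mxmeasure_choice (fun i j => charge_lincomb [:: true; false] (fun=> 1 : R)
  (fun b : bool => if b then mu i j else mu' i j)).
exists nu; split.
  move=> A mA; apply/matrixP => i j; rewrite !mxE hnu// !big_cons big_nil/=.
  by rewrite !mul1r addr0.
move=> Phi cP; rewrite /pairing -big_split; apply: eq_bigr => i _.
rewrite -big_split; apply: eq_bigr => j _ /=.
have [mf [M fM]] := within_bounded_measurable (cP i j).
by rewrite (charge_integral_lincomb (hnu i j) mK mf fM) !big_cons big_nil/= !mul1r addr0.
Qed.

Lemma mxmeasure_pushforward (S : borel E -> borel E) a (mu : mxmeasure E m l) :
  measurable_fun setT S -> (forall x, K x -> K (S x)) ->
  (forall i j, concentrated (mu i j) K) ->
  exists nu : mxmeasure E m l,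
  (forall A : set (borel E), measurable A -> mval nu A = a *: mval mu (S @^-1` A)) /\
  forall Phi, entries_within Phi -> pairing K Phi nu = a * pairing K (Phi \o S) mu.
Proof.
move=> mS SK muK.
have [mu' hmu'] := mxmeasure_choice (fun i j => charge_pushforward (mu i j) mS).
have [nu hnu] := mxmeasure_choice (fun i j => charge_lincomb [:: tt] (fun=> a)
  (fun=> mu' i j)).
exists nu; split.
  move=> A mA; apply/matrixP => i j; rewrite !mxE hnu// big_cons big_nil/= addr0.
  by rewrite hmu'.
move=> Phi cP; rewrite /pairing mulr_sumr; apply: eq_bigr => i _.
rewrite mulr_sumr; apply: eq_bigr => j _.
have [mf [M fM]] := within_bounded_measurable (cP i j).
rewrite (charge_integral_lincomb (hnu i j) mK mf fM) big_cons big_nil/= addr0.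
by rewrite (charge_integral_pushforward mS SK (muK i j) (hmu' i j) mK mf fM).
Qed.

(** The geometric bound is uniform over measurable sets, so the variations of the differences tend
    to 0; this gives convergence of pairings and not merely of values. *)
Lemma mxmeasure_limit (mu : nat -> mxmeasure E m l) C :
  (forall J (A : set (borel E)) i j, measurable A ->
     `|mval (mu J.+1) A i j - mval (mu J) A i j| <= C * 2^-1 ^+ J) ->
  exists nu : mxmeasure E m l,
  (forall A : set (borel E), measurable A -> mxcvg (fun J => mval (mu J) A) (mval nu A)) /\
  forall Phi, entries_within Phi -> pairing K Phi (mu J) @[J --> \oo] --> pairing K Phi nu.
Proof.
move=> h.
have [nu hnu] := mxmeasure_choice (fun i j => @charge_geometric_limit _ (borel E) R
  (fun J => mu J i j) C (fun J A mA => ltac:(by have := h J A i j mA; rewrite !mxE))).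
have C0 (i : 'I_m) (j : 'I_l) : 0 <= C.
  by have := h 0%N set0 i j measurable0; rewrite expr0 mulr1; exact: le_trans.
exists nu; split.
  move=> A mA i j; apply/cvgrPdist_le => e e0; have [J hJ] := half_pow_small (2 * C) e0.
  exists J => // J' /= JJ'; rewrite !mxE; apply: le_trans (hnu i j J' A mA) _.
  apply: le_trans hJ; rewrite ler_wpM2l ?mulr_ge0 ?(C0 i j)//.
  by apply: ler_wiXn2l => //; rewrite invf_le1// ler1n.
move=> Phi cP; apply: cvg_sum_fin => i; apply: cvg_sum_fin => j.
have [mf [M fM]] := within_bounded_measurable (cP i j).
(* The variation is a difference of two values, each at most 2 C 2^-J; hence the factor 4. *)
apply/cvgrPdist_le => e e0; have [J hJ] := half_pow_small (`|M| * (4 * C)) e0.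
exists J => // J' /= JJ'.
have [dl hdl] := charge_lincomb [:: true; false] (fun b : bool => if b then 1 else -1 : R)
  (fun b : bool => if b then nu i j else mu J' i j).
have dlE A : measurable A -> fine (dl A) = fine (nu i j A) - fine (mu J' i j A).
  by move=> mA; rewrite hdl// !big_cons big_nil/= addr0 mul1r mulN1r.
have -> : charge_integral (nu i j) K (fun x => Phi x i j) -
    charge_integral (mu J' i j) K (fun x => Phi x i j) =
    charge_integral dl K (fun x => Phi x i j).
  by rewrite (charge_integral_lincomb hdl mK mf fM) !big_cons big_nil/= addr0 mul1r mulN1r.
have fM' x : K x -> `|Phi x i j| <= `|M| by move=> Kx; apply: le_trans (fM x Kx) (ler_norm _).
apply: le_trans (normr_charge_integral dl mK mf fM') _.
apply: le_trans hJ; rewrite -mulrA ler_wpM2l//.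
apply: (@le_trans _ _ (4 * C * 2^-1 ^+ J')); last first.
  rewrite ler_wpM2l ?mulr_ge0 ?(C0 i j)//.
  by apply: ler_wiXn2l => //; rewrite invf_le1// ler1n.
have [P [N [mP mN _ hPN]]] := tv_hahn dl; rewrite hPN// !dlE//; first last.
- exact: measurableI.
- exact: measurableI.
have := hnu i j J' _ (measurableI _ _ mK mP); have := hnu i j J' _ (measurableI _ _ mK mN).
move=> /ler_normlP[h1 h2] /ler_normlP[h3 h4].
move: (_ - _) h3 h4 => x h3 h4; move: (_ - _) h1 h2 => y h1 h2.
have -> : 4 * C * 2^-1 ^+ J' = 2 * C * 2^-1 ^+ J' + 2 * C * 2^-1 ^+ J' by ring.
exact: lerD h4 h1.
Qed.

End MatrixMeasureOps.

Section CurveOps.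
Context {R : realType} {n k d : nat}.
Variables (L0 : {linear 'M[R]_n -> 'M[R]_(n, k)})
          (Lx : 'I_d -> {linear 'M[R]_n -> 'M[R]_(n, k)}).
Variables (L1 : 'M[R]_k) (L2 : 'M[R]_n) (Om : set 'rV[R]_d).
Hypotheses (cOm : compact Om).
Let E := (R * 'rV[R]_d)%type.
Let Q : set E := cylinder Om.
Let cQ : compact Q := compact_cylinder cOm.
Let mQ : measurable (Q : set (borel E)) := borel_compact cQ.
Let mOm := mxmeasure 'rV[R]_d n n.
Let mCurve := (mxmeasure E n n * mxmeasure E n k * mxmeasure E n n)%type.

Lemma C1_entries (Phi Phit : E -> 'M[R]_n) (Phix : 'I_d -> E -> 'M[R]_n) : C1 Q Phi Phit Phix ->
  [/\ forall i j, {within Q, continuous (fun x => Phi x i j)},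
      forall i j, {within Q, continuous (fun x => Phit x i j)} &
      forall i j, {within Q, continuous (fun x => Dstar L0 Lx Phi Phix x i j)}].
Proof.
move=> [_ cP cPt cPx _]; split=> i j; try exact: within_entry.
by apply: within_Dstar => *; exact: within_entry.
Qed.

Lemma action_le_add (mu mu' nu : mCurve) a a' :
  (forall A : set (borel E), measurable A -> mval nu.1.1 A = mval mu.1.1 A + mval mu'.1.1 A) ->
  (forall A : set (borel E), measurable A -> mval nu.1.2 A = mval mu.1.2 A + mval mu'.1.2 A) ->
  (forall A : set (borel E), measurable A -> mval nu.2 A = mval mu.2 A + mval mu'.2 A) ->
  action_le L1 L2 mu.1.1 mu.1.2 mu.2 a -> action_le L1 L2 mu'.1.1 mu'.1.2 mu'.2 a' ->
  action_le L1 L2 nu.1.1 nu.1.2 nu.2 (a + a').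
Proof.
move=> hG hq hr ha ha' F p N mF tF; apply: le_trans (lerD (ha F p N mF tF) (ha' F p N mF tF)).
rewrite -big_split; apply: ler_sum => i _ /=.
by rewrite hG// hq// hr// JlinD.
Qed.

(** The contributions of the intermediate measure at time [t] cancel. The values of the sum are
    exposed so that increments can be estimated when infinitely many curves are concatenated. *)
Lemma CE_on_add s t u (H H' H'' : mOm) (mu mu' : mCurve) a a' :
  CE_on L0 Lx Om s t H H' mu -> CE_on L0 Lx Om t u H' H'' mu' ->
  action_le L1 L2 mu.1.1 mu.1.2 mu.2 a -> action_le L1 L2 mu'.1.1 mu'.1.2 mu'.2 a' ->
  exists nu : mCurve, [/\ CE_on L0 Lx Om s u H H'' nu,
    action_le L1 L2 nu.1.1 nu.1.2 nu.2 (a + a'),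
    forall A : set (borel E), measurable A -> mval nu.1.1 A = mval mu.1.1 A + mval mu'.1.1 A,
    forall A : set (borel E), measurable A -> mval nu.1.2 A = mval mu.1.2 A + mval mu'.1.2 A &
    forall A : set (borel E), measurable A -> mval nu.2 A = mval mu.2 A + mval mu'.2 A].
Proof.
move=> [mG mq mr ce] [mG' mq' mr' ce'] ha ha'.
have [G [GE GI]] := mxmeasure_add cQ mu.1.1 mu'.1.1.
have [q [qE qI]] := mxmeasure_add cQ mu.1.2 mu'.1.2.
have [r [rE rI]] := mxmeasure_add cQ mu.2 mu'.2.
exists (G, q, r); split => //; last exact: (@action_le_add mu mu').
split.
- move=> A mA; have [s1 z1] := mG A mA; have [s2 z2] := mG' A mA; split.
    by rewrite /symm /= GE// linearD/= s1 s2.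
  by move=> AQ; rewrite GE// z1// z2// addr0.
- move=> A mA; have [_ z1] := mq A mA; have [_ z2] := mq' A mA; split => // AQ.
  by rewrite qE// z1// z2// addr0.
- move=> A mA; have [_ z1] := mr A mA; have [_ z2] := mr' A mA; split => // AQ.
  by rewrite rE// z1// z2// addr0.
- move=> Phi Phit Phix C1P; have [cP cPt cD] := C1_entries C1P.
  have := ce _ _ _ C1P; have := ce' _ _ _ C1P.
  rewrite /= GI// qI// rI//.
  move: (pairing _ _ mu.1.1) (pairing _ _ mu.1.2) (pairing _ _ mu.2)
    (pairing _ _ mu'.1.1) (pairing _ _ mu'.1.2) (pairing _ _ mu'.2) => x1 x2 x3 x4 x5 x6.
  move: (pairing _ _ H) (pairing _ _ H') (pairing _ _ H'') => x7 x8 x9.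
  by move=> h1 h2; lra.
Qed.

(* For [c < 0] time runs backwards; the sign carried by [q] and [r] restores the
   continuity equation. *)
Lemma CE_on_reparam (H H' : mOm) (mu : mCurve) a p c :
  CE_on L0 Lx Om 0 1 H H' mu -> action_le L1 L2 mu.1.1 mu.1.2 mu.2 a ->
  0 <= p <= 1 -> 0 <= p + c <= 1 -> c != 0 ->
  exists nu : mCurve, [/\ 0 < c -> CE_on L0 Lx Om p (p + c) H H' nu,
    c < 0 -> CE_on L0 Lx Om (p + c) p H' H nu,
    action_le L1 L2 nu.1.1 nu.1.2 nu.2 (a / `|c|) &
    mval nu.1.1 setT = `|c| *: mval mu.1.1 setT].
Proof.
move=> [mG mq mr ce] ha hp hpc c0.
have mS := reparam_measurable (d := d) p c.
have SQ x : Q x -> Q (reparam p c x) by exact: reparam_cylinder.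
have SA0 (A : set (borel E)) : A `&` Q = set0 -> (reparam p c @^-1` A) `&` Q = set0.
  move=> AQ; apply/seteqP; split=> // x [Ax Qx].
  have AQx : (A `&` Q) (reparam p c x) by split=> //; exact: SQ.
  by rewrite AQ in AQx.
have mSA (A : set (borel E)) : measurable A -> measurable (reparam p c @^-1` A : set (borel E)).
  by move=> mA; rewrite -[X in measurable X]setTI; exact: mS.
have [G [GE GI]] := mxmeasure_pushforward cQ `|c| mS SQ
  (fun i j => @measures_concentrated _ _ _ _ _ _ _ i j mG).
have [q [qE qI]] := mxmeasure_pushforward cQ (Num.sg c) mS SQ
  (fun i j => @measures_concentrated _ _ _ _ _ _ _ i j mq).
have [r [rE rI]] := mxmeasure_pushforward cQ (Num.sg c) mS SQ
  (fun i j => @measures_concentrated _ _ _ _ _ _ _ i j mr).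
have mG' : measures Q symm G.
  move=> A mA; have [s1 z1] := mG _ (mSA A mA); split.
    by rewrite /symm /= GE// linearZ/= s1.
  by move=> AQ; rewrite GE// z1 ?scaler0// SA0.
have mq' : measures Q setT q.
  move=> A mA; have [_ z1] := mq _ (mSA A mA); split => // AQ.
  by rewrite qE// z1 ?scaler0// SA0.
have mr' : measures Q setT r.
  move=> A mA; have [_ z1] := mr _ (mSA A mA); split => // AQ.
  by rewrite rE// z1 ?scaler0// SA0.
have key (Phi Phit : E -> 'M[R]_n) (Phix : 'I_d -> E -> 'M[R]_n) : C1 Q Phi Phit Phix ->
    pairing Q Phit G + pairing Q (Dstar L0 Lx Phi Phix) q + pairing Q Phi r =
    Num.sg c * (pairing Om (fun x => Phi (p + c, x)) H' - pairing Om (fun x => Phi (p, x)) H).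
  move=> C1P; have C1S := C1_reparam hp hpc c0 C1P.
  have [cP cPt cD] := C1_entries C1P; have [cP' cPt' cD'] := C1_entries C1S.
  have := ce _ _ _ C1S; rewrite {1 2}/comp /reparam /= mulr1 mulr0 addr0 => <-.
  rewrite GI// qI// rI//.
  have -> : pairing Q (fun z : E => c *: Phit (p + c * z.1, z.2)) mu.1.1 =
     c * pairing Q (Phit \o reparam p c) mu.1.1.
    apply: (pairingZ cQ) => i j.
    have := cPt' i j; under eq_fun do rewrite mxE.
    move=> /(fun h => (@withinZ _ _ Q _ c^-1 h)).
    by under eq_fun do rewrite mulKf//.
  by rewrite normrEsg; ring.
exists (G, q, r); split=> /=.
- move=> c_gt0; split=> //= Phi Phit Phix C1P.
  by rewrite key// gtr0_sg// mul1r.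
- move=> c_lt0; split=> //= Phi Phit Phix C1P.
  by rewrite key// ltr0_sg// mulN1r opprB.
- move=> F P N mF tF.
  have c1 : 0 < `|c| by rewrite normr_gt0.
  have sg2 : Num.sg c ^+ 2 = 1 by rewrite sqr_sg c0.
  under eq_bigr => i _ do rewrite GE// qE// rE// Jlin_rescale//.
  rewrite -mulr_sumr mulrC ler_wpM2r ?invr_ge0//.
  apply: (ha (fun i => reparam p c @^-1` F i) (fun i => dual_rescale `|c| (Num.sg c) (P i)) N).
    by move=> i; exact: mSA.
  by move=> i j _ _ [x [Fi Fj]]; apply: (tF i j) => //; exists (reparam p c x).
- by rewrite GE.
Qed.

Lemma action_le_limit (mu : nat -> mCurve) (nu : mCurve) a :
  (forall A : set (borel E), measurable A -> mxcvg (fun J => mval (mu J).1.1 A) (mval nu.1.1 A)) ->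
  (forall A : set (borel E), measurable A -> mxcvg (fun J => mval (mu J).1.2 A) (mval nu.1.2 A)) ->
  (forall A : set (borel E), measurable A -> mxcvg (fun J => mval (mu J).2 A) (mval nu.2 A)) ->
  (forall J, action_le L1 L2 (mu J).1.1 (mu J).1.2 (mu J).2 a) ->
  action_le L1 L2 nu.1.1 nu.1.2 nu.2 a.
Proof.
move=> hG hq hr ha F p N mF tF.
have h : \sum_(i < N) Jlin L1 L2 (p i) (mval (mu J).1.1 (F i)) (mval (mu J).1.2 (F i))
    (mval (mu J).2 (F i)) @[J --> \oo] -->
  \sum_(i < N) Jlin L1 L2 (p i) (mval nu.1.1 (F i)) (mval nu.1.2 (F i)) (mval nu.2 (F i)).
  apply: cvg_sum_ord => i; apply: cvgD; first apply: cvgD.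
  - by apply: cvg_frob; [exact: mxcvg_cst|exact: hG].
  - by apply: cvg_frob; [exact: mxcvg_cst|exact: hq].
  - by apply: cvg_frob; [exact: mxcvg_cst|exact: hr].
rewrite -(cvg_lim _ h)//; apply: limr_le; first by apply/cvg_ex; eexists; exact: h.
by apply: nearW => J; exact: ha.
Qed.

(** Both sides of the continuity equation converge for each test function, and a dual action bound
    involves finitely many values at a time, so it passes to the limit. *)
Lemma CE_on_limit (mu : nat -> mCurve) (t : nat -> R) (H : mOm) (H_ : nat -> mOm) H' C a :
  (forall J, CE_on L0 Lx Om 0 (t J) H (H_ J) (mu J)) ->
  (forall J, action_le L1 L2 (mu J).1.1 (mu J).1.2 (mu J).2 a) ->
  (forall J (A : set (borel E)), measurable A ->
     [/\ forall i j, `|mval (mu J.+1).1.1 A i j - mval (mu J).1.1 A i j| <= C * 2^-1 ^+ J,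
         forall i j, `|mval (mu J.+1).1.2 A i j - mval (mu J).1.2 A i j| <= C * 2^-1 ^+ J &
         forall i j, `|mval (mu J.+1).2 A i j - mval (mu J).2 A i j| <= C * 2^-1 ^+ J]) ->
  (forall Phi : E -> 'M[R]_n, {within Q, continuous Phi} ->
     pairing Om (fun x => Phi (t J, x)) (H_ J) @[J --> \oo] -->
     pairing Om (fun x => Phi (1, x)) H') ->
  exists nu : mCurve, CE_on L0 Lx Om 0 1 H H' nu /\ action_le L1 L2 nu.1.1 nu.1.2 nu.2 a.
Proof.
move=> ce ha hC hH.
have [G [GE GI]] := @mxmeasure_limit R E n n Q cQ (fun J => (mu J).1.1) C
  (fun J A i j mA => ltac:(by have [h _ _] := hC J A mA; exact: h)).
have [q [qE qI]] := @mxmeasure_limit R E n k Q cQ (fun J => (mu J).1.2) C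
  (fun J A i j mA => ltac:(by have [_ h _] := hC J A mA; exact: h)).
have [r [rE rI]] := @mxmeasure_limit R E n n Q cQ (fun J => (mu J).2) C
  (fun J A i j mA => ltac:(by have [_ _ h] := hC J A mA; exact: h)).
have lim0 (m l : nat) (u : nat -> mxmeasure E m l) (v : mxmeasure E m l) (A : set (borel E)) :
    (forall J, mval (u J) A = 0) -> mxcvg (fun J => mval (u J) A) (mval v A) -> mval v A = 0.
  move=> u0 h; apply/matrixP => i j; rewrite -(cvg_lim _ (h i j))// mxE.
  by under eq_fun do rewrite u0 mxE; exact: lim_cst.
exists (G, q, r); split; last exact: action_le_limit ha.
split=> /=.
- move=> A mA; split=> [|AQ].
    apply/matrixP => i j; rewrite mxE -(cvg_lim _ (GE A mA j i))// -(cvg_lim _ (GE A mA i j))//.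
    congr (limn _); apply/funext => J; have [mG _ _ _] := ce J.
    by have [/matrixP/(_ i j) + _] := mG A mA; rewrite mxE.
  apply: (lim0 _ _ _ _ _ _ (GE A mA)) => J; have [mG _ _ _] := ce J; have [_] := mG A mA; exact.
- move=> A mA; split=> // AQ.
  apply: (lim0 _ _ _ _ _ _ (qE A mA)) => J; have [_ mq _ _] := ce J; have [_] := mq A mA; exact.
- move=> A mA; split=> // AQ.
  apply: (lim0 _ _ _ _ _ _ (rE A mA)) => J; have [_ _ mr _] := ce J; have [_] := mr A mA; exact.
- move=> Phi Phit Phix C1P; have [cP cPt cD] := C1_entries C1P.
  have [_ cPhi _ _ _] := C1P.
  have lhs : pairing Q Phit (mu J).1.1 + pairing Q (Dstar L0 Lx Phi Phix) (mu J).1.2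
      + pairing Q Phi (mu J).2 @[J --> \oo] -->
      pairing Q Phit G + pairing Q (Dstar L0 Lx Phi Phix) q + pairing Q Phi r.
    by apply: cvgD; [apply: cvgD; [exact: GI|exact: qI]|exact: rI].
  have rhs : pairing Om (fun x => Phi (t J, x)) (H_ J) - pairing Om (fun x => Phi (0, x)) H
      @[J --> \oo] -->
      pairing Om (fun x => Phi (1, x)) H' - pairing Om (fun x => Phi (0, x)) H.
    by apply: cvgB; [exact: hH|exact: cvg_cst].
  rewrite -(cvg_lim _ lhs)// -(cvg_lim _ rhs)//; congr (limn _); apply/funext => J /=.
  by have [_ _ _ h] := ce J; exact: h C1P.
Qed.

End CurveOps.

(** * Product curves *)

Section UnitIntegral.
Context {R : realType}.
Let I01 : set R := `[0, 1]%classic.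
Let mI01 : measurable I01. Proof. exact: measurable_itv. Qed.

Lemma lebesgue_unit : lebesgue_measure I01 = 1%E.
Proof. by rewrite /I01 lebesgue_measure_itv/= lte_fin ltr01 -EFinD subr0. Qed.

Definition bounded_measurable (f : R -> R) :=
  measurable_fun I01 f /\ exists M, forall t, I01 t -> `|f t| <= M.

Definition unit_integral (f : R -> R) : R := \int[lebesgue_measure]_(t in I01) f t.

Lemma bmD f g : bounded_measurable f -> bounded_measurable g ->
  bounded_measurable (fun t => f t + g t).
Proof.
move=> [mf [M fM]] [mg [M' gM']]; split; first exact: measurable_funD.
exists (M + M') => t It; apply: le_trans (ler_normD _ _) _.
by rewrite lerD ?fM ?gM'.
Qed.

Lemma bmM f g : bounded_measurable f -> bounded_measurable g ->
  bounded_measurable (fun t => f t * g t).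
Proof.
move=> [mf [M fM]] [mg [M' gM']]; split; first exact: measurable_funM.
by exists (M * M') => t It; rewrite normrM ler_pM ?fM ?gM'.
Qed.

Lemma bm_cst a : bounded_measurable (fun=> a).
Proof. by split; [exact: measurable_cst|exists `|a|]. Qed.

Lemma bm_sum (J : Type) (s : seq J) (f : J -> R -> R) :
  (forall j, bounded_measurable (f j)) -> bounded_measurable (fun t => \sum_(j <- s) f j t).
Proof.
move=> h; elim: s => [|j s IH].
  by under eq_fun do rewrite big_nil; exact: bm_cst.
by under eq_fun do rewrite big_cons; exact: bmD.
Qed.

Lemma bm_integrable f : bounded_measurable f ->
  (@lebesgue_measure R).-integrable I01 (EFin \o f).
Proof.
move=> [mf [M fM]]; apply: measurable_bounded_integrable => //.
  by rewrite [X in (X < _)%E]lebesgue_unit ltry.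
exists M; split; first by rewrite num_real.
by move=> x Mx t It; apply: le_trans (ltW Mx); exact: fM.
Qed.

Lemma unit_integralD f g : bounded_measurable f -> bounded_measurable g ->
  unit_integral (fun t => f t + g t) = unit_integral f + unit_integral g.
Proof. by move=> /bm_integrable bf /bm_integrable bg; exact: RintegralD. Qed.

Lemma unit_integralZ a f : bounded_measurable f ->
  unit_integral (fun t => a * f t) = a * unit_integral f.
Proof. by move=> /bm_integrable bf; exact: RintegralZl. Qed.

Lemma unit_integral_cst a : unit_integral (fun=> a) = a.
Proof.
by rewrite /unit_integral Rintegral_cst// [X in fine X]lebesgue_unit mulr1.
Qed.

Lemma unit_integral_sum (J : Type) (s : seq J) (f : J -> R -> R) :
  (forall j, bounded_measurable (f j)) ->
  unit_integral (fun t => \sum_(j <- s) f j t) = \sum_(j <- s) unit_integral (f j).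
Proof.
move=> h; elim: s => [|j s IH].
  by under eq_fun do rewrite big_nil; rewrite big_nil unit_integral_cst.
under eq_fun do rewrite big_cons; rewrite big_cons unit_integralD ?IH//.
exact: bm_sum.
Qed.

Lemma le_unit_integral f g : bounded_measurable f -> bounded_measurable g ->
  (forall t, I01 t -> f t <= g t) -> unit_integral f <= unit_integral g.
Proof. by move=> /bm_integrable bf /bm_integrable bg h; apply: le_Rintegral. Qed.

Lemma eq_unit_integral f g : (forall t, I01 t -> f t = g t) -> unit_integral f = unit_integral g.
Proof. by move=> h; apply: eq_Rintegral => t; rewrite inE; exact: h. Qed.

Lemma unit_integral_norm_le f M : bounded_measurable f -> (forall t, I01 t -> `|f t| <= M) ->
  `|unit_integral f| <= M.
Proof.
move=> bf fM; rewrite ler_norml; apply/andP; split.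
  rewrite -[- M]unit_integral_cst; apply: le_unit_integral => //; first exact: bm_cst.
  by move=> t /fM; rewrite ler_norml => /andP[].
rewrite -[M]unit_integral_cst; apply: le_unit_integral => //; first exact: bm_cst.
by move=> t /fM; rewrite ler_norml => /andP[].
Qed.

Lemma bm_continuous f : {within I01, continuous f} -> bounded_measurable f.
Proof.
move=> cf; split.
  exact: subspace_continuous_measurable_fun.
have := @within_compact_bounded R R^o I01 f (@segment_compact _ 0 1) cf.
by move=> [M [_ h]]; exists M.
Qed.

Lemma unit_integral_dct (f_ : nat -> R -> R) (f : R -> R) M :
  (forall N, measurable_fun I01 (f_ N)) -> measurable_fun I01 f ->
  (forall N t, I01 t -> `|f_ N t| <= M) ->
  (forall t, I01 t -> f_ N t @[N --> \oo] --> f t) ->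
  unit_integral (f_ N) @[N --> \oo] --> unit_integral f.
Proof.
move=> mf_ mf fM cf.
have fM' t : I01 t -> `|f t| <= M.
  move=> It; rewrite -(cvg_lim _ (cvg_norm (cf t It)))//; apply: limr_le.
    by apply/cvg_ex; eexists; exact: cvg_norm (cf t It).
  by apply: nearW => N; exact: fM.
have iM : (@lebesgue_measure R).-integrable I01 (fun=> M%:E).
  exact: (bm_integrable (bm_cst M)).
have mE (g : R -> R) : measurable_fun I01 g -> measurable_fun I01 (fun t => (g t)%:E).
  by move=> mg; exact/measurable_EFinP.
have ae1 : {ae lebesgue_measure, forall t, I01 t -> (f_ N t)%:E @[N --> \oo] --> (f t)%:E}.
  by apply: aeW => t It; apply: cvg_EFin; [exact: nearW|exact: cf].
have ae2 : {ae lebesgue_measure, forall t (N : nat), I01 t -> (`|(f_ N t)%:E| <= M%:E)%E}.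
  by apply: aeW => t N It /=; rewrite lee_fin; exact: fM.
have [_ _ h] := @dominated_convergence _ _ R lebesgue_measure I01 mI01
  (fun N t => (f_ N t)%:E) (fun t => (f t)%:E) (fun=> M%:E) (fun N => mE _ (mf_ N)) (mE _ mf)
  ae1 iM ae2.
have fin : (\int[lebesgue_measure]_(t in I01) (f t)%:E)%E \is a fin_num.
  by apply: integrable_fin_num => //; apply: bm_integrable; split=> //; exists M.
rewrite /unit_integral /Rintegral; apply: fine_cvg; rewrite fineK//.
Qed.

End UnitIntegral.

(** * Sections of Borel sets and product charges *)

Section ProductMeasurability.
Context {R : realType} {d : nat}.
Let V := 'rV[R]_d.
Let E := (R * V)%type.

Lemma rV_rat_dense (x : V) (e : R) : 0 < e -> exists q : 'rV[rat]_d, `|x - map_mx ratr q| < e.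
Proof.
move=> e0; have h j : exists q : rat, `|x 0 j - ratr q| < e.
  have : x 0 j < x 0 j + e by rewrite ltrDl.
  move=> /rat_in_itvoo[q]; rewrite in_itv/= => /andP[h1 h2]; exists q.
  by rewrite distrC gtr0_norm ?subr_gt0// ltrBlDl.
have [q hq] := choice h; exists (\row_j q j).
rewrite /Num.norm/= mx_normrE; apply/bigmax_ltP; split=> // -[i j] _ /=.
by rewrite !mxE ord1.
Qed.

(** Sections are measurable for the product sigma-algebra, while curves live on the Borel sets of
    the product space. An open set is a countable union of boxes with rational centers and radii 1 /
    (N + 1). *)
Lemma borel_prod (A : set E) : measurable (A : set (borel E)) ->
  measurable (A : set (R * borel V)).
Proof.
move: A; apply: smallest_sub.
  by split; [exact: measurable0|move=> B; exact: measurableD|move=> F; exact: bigcupT_measurable].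
move=> U oU.
pose box (a : rat * 'rV[rat]_d * nat) : set E :=
  ball (ratr a.1.1 : R) (a.2.+1%:R^-1) `*` ball (map_mx ratr a.1.2 : V) (a.2.+1%:R^-1).
pose S (m : nat) : set E := if unpickle m is Some a then
  (if `[< box a `<=` U >] then box a else set0) else set0.
have SE a : box a `<=` U -> S (pickle a) = box a.
  by move=> aU; rewrite /S pickleK; case: asboolP.
have -> : U = \bigcup_m S m.
  apply/seteqP; split=> [z Uz|z [m _]]; last first.
    by rewrite /S; case: unpickle => [a|//]; case: asboolP => [sub /sub|_].
  have /nbhs_ballP[e /= e0 eU] := open_nbhs_nbhs (conj oU Uz).
  have [N hN] : exists N : nat, N.+1%:R^-1 < e / 2.
    have e2 : 0 < e / 2 by rewrite divr_gt0.
    by have [N _ /(_ N (leqnn N))] := near_infty_natSinv_lt (PosNum e2); exists N.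
  have N0 : 0 < N.+1%:R^-1 :> R by rewrite invr_gt0 ltr0n.
  have [q hq] := rV_rat_dense z.2 N0.
  have [p hp] : exists p : rat, `|z.1 - ratr p| < N.+1%:R^-1.
    have : z.1 < z.1 + N.+1%:R^-1 by rewrite ltrDl.
    move=> /rat_in_itvoo[p]; rewrite in_itv/= => /andP[h1 h2]; exists p.
    by rewrite distrC gtr0_norm ?subr_gt0// ltrBlDl.
  have boxU : box (p, q, N) `<=` U.
    move=> y [/=]; rewrite -!ball_normE /= => h1 h2; apply: eU; split; rewrite -ball_normE/=.
      apply: le_lt_trans (ler_distD (ratr p) _ _) _.
      by rewrite [ltRHS](splitr e) ltrD// (lt_trans _ hN).
    apply: le_lt_trans (ler_distD (map_mx ratr q) _ _) _.
    by rewrite [ltRHS](splitr e) ltrD// (lt_trans _ hN).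
  exists (pickle (p, q, N)); [exact: I|rewrite SE//].
  by split; rewrite /= -ball_normE/= distrC.
apply: bigcup_measurable => m _; rewrite /S; case: unpickle => [a|]; last exact: measurable0.
case: asboolP => _; last exact: measurable0.
apply: measurableX.
  by apply: open_measurable; exact: ball_open.
by apply: borel_open; exact: ball_open.
Qed.

Definition section (A : set E) (t : R) : set (borel V) := [set x | A (t, x)].

Lemma section_measurable (A : set E) t : measurable (A : set (borel E)) -> measurable (section A t).
Proof.
move=> mA; have := @measurable_xsection _ _ R (borel V) A t (borel_prod mA).
by congr measurable; apply/seteqP; split=> x; rewrite /xsection /section /= inE.
Qed.

Lemma section_charge_bm (nu : {charge set (borel V) -> \bar R}) (A : set E) :
  measurable (A : set (borel E)) -> bounded_measurable (fun t => fine (nu (section A t))).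
Proof.
move=> mA; have mP := borel_prod mA.
have msec t : section A t = xsection A t.
  by apply/seteqP; split=> x; rewrite /xsection /section /= inE.
split; last first.
  exists (tv nu setT) => t _; apply: le_trans (normr_charge_le_tv _ _) _.
    exact: section_measurable.
  by apply: le_tv => //; exact: section_measurable.
have -> : (fun t => fine (nu (section A t))) = fun t =>
    fine (jordan_pos (hahn nu) (xsection A t)) - fine (jordan_neg (hahn nu) (xsection A t)).
  by apply/funext => t; rewrite -msec; apply: fine_jordan; exact: section_measurable.
apply: measurable_funTS; apply: measurable_funB.
  apply: (@measurableT_comp _ _ _ _ _ _ fine) => //.
  exact: (measurable_fun_xsection (jordan_pos (hahn nu)) mP).
apply: (@measurableT_comp _ _ _ _ _ _ fine) => //.
exact: (measurable_fun_xsection (jordan_neg (hahn nu)) mP).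
Qed.

End ProductMeasurability.

Section ProductCharge.
Context {R : realType} {d : nat}.
Let V := 'rV[R]_d.
Let E := (R * V)%type.
Variable Om : set V.
Hypothesis cOm : compact Om.
Let Q : set E := cylinder Om.
Let cQ : compact Q := compact_cylinder cOm.
Let mQ : measurable (Q : set (borel E)) := borel_compact cQ.
Let mO : measurable (Om : set (borel V)) := borel_compact cOm.
Let I01 : set R := `[0, 1]%classic.

(** The product w(t) dt (x) nu, given by integrating sections. Countable additivity is dominated
    convergence, with the bound of [w] times the variation of [nu] as dominating constant. *)
Lemma product_charge (w : R -> R) (nu : {charge set (borel V) -> \bar R}) :
  bounded_measurable w -> exists eta : {charge set (borel E) -> \bar R},
  forall A : set (borel E), measurable A ->
    fine (eta A) = unit_integral (fun t => w t * fine (nu (section A t))).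
Proof.
move=> bw; pose phi (A : set (borel E)) := unit_integral (fun t => w t * fine (nu (section A t))).
have phi0 : phi set0 = 0.
  rewrite /phi -[RHS](unit_integral_cst 0); apply: eq_unit_integral => t _.
  by rewrite [section _ _](_ : _ = set0) ?charge0 ?mulr0//; apply/seteqP; split.
have phis : sigma_additive_fun phi.
  move=> F mF tF; have [mw [M wM]] := bw.
  have bF i := section_charge_bm nu (mF i).
  have secU t N : \big[setU/set0]_(i < N) section (F i) t = section (\big[setU/set0]_(i < N) F i) t.
    rewrite -(bigcup_mkord N (fun i => section (F i) t)) -(bigcup_mkord N F).
    by apply/seteqP; split=> x; rewrite /section/= => -[i iN Fi]; exists i.
  have tsec t : trivIset setT (fun i => section (F i) t).
    by move=> i j _ _ [x [Fi Fj]]; apply: (tF i j) => //; exists (t, x).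
  have msec t i : measurable (section (F i) t) by exact: section_measurable.
  have -> : (fun N => \sum_(i < N) phi (F i)) = fun N => unit_integral
      (fun t => w t * \sum_(i < N) fine (nu (section (F i) t))).
    apply/funext => N; rewrite -unit_integral_sum => [|i]; last exact: bmM.
    by apply: eq_unit_integral => t _; rewrite mulr_sumr.
  have bS N : bounded_measurable (fun t => w t * \sum_(i < N) fine (nu (section (F i) t))).
    by apply: bmM => //; exact: bm_sum.
  have mU : measurable (\bigcup_i F i) by exact: bigcupT_measurable.
  have bU : bounded_measurable (fun t => w t * fine (nu (section (\bigcup_i F i) t))).
    by apply: bmM => //; exact: section_charge_bm.
  apply: (@unit_integral_dct _ _ _ (M * tv nu setT)).
  - by move=> N; have [] := bS N.
  - by have [] := bU.
  - move=> N t It; rewrite normrM ler_pM ?wM//.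
    rewrite -(fine_charge_bigsetU nu N (msec t) (tsec t)).
    apply: le_trans (normr_charge_le_tv _ _) _.
      by apply: bigsetU_measurable => i _.
    by apply: le_tv => //; apply: bigsetU_measurable => i _.
  - move=> t It; apply: cvgM; first exact: cvg_cst.
    have -> : section (\bigcup_i F i) t = \bigcup_i section (F i) t.
      by apply/seteqP; split=> x; rewrite /section/= => -[i iN Fi]; exists i.
    exact: (charge_sigma_additive_fun (nu := nu)).
have [eta etaE] := charge_of_funP phi0 phis.
by exists eta => A mA; rewrite etaE.
Qed.

Lemma within_slice (U : normedModType R) (f : E -> U) t : I01 t -> {within Q, continuous f} ->
  {within Om, continuous (fun x => f (t, x))}.
Proof.
move=> It /within_continuous_normP h; apply/within_continuous_normP => x Ox e e0.
have [r r0 hr] := h (t, x) (conj It Ox) e e0; exists r => // y Oy xy.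
apply: hr; first by split.
by rewrite prod_normE /= subrr normr0 gt_max r0.
Qed.

Lemma slice_integral_continuous (nu : {charge set (borel V) -> \bar R}) (f : E -> R) :
  {within Q, continuous f} ->
  {within I01, continuous (fun t => charge_integral nu Om (fun x => f (t, x)))}.
Proof.
move=> cf; apply/(@within_continuous_normP R R^o R^o) => t It e e0.
have T0 : 0 < tv nu Om + 1 by rewrite ltr_wpDl// tv_ge0.
have [r r0 hr] := uniform_continuous_compact cQ cf (divr_gt0 e0 T0).
exists r => // s Is ts.
have wt := within_slice It cf; have ws := within_slice Is cf.
have wN := withinN ws.
have [_ [M1 fM1]] := @within_bounded_measurable R V Om cOm _ wt.
have [m2 [M2 fM2]] := @within_bounded_measurable R V Om cOm _ wN.
have [m3 [M3 fM3]] := @within_bounded_measurable R V Om cOm _ ws.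
have mt := within_measurable mO wt.
have -> : charge_integral nu Om (fun x => f (s, x)) = - charge_integral nu Om (fun x => - f (s, x)).
  have := charge_integralZ nu (-1) mO m3 fM3.
  rewrite mulN1r (_ : (fun x : V => -1 * f (s, x)) = fun x => - f (s, x)).
    by move=> ->; rewrite opprK.
  by apply/funext => x; rewrite mulN1r.
rewrite opprK -(charge_integralD nu mO mt m2 fM1 fM2).
have hb x : Om x -> `|f (t, x) + - f (s, x)| <= e / (tv nu Om + 1).
  move=> Ox; apply: ltW; apply: hr => //.
  by rewrite prod_normE /= subrr normr0 gt_max r0 andbT.
have mD := measurable_funD mt m2.
apply: le_lt_trans (normr_charge_integral nu mO mD hb) _.
by rewrite mulrAC ltr_pdivrMr// ltr_pM2l// ltrDl.
Qed.

(** Fubini's formula: a step approximation of [f] on the cylinder restricts to one on each slice,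
    with the same error. *)
Lemma product_charge_integral (w : R -> R) (nu : {charge set (borel V) -> \bar R})
    (eta : {charge set (borel E) -> \bar R}) (f : E -> R) :
  bounded_measurable w -> (forall A : set (borel E), measurable A ->
    fine (eta A) = unit_integral (fun t => w t * fine (nu (section A t)))) ->
  {within Q, continuous f} ->
  charge_integral eta Q f =
  unit_integral (fun t => w t * charge_integral nu Om (fun x => f (t, x))).
Proof.
move=> bw etaE cf; have [_ [Mw hMw]] := bw.
have [mf [M fM]] := within_bounded_measurable cQ cf.
have bh := bm_continuous (@slice_integral_continuous nu f cf).
apply: (@eq_small_dist _ _ _ (tv eta Q + `|Mw| * tv nu Om)) => e e0.
have [N [F [c sf]]] := stepping_exists mQ mf fM e0.
have [mF tF UF _ fF] := sf.
have h1 := charge_integral_stepping eta sf.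
have bS : bounded_measurable (fun t => \sum_(i < N) c i * fine (nu (section (F i) t))).
  by apply: bm_sum => i; apply: bmM; [exact: bm_cst|exact: section_charge_bm].
have sumE : \sum_(i < N) c i * fine (eta (F i)) =
    unit_integral (fun t => w t * \sum_(i < N) c i * fine (nu (section (F i) t))).
  under eq_bigr => i _ do rewrite etaE//.
  transitivity (\sum_(i < N) unit_integral (fun t => w t * (c i * fine (nu (section (F i) t))))).
    apply: eq_bigr => i _; rewrite -unit_integralZ.
      by apply: eq_unit_integral => t _; rewrite mulrCA.
    by apply: bmM => //; exact: section_charge_bm.
  rewrite -unit_integral_sum => [|i]; last first.
    by apply: bmM => //; apply: bmM; [exact: bm_cst|exact: section_charge_bm].
  by apply: eq_unit_integral => t _; rewrite mulr_sumr.
rewrite sumE in h1.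
rewrite mulrDr; apply: le_trans (ler_distD _ _ _) (lerD h1 _).
set g := (fun t => w t * _); set g' := (fun t => w t * _).
have bg : bounded_measurable g by exact: bmM.
have bg' : bounded_measurable (fun t => -1 * g' t) by apply: bmM; [exact: bm_cst|exact: bmM].
have -> : unit_integral g - unit_integral g' = unit_integral (fun t => g t + -1 * g' t).
  by rewrite unit_integralD// unit_integralZ ?mulN1r//; exact: bmM.
apply: unit_integral_norm_le; first exact: bmD.
move=> t It; rewrite mulN1r /g /g' -mulrBr normrM mulrCA.
apply: ler_pM => //; first exact: le_trans (hMw t It) (ler_norm _).
rewrite distrC; apply: (@charge_integral_stepping _ _ _ nu Om (fun x => f (t, x)) e N
  (fun i => section (F i) t) c); split.
- by move=> i; exact: section_measurable.
- by move=> i j _ _ [x [Fi Fj]]; apply: (tF i j) => //; exists (t, x).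
- rewrite -(bigcup_mkord N (fun i => section (F i) t)); apply/seteqP; split=> [x [i iN Fi]|x Ox].
    have : Q (t, x) by rewrite -UF -(bigcup_mkord N F); exists i.
    by case.
  have : Q (t, x) by split.
  by rewrite -UF -(bigcup_mkord N F) => -[i iN Fi]; exists i.
- exact: within_measurable (within_slice It cf).
- by move=> i x iN Fx; exact: fF.
Qed.

End ProductCharge.

Section UnitFTC.
Context {R : realType}.

Lemma unit_integral_ftc (F f : R -> R) : {within `[0, 1], continuous F} ->
  {within `[0, 1], continuous f} -> (forall t : R, 0 < t < 1 -> is_derive t 1 F (f t)) ->
  unit_integral f = F 1 - F 0.
Proof.
move=> cF cf dF; rewrite /unit_integral /Rintegral (@continuous_FTC2 _ f F 0 1)//.
- have /(continuous_within_itvP F ltr01)[_ F0 F1] := cF; split=> // t.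
  by rewrite in_itv/= => t01; have [] := dF t t01.
- by move=> t; rewrite in_itv/= => t01; rewrite derive1E; exact: (@derive_val _ _ _ _ _ _ _ (dF t t01)).
Qed.

Lemma increment_le (u f : R -> R) (s t a e : R) :
  s < t -> (forall c : R, s <= c <= t -> is_derive c 1 u (f c)) ->
  (forall c : R, s <= c <= t -> `|f c - a| <= e) ->
  `|u t - u s - (t - s) * a| <= e * (t - s).
Proof.
move=> st du fa.
have cu : {within `[s, t], continuous u}.
  apply: derivable_within_continuous => c; rewrite in_itv/= => hc.
  by have [] := du c hc.
have [c|c] := @MVT R u f s t st _ cu.
  by rewrite in_itv/= => /andP[sc ct]; apply: du; rewrite !ltW.
rewrite in_itv/= => /andP[sc ct] ->.
rewrite mulrC -mulrBr normrM ger0_norm ?subr_ge0 ?(ltW st)// mulrC.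
by rewrite ler_wpM2r ?subr_ge0 ?(ltW st)// fa// !ltW.
Qed.

End UnitFTC.

Lemma opp_sg_mul (R : realType) (a t : R) : - Num.sg a * t * a = - (t * `|a|).
Proof. by rewrite normrEsg; ring. Qed.

Section Boundary.
Context {R : realType} {d : nat}.

(** At a boundary point the local defining function vanishes and has a nonzero partial derivative; a
    short move along that axis, against the sign of the derivative, makes it negative. *)
Lemma smooth_boundary_dense (Om : set 'rV[R]_d) : closed Om -> smooth_boundary Om ->
  forall x, Om x -> forall e, 0 < e -> exists2 y, Om° y & `|x - y| < e.
Proof.
move=> clOm sOm x Ox e e0.
have [ix|nix] := pselect (Om° x); first by exists x; rewrite ?subrr ?normr0.
have [|U [g [oU Ux sg [i ai] OU]]] := sOm x; first by split=> //; exact: subset_closure.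
have cg y : U y -> {for y, continuous g} by move=> Uy; have [] := sg [::] y Uy.
have inner y : U y -> g y < 0 -> Om° y.
  move=> Uy gy; have : \forall z \near y, U z /\ g z < 0.
    apply: filterI; first exact: open_nbhs_nbhs.
    by apply: (cvgr_lt _ (cg y Uy)).
  apply: filterS => z [Uz gz]; have : (Om `&` U) z by rewrite OU /=; split=> //; exact: ltW.
  by case.
(* Were [g x] negative, [x] would be an interior point. *)
have gx : g x = 0.
  apply/eqP; rewrite eq_le; apply/andP; split.
    by have : (Om `&` U) x by []; rewrite OU => -[].
  by rewrite leNgt; apply/negP => /(inner x Ux).
have [_ /(_ i) dg] := sg [::] x Ux.
have [a {}ai /is_derive_normP dg'] : exists2 a : R, a != 0 & is_derive x (ebase i) g a.
  by exists ('D_(ebase i) g x) => //; exact: (DeriveDef dg).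
have a0 : 0 < `|a| by rewrite normr_gt0.
have [r r0 hr] := dg' _ (divr_gt0 a0 (ltr0n _ 2)).
have /nbhs_ballP[rho /= rho0 rhoU] := open_nbhs_nbhs (conj oU Ux).
pose v : 'rV[R]_d := ebase i.
have v1 : 0 < `|v| + 1 by rewrite ltr_wpDl.
pose m := Num.min r (Num.min rho e).
have m0 : 0 < m by rewrite !lt_min r0 rho0.
(* Makes both the parameter [tau] and the displacement [tau * |v|] smaller than [m]. *)
pose tau := m / 2 / (`|v| + 1).
have tau0 : 0 < tau by rewrite !divr_gt0.
have tauv : tau * `|v| < m.
  apply: (@le_lt_trans _ _ (m / 2)); last by rewrite ltr_pdivrMr// mulr_natr mulr2n ltrDl.
  rewrite /tau mulrAC ler_pdivrMr// ler_wpM2l ?lerDl// divr_ge0// ltW//.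
have taur : tau < m.
  apply: (@le_lt_trans _ _ (m / 2)); last by rewrite ltr_pdivrMr// mulr_natr mulr2n ltrDl.
  rewrite /tau ler_pdivrMr// ler_peMr ?divr_ge0 ?(ltW m0)//; last by rewrite lerDr.
(* The linear part is then - tau |a|, while the error is at most half of it in absolute value. *)
pose h := - Num.sg a * tau.
have nh : `|h| = tau by rewrite normrM normrN normr_sg ai mul1r gtr0_norm.
have h0 : h != 0 by rewrite -normr_gt0 nh.
have xy : `|x - (h *: v + x)| < m.
  by rewrite opprD addrCA subrr addr0 normrN normrZ nh.
exists (h *: v + x); last by apply: lt_le_trans xy _; rewrite /m !ge_min lexx !orbT.
apply: inner.
  apply: rhoU; rewrite -ball_normE /=; apply: lt_le_trans xy _.
  by rewrite /m !ge_min lexx orbT.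
have := hr h h0; rewrite nh => /(_ _)/ler_normlP[|_].
  by apply: lt_le_trans taur _; rewrite /m ge_min lexx.
have -> : h *: a = - (tau * `|a|).
  transitivity (- Num.sg a * tau * a); first by [].
  exact: opp_sg_mul.
rewrite gx subr0 opprK => H.
have : 0 < tau * `|a| by exact: mulr_gt0.
rewrite -/v; move: H; move: (g _) (`|a|) => y b H; nra.
Qed.

End Boundary.

Section TimeDerivative.
Context {R : realType} {n d : nat}.
Variable Om : set 'rV[R]_d.
Hypotheses (cOm : compact Om) (sOm : smooth_boundary Om).
Let V := 'rV[R]_d.
Let E := (R * V)%type.
Let Q : set E := cylinder Om.
Let cQ : compact Q := compact_cylinder cOm.

Lemma mx_entry_le_norm m l (A : 'M[R]_(m, l)) i j : `|A i j| <= `|A|.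
Proof. by rewrite [leRHS]mx_normrE; exact: (le_bigmax _ (fun ij => `|A ij.1 ij.2|) (i, j)). Qed.

Lemma cylinder_interior (t : R) x : 0 < t < 1 -> Om° x -> Q° (t, x).
Proof.
move=> /andP[t0 t1] /nbhs_ballP[r /= r0 rO].
have m0 : 0 < Num.min r (Num.min t (1 - t)) by rewrite !lt_min r0 t0 subr_gt0.
apply/nbhs_ballP; exists (Num.min r (Num.min t (1 - t))) => //.
move=> y [/=]; rewrite -!ball_normE /= => h1 h2; split; last first.
  by apply: rO; rewrite -ball_normE/=; apply: lt_le_trans h2 _; rewrite ge_min lexx.
move: h1; rewrite !lt_min => /and3P[_]; rewrite /= in_itv/= !ltr_norml.
by move=> /andP[? ?] /andP[? ?]; apply/andP; split; lra.
Qed.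

(* [C1] says nothing about derivatives on the boundary: the estimate holds over the
   interior of [Om] by the mean value theorem and extends by density. *)
Lemma time_increment (Phi Phit : E -> 'M[R]_n) (Phix : 'I_d -> E -> 'M[R]_n) i j e :
  C1 Q Phi Phit Phix -> 0 < e ->
  exists2 r, 0 < r & forall (s t : R) x, 0 < s < 1 -> 0 < t < 1 -> `|t - s| < r -> Om x ->
    `|Phi (t, x) i j - Phi (s, x) i j - (t - s) * Phit (s, x) i j| <= e * `|t - s|.
Proof.
move=> [_ cP cPt _ dP] e0.
have wP := @within_entry _ _ _ _ _ _ i j cP; have wPt := @within_entry _ _ _ _ _ _ i j cPt.
have [r r0 hr] := uniform_continuous_compact cQ wPt e0.
exists r => // s t x s01 t01 ts Ox.
have clOm : closed Om by apply: compact_closed => //; exact: norm_hausdorff.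
have Qin (u : R) y : 0 < u < 1 -> Om y -> Q (u, y).
  by move=> /andP[u0 u1] Oy; split=> //=; rewrite in_itv/= !ltW.
have inner y : Om° y ->
    `|Phi (t, y) i j - Phi (s, y) i j - (t - s) * Phit (s, y) i j| <= e * `|t - s|.
  move=> Oy; have Oy' := interior_subset Oy.
  have du (c : R) : 0 < c < 1 -> is_derive c 1 (fun c => Phi (c, y) i j) (Phit (c, y) i j).
    move=> c01; have [dt _] := dP _ (cylinder_interior c01 Oy).
    move: dt => /is_derive_normP dt; apply/is_derive_normP => eps eps0.
    have [rr rr0 hrr] := dt _ eps0; exists rr => // h h0 hh.
    have := hrr h h0 hh; have -> : h *: ((1, 0) : E) + (c, y) = (h *: 1 + c, y).
      by apply/pair_equal_spec; split; rewrite /= ?scaler0 ?add0r.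
    by apply: le_trans; apply: le_trans (mx_entry_le_norm _ i j); rewrite !mxE.
  have fa (a b c : R) : 0 < a < 1 -> 0 < b < 1 -> `|b - a| < r -> a <= c <= b \/ b <= c <= a ->
      0 < c < 1 /\ `|Phit (c, y) i j - Phit (a, y) i j| <= e.
    move=> /andP[a0 a1] /andP[b0 b1] ba hc.
    have c01 : 0 < c < 1 by case: hc => /andP[? ?]; apply/andP; split; lra.
    split=> //; apply: ltW; apply: hr; [exact: Qin|by apply: Qin => //; rewrite a0|].
    rewrite prod_normE /= subrr normr0 gt_max r0 andbT.
    apply: le_lt_trans ba; case: hc => /andP[h1 h2].
      by rewrite !ger0_norm ?subr_ge0//; lra.
    by rewrite !ler0_norm ?subr_le0//; lra.
  have [st|ts'|<-] := ltgtP s t; last by rewrite !subrr normr0 mul0r mulr0 subrr normr0.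
    rewrite (ger0_norm (x := t - s)) ?subr_ge0 ?(ltW st)//.
    apply: (increment_le (u := fun c => Phi (c, y) i j) (f := fun c => Phit (c, y) i j)) => //.
      by move=> c hc; apply: du; have [] := fa s t c s01 t01 ts (or_introl hc).
    by move=> c hc; have [] := fa s t c s01 t01 ts (or_introl hc).
  rewrite [X in _ <= _ * X]distrC (ger0_norm (x := s - t)) ?subr_ge0 ?(ltW ts')//.
  have := @increment_le R (fun c => Phi (c, y) i j) (fun c => Phit (c, y) i j) t s
    (Phit (s, y) i j) e ts'.
  move=> h.
  have -> : Phi (t, y) i j - Phi (s, y) i j - (t - s) * Phit (s, y) i j =
    - (Phi (s, y) i j - Phi (t, y) i j - (s - t) * Phit (s, y) i j) by ring.
  rewrite normrN.
  apply: h => c hc; first by apply: du; have [] := fa s t c s01 t01 ts (or_intror hc).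
  by have [] := fa s t c s01 t01 ts (or_intror hc).
apply/ler_addgt0Pr => eps eps0.
have eps3 : 0 < eps / 3 by rewrite divr_gt0.
have [r1 r10 h1] := uniform_continuous_compact cQ wP eps3.
have [r2 r20 h2] := uniform_continuous_compact cQ wPt eps3.
have m0 : 0 < Num.min r1 r2 by rewrite lt_min r10.
have [y Oy xy] := smooth_boundary_dense clOm sOm Ox m0.
have Oy' := interior_subset Oy.
have pn (u : R) : `|(u, x) - (u, y) : E| = `|x - y|.
  by rewrite prod_normE /= subrr normr0; apply/max_idPr.
have d1 (u : R) : 0 < u < 1 -> `|Phi (u, x) i j - Phi (u, y) i j| < eps / 3.
  move=> u01; apply: h1; [exact: Qin|exact: Qin|rewrite pn].
  by apply: lt_le_trans xy _; rewrite ge_min lexx.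
have d2 : `|Phit (s, x) i j - Phit (s, y) i j| < eps / 3.
  apply: h2; [exact: Qin|exact: Qin|rewrite pn].
  by apply: lt_le_trans xy _; rewrite ge_min lexx orbT.
have ts1 : `|t - s| <= 1.
  by move: s01 t01 => /andP[? ?] /andP[? ?]; rewrite ler_norml; apply/andP; split; lra.
have := inner y Oy; have := d1 _ s01; have := d1 _ t01.
have : `|(t - s) * (Phit (s, x) i j - Phit (s, y) i j)| <= eps / 3.
  by rewrite normrM -[leRHS]mul1r ler_pM// ltW.
move: (e * `|t - s|) d2; rewrite mulrBr.
move: (Phi (t, x) i j) (Phi (t, y) i j) (Phi (s, x) i j) (Phi (s, y) i j) => x1 x2 x3 x4.
move: ((t - s) * Phit (s, x) i j) ((t - s) * Phit (s, y) i j) => x5 x6 b _.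
rewrite !ltr_norml !ler_norml => /andP[? ?] /andP[? ?] /andP[? ?] /andP[? ?].
by apply/andP; split; lra.
Qed.

End TimeDerivative.

Section ProductCurve.
Context {R : realType} {n k d : nat}.
Variables (L0 : {linear 'M[R]_n -> 'M[R]_(n, k)})
          (Lx : 'I_d -> {linear 'M[R]_n -> 'M[R]_(n, k)}).
Variables (L1 : 'M[R]_k) (L2 : 'M[R]_n) (Om : set 'rV[R]_d).
Hypotheses (cOm : compact Om) (sOm : smooth_boundary Om).
Let V := 'rV[R]_d.
Let E := (R * V)%type.
Let Q : set E := cylinder Om.
Let cQ : compact Q := compact_cylinder cOm.
Let mO : measurable (Om : set (borel V)) := borel_compact cOm.
Let mCurve := (mxmeasure E n n * mxmeasure E n k * mxmeasure E n n)%type.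
Implicit Types nu : {charge set (borel V) -> \bar R}.

Lemma charge_integral_withinD nu (f g : V -> R) : {within Om, continuous f} ->
  {within Om, continuous g} ->
  charge_integral nu Om (fun x => f x + g x) = charge_integral nu Om f + charge_integral nu Om g.
Proof.
move=> cf cg; have [mf [M fM]] := within_bounded_measurable cOm cf.
have [mg [M' gM]] := within_bounded_measurable cOm cg.
exact: (charge_integralD nu mO mf mg fM gM).
Qed.

Lemma charge_integral_withinZ nu a (f : V -> R) : {within Om, continuous f} ->
  charge_integral nu Om (fun x => a * f x) = a * charge_integral nu Om f.
Proof.
move=> cf; have [mf [M fM]] := within_bounded_measurable cOm cf.
exact: (charge_integralZ nu a mO mf fM).
Qed.

(** Differentiation under the integral: the increment estimate is uniform in [x], including boundary
    points. *)
Lemma slice_derivative nu (Phi Phit : E -> 'M[R]_n) (Phix : 'I_d -> E -> 'M[R]_n) i j (t : R) :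
  C1 Q Phi Phit Phix -> 0 < t < 1 ->
  is_derive t 1 (fun t => charge_integral nu Om (fun x => Phi (t, x) i j))
    (charge_integral nu Om (fun x => Phit (t, x) i j)).
Proof.
move=> C1P t01; have [_ cP cPt _ _] := C1P.
have wP := @within_entry _ _ _ _ _ _ i j cP; have wPt := @within_entry _ _ _ _ _ _ i j cPt.
have [t0 t1] := andP t01.
have in01 (u : R) : 0 < u < 1 -> `[0, 1]%classic u.
  by move=> /andP[? ?]; rewrite /= in_itv/= !ltW.
apply/is_derive_normP => e e0.
have T0 : 0 < tv nu Om + 1 by rewrite ltr_wpDl// tv_ge0.
have [r r0 hr] := @time_increment R n d Om cOm sOm Phi Phit Phix i j _ C1P (divr_gt0 e0 T0).
have m0 : 0 < Num.min r (Num.min t (1 - t)) by rewrite !lt_min r0 t0 subr_gt0.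
exists (Num.min r (Num.min t (1 - t))) => // h h0.
rewrite !lt_min => /and3P[h1 h2 h3].
have -> : h *: (1 : R) + t = t + h by rewrite addrC [h *: _]mulr1.
have th01 : 0 < t + h < 1.
  by move: h2 h3; rewrite !ltr_norml => /andP[? ?] /andP[? ?]; apply/andP; split; lra.
have c1 := within_slice (in01 _ th01) wP; have c2 := within_slice (in01 _ t01) wP.
have c3 := within_slice (in01 _ t01) wPt.
have c2' := (@withinZ _ _ Om _ (-1) c2); have c3' := (@withinZ _ _ Om _ (- h) c3).
have c12 := withinD c1 c2'.
have -> : charge_integral nu Om (fun x => Phi (t + h, x) i j) -
    charge_integral nu Om (fun x => Phi (t, x) i j) -
    h *: charge_integral nu Om (fun x => Phit (t, x) i j) =
    charge_integral nu Om (fun x => Phi (t + h, x) i j + -1 * Phi (t, x) i j +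
      - h * Phit (t, x) i j).
  rewrite (charge_integral_withinD nu c12 c3') (charge_integral_withinD nu c1 c2').
  by rewrite !charge_integral_withinZ// mulN1r mulNr.
have [mf [M fM]] := within_bounded_measurable cOm (withinD c12 c3').
have hb x : Om x -> `|Phi (t + h, x) i j + -1 * Phi (t, x) i j + - h * Phit (t, x) i j| <=
    e / (tv nu Om + 1) * `|h|.
  move=> Ox; have e1 : t + h - t = h by rewrite addrC addKr.
  have := hr t (t + h) x t01 th01; rewrite e1 => /(_ h1 Ox).
  by rewrite mulN1r mulNr.
apply: le_trans (normr_charge_integral nu mO mf hb) _.
rewrite mulrAC ler_wpM2r//.
by rewrite mulrAC ler_pdivrMr// ler_pM2l// lerDl.
Qed.

(* [G = w(t) dt (x) H] and [r = w'(t) dt (x) H]. *)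
Lemma product_curve (w w' : R -> R) (H : mxmeasure V n n) :
  (forall t : R, is_derive t 1 w (w' t)) -> continuous w' ->
  measures Om psd H -> exists mu : mCurve,
  [/\ [/\ measures Q symm mu.1.1, measures Q setT mu.1.2 & measures Q setT mu.2],
   forall Phi Phit Phix, C1 Q Phi Phit Phix ->
      pairing Q Phit mu.1.1 + pairing Q (Dstar L0 Lx Phi Phix) mu.1.2 + pairing Q Phi mu.2 =
      w 1 * pairing Om (fun x => Phi (1, x)) H - w 0 * pairing Om (fun x => Phi (0, x)) H,
   forall A : set (borel E), measurable A -> forall i j,
      mval mu.1.1 A i j = unit_integral (fun t => w t * mval H (section A t) i j),
   forall A : set (borel E), measurable A -> mval mu.1.2 A = 0 &
   forall A : set (borel E), measurable A -> forall i j,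
      mval mu.2 A i j = unit_integral (fun t => w' t * mval H (section A t) i j)].
Proof.
move=> dw cw' mH.
have cw : continuous w.
  move=> t; apply: differentiable_continuous; apply/derivable1_diffP.
  by have [] := dw t.
have ww : {within `[0, 1], continuous w} by exact: continuous_subspaceT.
have ww' : {within `[0, 1], continuous w'} by exact: continuous_subspaceT.
have bw := bm_continuous ww; have bw' := bm_continuous ww'.
have [G GE] := mxmeasure_choice (fun i j => product_charge (H i j) bw).
have [r rE] := mxmeasure_choice (fun i j => product_charge (H i j) bw').
have [q qE] := @mxmeasure_choice R E n k _ (fun i j => charge_lincomb ([::] : seq unit) (fun=> 0 : R)
  (fun=> charge_of_finite_measure (dirac (0 : borel E)))).
have q0 (A : set (borel E)) : measurable A -> mval q A = 0.
  by move=> mA; apply/matrixP => i j; rewrite !mxE qE// big_nil.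
have sec0 (A : set (borel E)) t i j : measurable A -> A `&` Q = set0 -> `[0, 1]%classic t ->
    fine (H i j (section A t)) = 0.
  move=> mA AQ It; have [_ +] := mH _ (section_measurable t mA).
  move=> /(_ _)/matrixP/(_ i j); rewrite !mxE; apply.
  apply/seteqP; split=> // x [Ax Ox].
  have AQx : (A `&` Q) (t, x) by split=> //; split.
  by rewrite AQ in AQx.
have v0 (v : R -> R) (A : set (borel E)) i j : measurable A -> A `&` Q = set0 ->
    unit_integral (fun t => v t * fine (H i j (section A t))) = 0.
  move=> mA AQ; rewrite -[RHS](unit_integral_cst 0); apply: eq_unit_integral => t It.
  by rewrite sec0// mulr0.
exists (G, q, r) => /=; split.
- split=> A mA; split=> //.
  + apply/matrixP => i j; rewrite !mxE !GE//; apply: eq_unit_integral => t _; congr (_ * _).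
    have [[/matrixP/(_ i j) + _] _] := mH _ (section_measurable t mA).
    by rewrite !mxE.
  + by move=> AQ; apply/matrixP => i j; rewrite !mxE GE// v0.
  + by move=> _; exact: q0.
  + by move=> AQ; apply/matrixP => i j; rewrite !mxE rE// v0.
- move=> Phi Phit Phix C1P; have [cP cPt cD] := C1_entries L0 Lx C1P.
  have -> : pairing Q (Dstar L0 Lx Phi Phix) q = 0.
    rewrite /pairing big1// => i _; rewrite big1// => j _.
    have [mf [M fM]] := within_bounded_measurable cQ (cD i j).
    by rewrite (charge_integral_lincomb (qE i j) (borel_compact cQ) mf fM) big_nil.
  rewrite addr0 /pairing -big_split/= !mulr_sumr -sumrB; apply: eq_bigr => i _.
  rewrite -big_split/= !mulr_sumr -sumrB; apply: eq_bigr => j _.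
  rewrite (product_charge_integral cOm bw (GE i j) (cPt i j)).
  rewrite (product_charge_integral cOm bw' (rE i j) (cP i j)).
  set h := fun t => charge_integral (H i j) Om (fun x => Phi (t, x) i j).
  set h' := fun t => charge_integral (H i j) Om (fun x => Phit (t, x) i j).
  have wh : {within `[0, 1], continuous h}.
    exact: (@slice_integral_continuous R d Om cOm (H i j) (fun z => Phi z i j) (cP i j)).
  have wh' : {within `[0, 1], continuous h'}.
    exact: (@slice_integral_continuous R d Om cOm (H i j) (fun z => Phit z i j) (cPt i j)).
  rewrite -unit_integralD; first last.
  - by apply: bmM => //; exact: bm_continuous.
  - by apply: bmM => //; exact: bm_continuous.
  have := @unit_integral_ftc R (fun t => w t * h t) (fun t => w t * h' t + w' t * h t).
  apply.
  - exact: (@withinM R R^o _ _ _ ww wh).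
  - by apply: (@withinD R R^o); [exact: (@withinM R R^o)|exact: (@withinM R R^o)].
  - move=> t t01; have := is_deriveM (dw t) (@slice_derivative (H i j) Phi Phit Phix i j t C1P t01).
    rewrite -/h -/h' => D; have -> : w t * h' t + w' t * h t = w t *: h' t + h t *: w' t.
      by rewrite [w' t * _]mulrC.
    exact: D.
- by move=> A mA i j; rewrite !mxE GE//; apply: eq_unit_integral => t _; rewrite mxE.
- exact: q0.
- by move=> A mA i j; rewrite !mxE rE//; apply: eq_unit_integral => t _; rewrite mxE.
Qed.

Lemma frob_unit_integral m l (X : R -> 'M[R]_(m, l)) (Y B : 'M[R]_(m, l)) (v : R -> R) :
  bounded_measurable v -> (forall i j, bounded_measurable (fun t => X t i j)) ->
  (forall i j, Y i j = unit_integral (fun t => v t * X t i j)) ->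
  frob B Y = unit_integral (fun t => v t * frob B (X t)).
Proof.
move=> bv bX YE.
transitivity (unit_integral (fun t => \sum_i \sum_j B i j * (v t * X t i j))).
  rewrite unit_integral_sum => [|i]; last first.
    by apply: bm_sum => j; apply: bmM; [exact: bm_cst|exact: bmM].
  rewrite frobE; apply: eq_bigr => i _; rewrite unit_integral_sum => [|j]; last first.
    by apply: bmM; [exact: bm_cst|exact: bmM].
  by apply: eq_bigr => j _; rewrite unit_integralZ ?YE//; exact: bmM.
apply: eq_unit_integral => t _; rewrite frobE mulr_sumr; apply: eq_bigr => i _.
by rewrite mulr_sumr; apply: eq_bigr => j _; rewrite mulrCA.
Qed.

Hypotheses (sL2 : L2^T = L2) (uL2 : L2 \in unitmx).
Let Li := invmx L2.

(* Completing the square. *)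
Lemma Jlin_product_le (p : @dual_param R n k) (X : 'M[R]_n) a b : psd X ->
  Jlin L1 L2 p (a ^+ 2 *: X) 0 ((a * b) *: X) <= 2^-1 * b ^+ 2 * frob Li (X *m Li).
Proof.
move=> pX; have [sX _] := pX; case: p => [[[B C] v] W].
have sLi : Li^T = Li by rewrite /Li trmx_inv sL2.
rewrite JlinE frob0r.
have a2 : 0 <= a ^+ 2 by exact: sqr_ge0.
have -> : frob (W - W^T) (a ^+ 2 *: X) = 0.
  rewrite frobZr frobDl frobNl -[frob W^T X]frob_tr trmxK sX subrr mulr0//.
have h1 : 0 <= frob (B *m L1) (a ^+ 2 *: X *m (B *m L1)).
  by rewrite -scalemxAl frobZr mulr_ge0// frob_psd.
have h2 : 0 <= (v^T *m (a ^+ 2 *: X) *m v) 0 0.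
  by rewrite -scalemxAr -scalemxAl mxE mulr_ge0//; have [_] := pX; exact.
pose D := a *: (C *m L2).
have DL : a *: C = D *m Li by rewrite /D -scalemxAl -mulmxA mulmxV// mulmx1.
have -> : frob C ((a * b) *: X) = b * frob D (X *m Li).
  by rewrite frob_mulr sLi -DL frobZl frobZr; ring.
have -> : frob (C *m L2) (a ^+ 2 *: X *m (C *m L2)) = frob D (X *m D).
  by rewrite /D -scalemxAl -scalemxAr frobZl !frobZr; ring.
clearbody D.
have := frob_psd (D - b *: Li) pX.
have sym : frob Li (X *m D) = frob D (X *m Li).
  by rewrite frob_mull sX frobC.
rewrite mulmxBr -scalemxAr !frobDl !frobDr !frobNl !frobNr !frobZl !frobZr sym.
move: (frob D (X *m D)) (frob D (X *m Li)) (frob Li (X *m Li)) => x y z.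
move: h1 h2; move: (frob (B *m L1) _) ((_ *m v) 0 0) => h1 h2 ? ? H.
nra.
Qed.

(** With weight [al ^+ 2] on [G] and [al * b] on [r], the factor [al] cancels in J and the action
    density is constant in time. With the profile 1 - t instead of its square the density would be 1
    / (1 - t) up to a factor. *)
Lemma product_action (al : R -> R) b (H : mxmeasure V n n) (mu : mCurve) :
  continuous al -> measures Om psd H ->
  (forall A : set (borel E), measurable A -> forall i j,
      mval mu.1.1 A i j = unit_integral (fun t => al t ^+ 2 * mval H (section A t) i j)) ->
  (forall A : set (borel E), measurable A -> mval mu.1.2 A = 0) ->
  (forall A : set (borel E), measurable A -> forall i j,
      mval mu.2 A i j = unit_integral (fun t => al t * b * mval H (section A t) i j)) ->
  action_le L1 L2 mu.1.1 mu.1.2 mu.2 (2^-1 * b ^+ 2 * frob Li (mval H setT *m Li)).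
Proof.
move=> cal mH GE q0 rE F p N mF tF.
have bal : bounded_measurable al by apply: bm_continuous; exact: continuous_subspaceT.
have bal2 : bounded_measurable (fun t => al t ^+ 2).
  by under eq_fun do rewrite expr2; exact: bmM.
have balb : bounded_measurable (fun t => al t * b) by apply: bmM => //; exact: bm_cst.
have bH (A : set (borel E)) i j : measurable A ->
    bounded_measurable (fun t => mval H (section A t) i j).
  by move=> mA; under eq_fun do rewrite mxE; exact: section_charge_bm.
have bfrob (B : 'M[R]_n) (A : set (borel E)) : measurable A ->
    bounded_measurable (fun t => frob B (mval H (section A t))).
  move=> mA; under eq_fun do rewrite frobE.
  apply: bm_sum => i; apply: bm_sum => j; apply: bmM; first exact: bm_cst.
  exact: bH.
have bLi (A : set (borel E)) : measurable A ->
    bounded_measurable (fun t => frob Li (mval H (section A t) *m Li)).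
  by move=> mA; under eq_fun do rewrite frob_mulr; exact: bfrob.
have psdH A : measurable A -> psd (mval H A) by move=> mA; have [] := mH A mA.
set c := 2^-1 * b ^+ 2.
have c0 : 0 <= c by rewrite /c mulr_ge0// sqr_ge0.
have step (i : 'I_N) : Jlin L1 L2 (p i) (mval mu.1.1 (F i)) (mval mu.1.2 (F i)) (mval mu.2 (F i)) <=
    unit_integral (fun t => c * frob Li (mval H (section (F i) t) *m Li)).
  rewrite q0// /Jlin frob0r addr0.
  rewrite (frob_unit_integral _ bal2 (fun a b => bH _ a b (mF i)) (GE _ (mF i))).
  rewrite (frob_unit_integral _ balb (fun a b => bH _ a b (mF i)) (rE _ (mF i))).
  have b1 := bmM bal2 (bfrob (dual_coef L1 L2 (p i)) _ (mF i)).
  have b2 := bmM balb (bfrob (p i).1.1.2 _ (mF i)).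
  rewrite -unit_integralD//; apply: le_unit_integral.
  - exact: bmD.
  - by apply: bmM; [exact: bm_cst|exact: bLi].
  move=> t _; have := @Jlin_product_le (p i) _ (al t) b (psdH _ (section_measurable t (mF i))).
  by rewrite /Jlin frob0r addr0 !frobZr.
apply: le_trans (ler_sum _ (fun i _ => step i)) _.
have bcL (i : 'I_N) : bounded_measurable (fun t => c * frob Li (mval H (section (F i) t) *m Li)).
  by apply: bmM; [exact: bm_cst|exact: bLi].
rewrite -unit_integral_sum//.
rewrite -[leRHS]unit_integral_cst; apply: le_unit_integral.
- exact: bm_sum.
- exact: bm_cst.
move=> t _; rewrite -mulr_sumr ler_wpM2l//.
have -> : \sum_(i < N) frob Li (mval H (section (F i) t) *m Li) =
    frob Li (mval H (\big[setU/set0]_(i < N) section (F i) t) *m Li).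
  have tsec : trivIset setT (fun i => section (F i) t).
    by move=> i j _ _ [x [Fi Fj]]; apply: (tF i j) => //; exists (t, x).
  have -> : mval H (\big[setU/set0]_(i < N) section (F i) t) =
      \sum_(i < N) mval H (section (F i) t).
    apply/matrixP => i j; rewrite summxE mxE.
    rewrite (@fine_charge_bigsetU _ _ _ (H i j) (fun i => section (F i) t) N _ tsec).
      by apply: eq_bigr => l _; rewrite mxE.
    by move=> l; exact: section_measurable.
  rewrite mulmx_suml; elim/big_rec2: _ => [|i X Y _ ->]; first by rewrite frob0r.
  by rewrite frobDr.
set U := \big[setU/set0]_(i < N) _.
have mU : measurable U by apply: bigsetU_measurable => i _; exact: section_measurable.
have -> : mval H setT = mval H U + mval H (~` U).
  rewrite -mvalU ?setUv ?setICr//; exact: measurableC.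
by rewrite mulmxDl frobDr lerDl frob_psd//; apply: psdH; exact: measurableC.
Qed.

End ProductCurve.

(** * The metric *)

Section Cost.
Context {R : realType} {n k d : nat}.
Variables (L0 : {linear 'M[R]_n -> 'M[R]_(n, k)})
          (Lx : 'I_d -> {linear 'M[R]_n -> 'M[R]_(n, k)}).
Variables (L1 : 'M[R]_k) (L2 : 'M[R]_n) (Om : set 'rV[R]_d).
Hypotheses (sL1 : L1^T = L1) (sL2 : L2^T = L2) (uL2 : L2 \in unitmx).
Hypotheses (cOm : compact Om) (sOm : smooth_boundary Om).
Let V := 'rV[R]_d.
Let E := (R * V)%type.
Let Q : set E := cylinder Om.
Let cQ : compact Q := compact_cylinder cOm.
Let mOm := mxmeasure V n n.
Let mCurve := (mxmeasure E n n * mxmeasure E n k * mxmeasure E n n)%type.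
Implicit Types a b : R.

Definition action_curve (mu : mCurve) a := action_le L1 L2 mu.1.1 mu.1.2 mu.2 a.

(** The metric arguments are carried out with this real-valued relation; [WB_lt] and [WB_le]
    translate it to and from the square root of the infimum. *)
Definition cost_le a (H H' : mOm) :=
  exists mu : mCurve, CE_on L0 Lx Om 0 1 H H' mu /\ action_curve mu a.

Lemma action_curve_mono (mu : mCurve) a b : a <= b -> action_curve mu a -> action_curve mu b.
Proof. by move=> ab h F p N mF tF; apply: le_trans ab; exact: h. Qed.

Lemma cost_le_mono a b (H H' : mOm) : a <= b -> cost_le a H H' -> cost_le b H H'.
Proof. by move=> ab [mu [ce ha]]; exists mu; split=> //; exact: action_curve_mono ha. Qed.

Lemma action_CE_le a (H H' : mOm) (mu : mCurve) : CE_on L0 Lx Om 0 1 H H' mu ->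
  (action L1 L2 Q mu <= a%:E)%E <-> action_curve mu a.
Proof.
case: mu => [[G q] r] [/= mG mq mr _].
apply: action_leP => //; first exact: borel_compact.
by move=> A mA; split=> //; have [] := mG A mA.
Qed.

Lemma sqrte_EFin_sqr a : 0 <= a -> sqrte (a ^+ 2)%:E = a%:E.
Proof. by move=> a0; rewrite /= sqrtr_sqr ger0_norm. Qed.

Lemma WB_lt a (H H' : mOm) : 0 < a -> (WB L0 Lx L1 L2 Om H H' < a%:E)%E ->
  cost_le (a ^+ 2) H H'.
Proof.
move=> a0 h.
have : (ereal_inf [set action L1 L2 Q mu | mu in CE L0 Lx Om H H'] < (a ^+ 2)%:E)%E.
  rewrite ltNge; apply/negP => le_a; move: h; apply/negP; rewrite -leNgt.
  rewrite -(sqrte_EFin_sqr (ltW a0)) lee_sqrt//; apply: le_trans le_a.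
  by rewrite lee_fin sqr_ge0.
move=> /ereal_inf_lt[_ [mu ce <-] /ltW hmu]; exists mu.
by have ce' := (CE_onE L0 Lx Om H H' mu).1 ce; split=> //; apply/(action_CE_le _ ce').
Qed.

Lemma WB_le a (H H' : mOm) : 0 <= a -> cost_le (a ^+ 2) H H' ->
  (WB L0 Lx L1 L2 Om H H' <= a%:E)%E.
Proof.
move=> a0 [mu [ce /(action_CE_le _ ce) h]].
rewrite -(sqrte_EFin_sqr a0) lee_sqrt ?lee_fin ?sqr_ge0//.
apply: le_trans h; apply: ereal_inf_lbound; exists mu => //.
exact: (CE_onE L0 Lx Om H H' mu).2.
Qed.

Lemma pairing_eq_mxmeasure (H H' : mOm) (Phi : V -> 'M[R]_n) : eq_mxmeasure H H' ->
  (forall i j, {within Om, continuous (fun x => Phi x i j)}) ->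
  pairing Om Phi H = pairing Om Phi H'.
Proof.
move=> HH cP; apply: eq_bigr => i _; apply: eq_bigr => j _.
have [mf [M fM]] := within_bounded_measurable cOm (cP i j).
apply: (charge_integral_eq_charge (borel_compact cOm) mf fM) => A mA.
by have /matrixP/(_ i j) := HH A mA; rewrite !mxE.
Qed.

Lemma C1_slice_entries (Phi Phit : E -> 'M[R]_n) (Phix : 'I_d -> E -> 'M[R]_n) (t : R) i j :
  C1 Q Phi Phit Phix -> `[0, 1]%classic t ->
  {within Om, continuous (fun x => Phi (t, x) i j)}.
Proof.
move=> [_ cP _ _ _] It.
exact: (within_slice It (@within_entry _ _ _ _ _ _ i j cP)).
Qed.

Lemma unit_itv1 : `[0, 1]%classic (1 : R). Proof. by rewrite /= in_itv/= lexx ler01. Qed.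

Lemma cost_refl (H H' : mOm) : measures Om psd H -> eq_mxmeasure H H' -> cost_le 0 H H'.
Proof.
move=> mH HH.
(* The constant weight and its derivative are written as [1 ^+ 2] and [1 * 0] to match
   [product_action] with [al = 1] and [b = 0]. *)
have dw (t : R) : is_derive t 1 (fun=> 1 ^+ 2 : R) (1 * 0 : R).
  by rewrite mulr0; exact: is_derive_cst.
have [mu [[mG mq mr] ce GE q0 rE]] := product_curve L0 Lx cOm sOm dw
  (@cst_continuous R R^o (1 * 0)) mH.
exists mu; split.
  split=> // Phi Phit Phix C1P; rewrite (ce _ _ _ C1P) expr1n !mul1r; congr (_ - _).
  apply: pairing_eq_mxmeasure => // i j; exact: C1_slice_entries C1P unit_itv1.
have := product_action L1 sL2 uL2 (@cst_continuous R R^o 1) mH GE q0 rE.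
by rewrite expr0n/= mulr0 mul0r.
Qed.

Lemma cost_sym a (H H' : mOm) : cost_le a H H' -> cost_le a H' H.
Proof.
move=> [mu [ce ha]].
have [|||nu [_ h ha' _]] := @CE_on_reparam R n k d L0 Lx L1 L2 Om cOm H H' mu a 1 (-1) ce ha.
- by rewrite ler01 lexx.
- by rewrite subrr lexx ler01.
- by rewrite oppr_eq0 oner_eq0.
exists nu; split; first by rewrite -(subrr 1); apply: h; rewrite oppr_lt0.
by move: ha'; rewrite normrN1 divr1.
Qed.

(* Time is split in the ratio [a : b], and
   [a^2 / (a / (a + b)) + b^2 / (b / (a + b)) = (a + b)^2]. *)
Lemma cost_trans a b (H H' H'' : mOm) : 0 < a -> 0 < b -> cost_le (a ^+ 2) H H' ->
  cost_le (b ^+ 2) H' H'' -> cost_le ((a + b) ^+ 2) H H''.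
Proof.
move=> a0 b0 [mu [ce ha]] [mu' [ce' hb]]; have ab0 : 0 < a + b by exact: addr_gt0.
pose t := a / (a + b).
have t0 : 0 < t by exact: divr_gt0.
have t1 : t + (1 - t) = 1 by rewrite addrC subrK.
have t1E : 1 - t = b / (a + b).
  rewrite /t -[1](@divff _ (a + b)) ?lt0r_neq0// -mulrBl; congr (_ / _); lra.
have t10 : 0 < 1 - t by rewrite t1E divr_gt0.
have [|||nu [h _ hnu _]] := @CE_on_reparam R n k d L0 Lx L1 L2 Om cOm H H' mu _ 0 t ce ha.
- by rewrite lexx ler01.
- by rewrite add0r ltW//= -subr_ge0 ltW.
- exact: lt0r_neq0.
have [|||nu' [h' _ hnu' _]] := @CE_on_reparam R n k d L0 Lx L1 L2 Om cOm H' H'' mu' _ t (1 - t) ce' hb.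
- by rewrite ltW//= -subr_ge0 ltW.
- by rewrite t1 ler01 lexx.
- exact: lt0r_neq0.
move: (h t0) (h' t10); rewrite add0r t1 => c1 c2.
have [eta [c3 ha3 _ _ _]] := CE_on_add cOm c1 c2 hnu hnu'.
exists eta; split=> //; apply: action_curve_mono ha3.
rewrite !gtr0_norm// t1E /t !invf_div le_eqVlt; apply/orP; left; apply/eqP.
have na := lt0r_neq0 a0; have nb := lt0r_neq0 b0.
by rewrite !expr2 mulrA (mulrAC a) -(mulrA (a * _)) ; field; rewrite na nb.
Qed.

Lemma zero_mxmeasure : exists H0 : mOm, forall A : set (borel V), measurable A -> mval H0 A = 0.
Proof.
have [H0 hH0] := @mxmeasure_choice R V n n _ (fun i j => charge_lincomb ([::] : seq unit)
  (fun=> 0 : R) (fun=> charge_of_finite_measure (dirac (0 : borel V)))).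
by exists H0 => A mA; apply/matrixP => i j; rewrite !mxE hH0// big_nil.
Qed.

Lemma cost_zero (H H0 : mOm) : measures Om psd H ->
  (forall A : set (borel V), measurable A -> mval H0 A = 0) -> exists a, cost_le a H H0.
Proof.
move=> mH H00.
have dw (t : R) : is_derive t 1 (fun t : R => (1 - t) ^+ 2) ((1 - t) * (- 2)).
  apply/is_derive_normP => e e0; exists e => // h h0 he.
  have -> : h *: (1 : R) + t = h + t by rewrite [h *: _]mulr1.
  have -> : (1 - (h + t)) ^+ 2 - (1 - t) ^+ 2 - h *: ((1 - t) * - 2) = h * h.
    have -> : h *: ((1 - t) * - 2) = h * ((1 - t) * - 2) by [].
    ring.
  by rewrite normrM ler_wpM2r// ltW.
have c1 : continuous (fun t : R => 1 - t).
  by move=> t; apply: cvgB; [exact: cvg_cst|exact: cvg_id].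
have c2 : continuous (fun t : R => (1 - t) * (- 2)).
  by move=> t; apply: cvgM; [exact: c1|exact: cvg_cst].
have [mu [[mG mq mr] ce GE q0 rE]] := product_curve L0 Lx cOm sOm dw c2 mH.
eexists; exists mu; split; last first.
  exact: (product_action L1 sL2 uL2 c1 mH GE q0 rE).
split=> // Phi Phit Phix C1P; rewrite (ce _ _ _ C1P) subrr subr0 expr1n expr0n/= mul0r mul1r.
congr (_ - _); symmetry; rewrite /pairing big1// => i _; rewrite big1// => j _.
have [mf [M fM]] := within_bounded_measurable cOm (@C1_slice_entries _ _ _ 1 i j C1P unit_itv1).
have := normr_charge_integral (H0 i j) (borel_compact cOm) mf fM.
have -> : tv (H0 i j) Om = 0.
  have [P [N [mP mN _ ->]]] := tv_hahn (H0 i j); last exact: borel_compact.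
  have z A : measurable A -> fine (H0 i j A) = 0.
    by move=> mA; have /matrixP/(_ i j) := H00 A mA; rewrite !mxE.
  by rewrite !z ?subrr//; apply: measurableI => //; exact: borel_compact.
by rewrite mulr0 normr_le0 => /eqP.
Qed.

Lemma cost_finite (H H' : mOm) : measures Om psd H -> measures Om psd H' ->
  exists2 a, 0 < a & cost_le (a ^+ 2) H H'.
Proof.
move=> mH mH'; have [H0 H00] := zero_mxmeasure.
(* Replaces an arbitrary bound by the square of a positive number, the form needed for
   [cost_trans]. *)
have big a (K K' : mOm) : cost_le a K K' -> cost_le ((`|a| + 1) ^+ 2) K K'.
  apply: cost_le_mono; have := ler_norm a; have := normr_ge0 a.
  by move: (`|a|) => x; nra.
have [a /big ha] := cost_zero mH H00; have [b /big/cost_sym hb] := cost_zero mH' H00.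
have pos c : 0 < `|c| + 1 :> R by rewrite ltr_wpDl.
exists (`|a| + 1 + (`|b| + 1)); first by rewrite addr_gt0.
exact: cost_trans ha hb.
Qed.

(** The infimum is not known to be attained, so curves are provided for every [D + e]. *)
Lemma WB_finite (H H' : mOm) : measures Om psd H -> measures Om psd H' ->
  exists D, [/\ 0 <= D, WB L0 Lx L1 L2 Om H H' = D%:E &
    forall e, 0 < e -> cost_le ((D + e) ^+ 2) H H'].
Proof.
move=> mH mH'; have [a a0 ha] := cost_finite mH mH'.
have := sqrte_ge0 (ereal_inf [set action L1 L2 Q mu | mu in CE L0 Lx Om H H']).
have := WB_le (ltW a0) ha; rewrite -/(WB L0 Lx L1 L2 Om H H').
have := @WB_lt^~ H^~ H'; case: WB => [D| |]// hlt _ D0; exists D; split=> // e e0.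
apply: hlt; first by rewrite ltr_wpDl.
by rewrite lte_fin ltrDl.
Qed.

End Cost.

Section Metric.
Context {R : realType} {n k d : nat}.
Variables (L0 : {linear 'M[R]_n -> 'M[R]_(n, k)})
          (Lx : 'I_d -> {linear 'M[R]_n -> 'M[R]_(n, k)}).
Variables (L1 : 'M[R]_k) (L2 : 'M[R]_n) (Om : set 'rV[R]_d).
Hypotheses (sL1 : L1^T = L1) (sL2 : L2^T = L2) (uL2 : L2 \in unitmx).
Hypotheses (L0_id : L0 1%:M = 0) (cOm : compact Om) (sOm : smooth_boundary Om).
Let V := 'rV[R]_d.
Let E := (R * V)%type.
Let Q : set E := cylinder Om.
Let mO : measurable (Om : set (borel V)) := borel_compact cOm.
Let mOm := mxmeasure V n n.
Let cost := cost_le L0 Lx L1 L2 Om.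
Let dist := WB L0 Lx L1 L2 Om.
Let MOm := measures Om psd : set mOm.

Lemma psd_tv_le (H : mOm) i j : MOm H -> tv (H i j) Om <= \tr (mval H setT).
Proof.
move=> mH; apply: (@le_trans _ _ (tv (H i j) setT)); first exact: le_tv.
by apply: tv_le_trace => A mA; have [] := mH A mA.
Qed.

Lemma cost_mass : exists2 C, 0 < C & forall (H H' : mOm) a, MOm H -> MOm H' ->
  cost a H H' -> \tr (mval H' setT) <= C * (\tr (mval H setT) + a).
Proof.
have [C C0 hC] := CE_mass_le Lx L1 L2 L0_id cOm; exists C => // H H' a mH mH'.
move=> [[[G q] r] [/(CE_onE L0 Lx Om H H') ce ha]].
by have [] := hC H H' G q r a mH mH' ce ha.
Qed.

Lemma cost_close (g : V -> R) (i j : 'I_n) (m e : R) : C1fun g -> 0 < e ->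
  exists2 dl, 0 < dl & forall H H' : mOm, MOm H -> MOm H' -> \tr (mval H setT) <= m ->
  cost dl H H' -> `|charge_integral (H' i j) Om g - charge_integral (H i j) Om g| <= e.
Proof.
move=> Cg e0; have [dl dl0 h] := CE_close Lx L1 L2 L0_id cOm i j m Cg e0.
exists dl => // H H' mH mH' hm [mu [/(CE_onE L0 Lx Om H H') ce ha]].
exact: (h H H' mu mH mH' hm ce ha).
Qed.

Lemma cost_weak_cvg (u : nat -> mOm) (G : mOm) : (forall l, MOm (u l)) -> MOm G ->
  (forall dl, 0 < dl -> \forall l \near \oo, cost dl G (u l)) ->
  forall i j (f : V -> R), {within Om, continuous f} ->
  charge_integral (u l i j) Om f @[l --> \oo] --> charge_integral (G i j) Om f.
Proof.
move=> mu mG hu i j f cf.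
have [C C0 hC] := cost_mass.
have [N _ hN] := hu 1 ltr01.
(* The uniform mass bound is available from rank [N] on, where the cost from [G] is at most 1. *)
rewrite -(cvg_shiftn N); apply/cvgrPdist_le => e e0.
pose M := Num.max (\tr (mval G setT)) (C * (\tr (mval G setT) + 1)).
have M1 (l : nat) : tv (G i j) Om <= M.
  by apply: le_trans (psd_tv_le i j mG) _; rewrite le_max lexx.
have M2 (l : nat) : tv (u (l + N)%N i j) Om <= M.
  apply: le_trans (psd_tv_le i j (mu _)) _; rewrite le_max; apply/orP; right.
  by apply: hC => //; apply: hN; exact: leq_addl.
apply: (@C1fun_small R d nat \oo _ (fun=> G i j) (fun l => u (l + N)%N i j) Om M cOm M1 M2 _ f cf e e0).
move=> g Cg e' e'0; have [dl dl0 hdl] := cost_close i j (\tr (mval G setT)) Cg e'0.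
have [N' _ hN'] := hu dl dl0; exists N' => // l /= N'l.
rewrite distrC; apply: hdl => //; apply: hN'.
exact: leq_trans N'l (leq_addr _ _).
Qed.

(** The constant sequence [H'] converges weakly to [H], so both measures integrate continuous
    functions equally. *)
Lemma weak_eq (H H' : mOm) : MOm H -> MOm H' -> (forall dl, 0 < dl -> cost dl H H') ->
  eq_mxmeasure H H'.
Proof.
move=> mH mH' h A mA; apply/matrixP => i j; rewrite !mxE.
apply: (@charge_unique R V (H i j) (H' i j) Om cOm) mA.
- exact: (@measures_concentrated R V n n Om psd H i j mH).
- exact: (@measures_concentrated R V n n Om psd H' i j mH').
move=> f cf; have wf := @continuous_subspaceT _ R Om f cf.
have := @cost_weak_cvg (fun=> H') H (fun=> mH') mH _ i j f wf.
move=> /(_ _)/cvg_lim <- //; first by rewrite lim_cst.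
by move=> dl dl0; exact: nearW (fun=> h dl dl0).
Qed.

Lemma cost_of_dist (H H' : mOm) e : 0 < e -> (dist H H' < e%:E)%E -> cost (e ^+ 2) H H'.
Proof. by move=> e0; exact: (WB_lt sL1 sL2 uL2 cOm e0). Qed.

Lemma dist_of_cost (H H' : mOm) e : 0 <= e -> cost (e ^+ 2) H H' -> (dist H H' <= e%:E)%E.
Proof. exact: (WB_le sL1 sL2 uL2 cOm). Qed.

Lemma dist_sym_le (H H' : mOm) : MOm H -> MOm H' -> (dist H H' <= dist H' H)%E.
Proof.
move=> mH mH'; have [D [D0 DE hD]] := WB_finite L0 Lx sL1 sL2 uL2 cOm sOm mH' mH.
rewrite /dist DE; apply/lee_addgt0Pr => e e0; apply: dist_of_cost; first by rewrite addr_ge0// ltW.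
exact/cost_sym/hD.
Qed.

Lemma dist_triangle (H H' H'' : mOm) : MOm H -> MOm H' -> MOm H'' ->
  (dist H H'' <= dist H H' + dist H' H'')%E.
Proof.
move=> mH mH' mH''; have [D [D0 DE hD]] := WB_finite L0 Lx sL1 sL2 uL2 cOm sOm mH mH'.
have [D' [D'0 D'E hD']] := WB_finite L0 Lx sL1 sL2 uL2 cOm sOm mH' mH''.
rewrite /dist DE D'E -EFinD; apply/lee_addgt0Pr => e e0.
have e20 : 0 < e / 2 by rewrite divr_gt0.
rewrite -EFinD [e]splitr addrACA; apply: dist_of_cost.
  by rewrite !addr_ge0// ltW.
apply: (cost_trans cOm _ _ (hD _ e20) (hD' _ e20)); by rewrite ltr_wpDl.
Qed.

Lemma dist_metric : is_metric MOm eq_mxmeasure dist.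
Proof.
split.
- move=> H H' mH mH'; have [D [D0 DE hD]] := WB_finite L0 Lx sL1 sL2 uL2 cOm sOm mH mH'.
  by rewrite /dist DE lee_fin D0 ltry.
- move=> H H' mH mH'; split=> [d0|HH].
    apply: weak_eq => // dl dl0.
    have s0 : 0 < Num.sqrt dl by rewrite sqrtr_gt0.
    by rewrite -(sqr_sqrtr (ltW dl0)); apply: cost_of_dist; rewrite // d0 lte_fin.
  apply/eqP; rewrite eq_le sqrte_ge0 andbT; apply: dist_of_cost => //.
  by rewrite expr0n; exact: cost_refl.
- by move=> H H' mH mH'; apply/eqP; rewrite eq_le !dist_sym_le.
- exact: dist_triangle.
Qed.

Lemma dist_cvg0_near (u : nat -> mOm) (G : mOm) (e : R) : 0 < e ->
  dist (u j) G @[j --> \oo] --> 0%E -> \forall j \near \oo, (dist (u j) G < e%:E)%E.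
Proof.
move=> e0 /fine_cvgP[fin /cvgr_lt/(_ _ e0) lt].
near=> j; have fj : dist (u j) G \is a fin_num by near: j.
rewrite -(fineK fj) lte_fin; near: j; exact: lt.
Unshelve. all: by end_near. Qed.

Lemma dist_weak_star (u : nat -> mOm) (G : mOm) : (forall j, MOm (u j)) -> MOm G ->
  dist (u j) G @[j --> \oo] --> 0%E -> weak_star Om symm u G.
Proof.
move=> mu mG hd Phi cP _; apply: cvg_sum_fin => i; apply: cvg_sum_fin => j.
apply: cost_weak_cvg => // [dl dl0|]; last exact: within_entry.
have s0 : 0 < Num.sqrt dl by rewrite sqrtr_gt0.
have := dist_cvg0_near s0 hd; apply: filterS => l hl.
by apply: cost_sym => //; rewrite -(sqr_sqrtr (ltW dl0)); exact: cost_of_dist.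
Qed.

(** Slice and measure vary together: uniform continuity of [f] and the mass bound replace the slice
    at [t J] by the slice at 1. This identifies the endpoint of an infinite concatenation. *)
Lemma slice_limit (f : E -> R) (t : nat -> R) (nu_ : nat -> {charge set (borel V) -> \bar R})
    (nu : {charge set (borel V) -> \bar R}) M : {within Q, continuous f} ->
  (forall J, `[0, 1]%classic (t J)) -> t J @[J --> \oo] --> (1 : R) ->
  (forall J, tv (nu_ J) Om <= M) ->
  (forall g : V -> R, {within Om, continuous g} ->
     charge_integral (nu_ J) Om g @[J --> \oo] --> charge_integral nu Om g) ->
  charge_integral (nu_ J) Om (fun x => f (t J, x)) @[J --> \oo] -->
  charge_integral nu Om (fun x => f (1, x)).
Proof.
move=> cf t01 t1 tvM hnu.
have c1 := within_slice unit_itv1 cf.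
apply/cvgrPdist_le => e e0.
have M0 : 0 < `|M| + 1 by rewrite ltr_wpDl.
have e2 : 0 < e / 2 by rewrite divr_gt0.
have [r r0 hr] := uniform_continuous_compact (compact_cylinder cOm) cf (divr_gt0 e2 M0).
have /cvgrPdist_lt/(_ _ r0) near_t := t1.
have /cvgrPdist_le/(_ _ e2) near_nu := hnu _ c1.
near=> J.
have tJ : `|1 - t J| < r by near: J.
have nuJ : `|charge_integral nu Om (fun x => f (1, x)) -
   charge_integral (nu_ J) Om (fun x => f (1, x))| <= e / 2 by near: J.
apply: le_trans (ler_distD (charge_integral (nu_ J) Om (fun x => f (1, x))) _ _) _.
rewrite [leRHS]splitr lerD//.
have c2 := within_slice (t01 J) cf; have c3 := @withinZ _ _ Om _ (-1) c2.
have -> : charge_integral (nu_ J) Om (fun x => f (1, x)) -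
    charge_integral (nu_ J) Om (fun x => f (t J, x)) =
    charge_integral (nu_ J) Om (fun x => f (1, x) + -1 * f (t J, x)).
  by rewrite (charge_integral_withinD cOm _ c1 c3) (charge_integral_withinZ cOm _ _ c2) mulN1r.
have [mf _] := within_bounded_measurable cOm (withinD c1 c3).
have hb x : Om x -> `|f (1, x) + -1 * f (t J, x)| <= e / 2 / (`|M| + 1).
  move=> Ox; rewrite mulN1r; apply: ltW; apply: hr.
  - by split=> //; exact: unit_itv1.
  - by split=> //; exact: t01.
  - by rewrite prod_normE /= subrr normr0 gt_max r0 andbT.
apply: le_trans (normr_charge_integral (nu_ J) mO mf hb) _.
rewrite mulrAC ler_pdivrMr// ler_pM2l//.
by apply: le_trans (tvM J) _; rewrite (le_trans (ler_norm _))// lerDl.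
Unshelve. all: by end_near. Qed.

End Metric.

Lemma cvg_shift_left (R : realType) (x : nat -> R) (l : R) N :
  x m @[m --> \oo] --> l -> x (N + m)%N @[m --> \oo] --> l.
Proof.
rewrite (_ : (fun m => x (N + m)%N) = fun m => x (m + N)%N); first by rewrite (cvg_shiftn N x).
by apply/funext => m; rewrite addnC.
Qed.

(** * Completeness *)

Section Completeness.
Context {R : realType} {n k d : nat}.
Variables (L0 : {linear 'M[R]_n -> 'M[R]_(n, k)})
          (Lx : 'I_d -> {linear 'M[R]_n -> 'M[R]_(n, k)}).
Variables (L1 : 'M[R]_k) (L2 : 'M[R]_n) (Om : set 'rV[R]_d).
Hypotheses (sL1 : L1^T = L1) (sL2 : L2^T = L2) (uL2 : L2 \in unitmx).
Hypotheses (L0_id : L0 1%:M = 0) (cOm : compact Om) (sOm : smooth_boundary Om).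
Let V := 'rV[R]_d.
Let E := (R * V)%type.
Let Q : set E := cylinder Om.
Let mOm := mxmeasure V n n.
Let mCurve := (mxmeasure E n n * mxmeasure E n k * mxmeasure E n n)%type.
Let cost := cost_le L0 Lx L1 L2 Om.
Let dist := WB L0 Lx L1 L2 Om.
Let MOm := measures Om psd : set mOm.
Let q : R := 2^-1.

Lemma half_gt0 l : 0 < q ^+ l. Proof. by rewrite exprn_gt0// invr_gt0. Qed.

Lemma half_le1 l : q ^+ l <= 1.
Proof. by rewrite exprn_ile1// ?invr_ge0// invf_le1// ler1n. Qed.

Lemma half_mono l m : (l <= m)%N -> q ^+ m <= q ^+ l.
Proof. by move=> lm; apply: ler_wiXn2l => //; rewrite ?invr_ge0// invf_le1// ler1n. Qed.

Lemma half_step J : 1 - q ^+ J + q ^+ J.+1 = 1 - q ^+ J.+1.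
Proof. by rewrite (@pow2_half_sum R J) -/q; move: (q ^+ J.+1) => x; lra. Qed.

(** Common bound for the values of all three components of a piece: a mass bound [Mt] for [G], and
    [action_le_tv] with s = 1 for [q] and [r]. *)
Let K_of (Mt eta : R) := Mt + eta + (frob L1 L1 + frob L2 L2) * Mt.

(** Run in time [q ^+ l.+1], a curve of action [eta * (q ^+ l.+1) ^+ 2] acquires action
    [eta * q ^+ l.+1], and these sum to [eta]. The values also decay geometrically, as the limit of
    the concatenations requires. *)
Lemma cost_piece (Mb : R) : exists2 C, 0 < C & forall (H H' : mOm) (eta : R) l,
  MOm H -> MOm H' -> \tr (mval H setT) <= Mb -> 0 < eta ->
  cost (eta * (q ^+ l.+1) ^+ 2) H H' ->
  exists P : mCurve, [/\ CE_on L0 Lx Om (1 - q ^+ l) (1 - q ^+ l.+1) H H' P,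
    action_curve L1 L2 P (eta * q ^+ l.+1) &
    forall A : set (borel E), measurable A ->
      [/\ forall i j, `|mval P.1.1 A i j| <= K_of (2 * Mb + C * eta) eta * q ^+ l,
          forall i j, `|mval P.1.2 A i j| <= K_of (2 * Mb + C * eta) eta * q ^+ l &
          forall i j, `|mval P.2 A i j| <= K_of (2 * Mb + C * eta) eta * q ^+ l]].
Proof.
have [C C0 hC] := CE_mass_le Lx L1 L2 L0_id cOm; exists C => // H H' eta l mH mH' hMb eta0.
move=> [[[G r'] r] [ce ha]].
have c0 := half_gt0 l.+1; have c1 := half_le1 l.+1.
have [hT _] := hC H H' G r' r _ mH mH' ((CE_onE L0 Lx Om H H' (G, r', r)).2 ce) ha.
set Mt := 2 * Mb + C * eta.
have TMt : \tr (mval G setT) <= Mt.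
  apply: le_trans hT _; rewrite lerD//; first by rewrite ler_pM2l.
  rewrite ler_pM2l// -[leRHS]mulr1 ler_pM2l// expr2 -[leRHS]mulr1.
  by apply: ler_pM => //; exact: ltW.
have [|||P [h _ hP PT]] := @CE_on_reparam R n k d L0 Lx L1 L2 Om cOm H H' (G, r', r) _
  (1 - q ^+ l) (q ^+ l.+1) ce ha.
- by rewrite subr_ge0 half_le1 lerBlDr lerDl ltW// half_gt0.
- by rewrite half_step subr_ge0 half_le1 lerBlDr lerDl ltW// half_gt0.
- exact: lt0r_neq0.
have hP' : action_curve L1 L2 P (eta * q ^+ l.+1).
  move: hP; rewrite gtr0_norm//; congr (action_le _ _ _ _ _ _).
  by rewrite expr2 mulrA mulfK// lt0r_neq0.
exists P; split=> //; first by have := h c0; rewrite half_step.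
have [mG _ _ _] := h c0.
have pG A : measurable A -> psd (mval P.1.1 A).
  by move=> mA; apply: (action_le_psd hP') => //; have [] := mG A mA.
have [tq tr'] := action_le_tv pG hP' ltr01.
set cL := frob L1 L1 + frob L2 L2 in tq tr'.
have cL0 : 0 <= cL by rewrite /cL addr_ge0 ?frob_ge0.
have PT' : \tr (mval P.1.1 setT) <= Mt * q ^+ l.
  rewrite PT mxtraceZ gtr0_norm// mulrC; apply: (@le_trans _ _ (Mt * q ^+ l.+1)).
    by rewrite ler_pM2r.
  have Mt0 : 0 <= Mt.
    apply: le_trans TMt; move: PT; rewrite gtr0_norm// => PT.
    have : 0 <= \tr (mval P.1.1 setT).
      by apply: sumr_ge0 => i _; apply: psd_diag; exact: pG.
    by rewrite PT mxtraceZ pmulr_rge0.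
  by rewrite ler_wpM2l// half_mono.
have Mtl : 0 <= Mt * q ^+ l.
  apply: le_trans PT'.
  by apply: sumr_ge0 => i _; apply: psd_diag; exact: pG.
have ql := half_gt0 l.
have bnd : eta * q ^+ l.+1 / 1 + 1 * cL * \tr (mval P.1.1 setT) <= K_of Mt eta * q ^+ l.
  rewrite divr1 mul1r /K_of -/cL (mulrDl (Mt + eta)) (mulrDl Mt).
  have h1 : eta * q ^+ l.+1 <= eta * q ^+ l by rewrite ler_pM2l// half_mono.
  have h2 : cL * \tr (mval P.1.1 setT) <= cL * Mt * q ^+ l.
    by rewrite -mulrA ler_wpM2l.
  move: h1 h2 Mtl; move: (eta * q ^+ l.+1) (eta * q ^+ l) (Mt * q ^+ l)
    (cL * Mt * q ^+ l) (cL * \tr _) => x1 x2 x3 x4 x5; lra.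
have bndG : \tr (mval P.1.1 setT) <= K_of Mt eta * q ^+ l.
  apply: le_trans PT' _; rewrite ler_pM2r// /K_of -/cL -addrA lerDl addr_ge0 ?(ltW eta0)//.
  by rewrite mulr_ge0// -(pmulr_lge0 _ ql).
move=> A mA; split=> i j; rewrite mxE.
- apply: le_trans bndG; apply: le_trans (tv_le_trace i j pG).
  by apply: le_trans (normr_charge_le_tv _ mA) _; exact: le_tv.
- apply: le_trans bnd; apply: le_trans (tq i j).
  by apply: le_trans (normr_charge_le_tv _ mA) _; exact: le_tv.
- apply: le_trans bnd; apply: le_trans (tr' i j).
  by apply: le_trans (normr_charge_le_tv _ mA) _; exact: le_tv.
Qed.

(* Concatenation of countably many curves, the [l]-th one run on
   [[1 - q ^+ l, 1 - q ^+ l.+1]]. *)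
Lemma cost_chain (H_ : nat -> mOm) (G : mOm) (Mb eta : R) : (forall l, MOm (H_ l)) ->
  (forall l, \tr (mval (H_ l) setT) <= Mb) -> 0 < eta ->
  (forall l, cost (eta * (q ^+ l.+1) ^+ 2) (H_ l) (H_ l.+1)) ->
  (forall i j (f : V -> R), {within Om, continuous f} ->
     charge_integral (H_ l i j) Om f @[l --> \oo] --> charge_integral (G i j) Om f) ->
  cost eta (H_ 0%N) G.
Proof.
move=> mH hMb eta0 hcost hlim.
have [C C0 hC] := cost_piece Mb; set K := K_of (2 * Mb + C * eta) eta in hC.
have [P hP] := choice (fun l => hC (H_ l) (H_ l.+1) eta l (mH l) (mH l.+1) (hMb l) eta0 (hcost l)).
(* The curve after pieces 0 to [J]; its action bound is the partial geometric sum. *)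
pose Inv J (mu : mCurve) := CE_on L0 Lx Om 0 (1 - q ^+ J.+1) (H_ 0%N) (H_ J.+1) mu /\
  action_curve L1 L2 mu (eta * (1 - q ^+ J.+1)).
(* Choice needs a total function, so the extension is stated for every pair and is void when [Inv]
   fails. *)
have step (p : nat * mCurve) : exists nu : mCurve, Inv p.1 p.2 -> Inv p.1.+1 nu /\
    [/\ forall A : set (borel E), measurable A ->
          mval nu.1.1 A = mval p.2.1.1 A + mval (P p.1.+1).1.1 A,
        forall A : set (borel E), measurable A ->
          mval nu.1.2 A = mval p.2.1.2 A + mval (P p.1.+1).1.2 A &
        forall A : set (borel E), measurable A ->
          mval nu.2 A = mval p.2.2 A + mval (P p.1.+1).2 A].
  case: p => J mu /=; have [[ce ha]|nInv] := pselect (Inv J mu); last by exists mu.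
  have [ce' ha' _] := hP J.+1.
  have [nu [c3 a3 hG hq hr]] := CE_on_add cOm ce ce' ha ha'.
  exists nu => _; split; last by split.
  split=> //; apply: action_curve_mono a3.
  by rewrite -mulrDr half_step.
have [f hf] := choice step.
pose mu := fix mu J : mCurve := if J is J'.+1 then f (J', mu J') else P 0%N.
have hInv J : Inv J (mu J).
  elim: J => [|J IH] /=; last by have [] := hf (J, mu J) IH.
  have [ce ha _] := hP 0%N; split; first by move: ce; rewrite expr0 subrr.
  apply: action_curve_mono ha; rewrite ler_pM2l//.
  by have := half_step 0; rewrite expr0 subrr add0r => <-.
have q_ J : `[0, 1]%classic (1 - q ^+ J).
  by rewrite /= in_itv/= subr_ge0 half_le1 lerBlDr lerDl ltW// half_gt0.
have [||||nu [ce ha]] := @CE_on_limit R n k d L0 Lx L1 L2 Om cOm mu (fun J => 1 - q ^+ J.+1)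
  (H_ 0%N) (fun J => H_ J.+1) G K eta.
- by move=> J; have [] := hInv J.
- move=> J; have [_] := hInv J; apply: action_curve_mono.
  by rewrite -[leRHS]mulr1 ler_pM2l// lerBlDr lerDl ltW// half_gt0.
- move=> J A mA; have [_ [hG hq hr]] := hf (J, mu J) (hInv J).
  have [_ _ /(_ A mA)[h1 h2 h3]] := hP J.+1.
  (* Step [J] adds piece [J.+1], which is smaller by one factor than the rate asked for by
     [CE_on_limit]; nonnegativity of [K] follows from the bound itself. *)
  have K0 x : x <= K * q ^+ J.+1 -> 0 <= x -> x <= K * q ^+ J.
    move=> xK x0; apply: (le_trans xK); rewrite ler_wpM2l ?half_mono//.
    by rewrite -(pmulr_lge0 _ (half_gt0 J.+1)) (le_trans x0 xK).
  split=> i j /=.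
  + by rewrite hG// mxE addrAC subrr add0r K0.
  + by rewrite hq// mxE addrAC subrr add0r K0.
  + by rewrite hr// mxE addrAC subrr add0r K0.
- move=> Phi cP; apply: cvg_sum_fin => i; apply: cvg_sum_fin => j.
  apply: (@slice_limit R d Om cOm (fun z => Phi z i j) (fun J => 1 - q ^+ J.+1)
    (fun J => H_ J.+1 i j) (G i j) Mb).
  + exact: within_entry.
  + by move=> J; exact: q_.
  + rewrite -[X in _ --> X]subr0; apply: cvgB; first exact: cvg_cst.
    have hq : q * q ^+ J @[J --> \oo] --> q * 0.
      apply: cvgM; first exact: cvg_cst.
      by apply: cvg_expr; rewrite ger0_norm ?invr_ge0// invf_lt1// ltr1n.
    by rewrite mulr0 in hq; under eq_fun do rewrite exprS.
  + by move=> J; exact: le_trans (psd_tv_le cOm i j (mH _)) (hMb _).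
  + move=> g cg; 
    exact: (@cvg_shift_left R (fun J => charge_integral (H_ J i j) Om g) _ 1 (hlim i j g cg)).
by exists nu.
Qed.

Lemma dist_complete : is_complete MOm dist.
Proof.
move=> u mu hc.
(* Tolerance 4^-l: consecutive distances must beat the factors 2^-(m+1) of [cost_chain]. *)
have [p0 hp0] := choice (fun l => hc (q ^+ (2 * l)) (half_gt0 _)).
(* Partial sums turn the chosen ranks into nondecreasing ones. *)
pose p l := (\sum_(m < l.+1) p0 m)%N.
have p_mono l m : (l <= m)%N -> (p l <= p m)%N.
  move=> lm; rewrite /p -(subnK lm) -addnS addnC big_split_ord /=; exact: leq_addr.
have p0p l : (p0 l <= p l)%N by rewrite /p big_ord_recr/=; exact: leq_addl.
pose v l := u (p l).
have hv l j : (p l <= j)%N -> (dist (v l) (u j) < (q ^+ (2 * l))%:E)%E /\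
    (dist (u j) (v l) < (q ^+ (2 * l))%:E)%E.
  by move=> lj; split; apply: hp0 => //; apply: leq_trans lj.
have mv l : MOm (v l) by exact: mu.
have cost_v l m : (l <= m)%N -> cost ((q ^+ (2 * l)) ^+ 2) (v l) (v m).
  move=> lm; apply: (cost_of_dist sL1 sL2 uL2 cOm (half_gt0 _)).
  have [h _] := hv l (p m) (p_mono _ _ lm); exact: h.
have [C C0 hC] := cost_mass Lx L1 L2 L0_id cOm.
pose Mb := C * (\tr (mval (v 0%N) setT) + 1).
have hMb l : \tr (mval (v l) setT) <= Mb.
  have c1 := cost_v 0%N l (leq0n _); rewrite muln0 expr0 expr1n in c1.
  exact: (hC _ _ _ (mv 0%N) (mv l) c1).
have lcvg i j (g : V -> R) : C1fun g -> cvgn (fun l => charge_integral (v l i j) Om g).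
  move=> Cg; apply/cauchy_cvgP/cauchy_ballP => e e0.
  have e20 : 0 < e / 2 by rewrite divr_gt0.
  have [dl dl0 hdl] := cost_close Lx L1 L2 L0_id cOm i j Mb Cg e20.
  have [J hJ] := half_pow_small 1 dl0; rewrite mul1r in hJ.
  have key l m : (J <= l)%N -> (l <= m)%N ->
      `|charge_integral (v m i j) Om g - charge_integral (v l i j) Om g| <= e / 2.
    move=> Jl lm; apply: (hdl _ _ (mv l) (mv m) (hMb l)).
    apply: (cost_le_mono _ (cost_v l m lm)).
    apply: le_trans hJ; rewrite -exprM; apply: half_mono.
    by rewrite (leq_trans Jl)// mul2n muln2 -!addnn -addnA leq_addr.
  have e2e : e / 2 < e by rewrite ltr_pdivrMr// mulr_natr mulr2n ltrDl.
  rewrite near_map2 /=; exists ([set l | (J <= l)%N], [set l | (J <= l)%N]);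
    first by split; exists J.
  move=> [l m] [/= Jl Jm]; rewrite -ball_normE /=.
  have [lm|/ltnW ml] := leqP l m.
    by rewrite distrC; apply: le_lt_trans e2e; exact: key.
  by apply: le_lt_trans e2e; exact: key.
have [G [mG hG]] := measures_limit cOm mv hMb lcvg.
exists G; split=> //.
have vG l : (dist (v l) G <= (2 * q ^+ (2 * l))%:E)%E.
  apply: (dist_of_cost sL1 sL2 uL2 cOm); first by rewrite mulr_ge0// ltW// half_gt0.
  (* For this total action the [m]-th link may cost (4^-l 2^-m)^2, and it costs at most
     (4^-(l+m))^2. *)
  have := @cost_chain (fun m => v (l + m)%N) G Mb ((2 * q ^+ (2 * l)) ^+ 2).
  rewrite addn0; apply.
  - by move=> m; exact: mv.
  - by move=> m; exact: hMb.
  - by rewrite exprn_gt0// mulr_gt0// half_gt0.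
  - move=> m; have lm : (l + m <= l + m.+1)%N by rewrite leq_add2l.
    apply: (cost_le_mono _ (cost_v _ _ lm)).
    have -> : (2 * q ^+ (2 * l)) ^+ 2 * (q ^+ m.+1) ^+ 2 = (q ^+ (2 * l) * q ^+ m) ^+ 2.
      rewrite [q ^+ m](@pow2_half_sum R m) -/q; move: (q ^+ m.+1) (q ^+ (2 * l)) => x y; ring.
    rewrite mulnDr exprD; apply: lerXn2r; rewrite ?nnegrE ?mulr_ge0 ?(ltW (half_gt0 _))//.
    by rewrite ler_pM2l ?half_gt0// half_mono// mul2n -addnn leq_addr.
  - move=> i j f cf.
    exact: (@cvg_shift_left R (fun m => charge_integral (v m i j) Om f) _ l (hG i j f cf)).
have fin j : dist (u j) G \is a fin_num.
  by have [D [_ DE _]] := WB_finite L0 Lx sL1 sL2 uL2 cOm sOm (mu j) mG; rewrite /dist DE.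
apply/fine_cvgP; split; first by apply: nearW => j; exact: fin.
(* The constant 3 is 1 for the distance from [u j] to [v l] plus 2 for that from [v l] to [G], both
   in units of 4^-l. *)
apply/cvgrPdist_le => e e0; have [l hl] := half_pow_small 3 e0.
exists (p l) => // j /= lj; rewrite sub0r normrN ger0_norm ?fine_ge0 ?sqrte_ge0//.
rewrite -lee_fin (fineK (fin j)).
have tri := @dist_triangle R n k d L0 Lx L1 L2 Om sL1 sL2 uL2 cOm sOm _ _ _ (mu j) (mv l) mG.
apply: (le_trans tri).
have [_ /ltW h1] := hv l j lj.
apply: le_trans (leeD h1 (vG l)) _; rewrite -EFinD lee_fin; apply: le_trans hl.
have : q ^+ (2 * l) <= q ^+ l by rewrite half_mono// mul2n -addnn leq_addr.
by rewrite -/q; move: (q ^+ l) (q ^+ (2 * l)) => x y; lra.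
Qed.

End Completeness.

Lemma posdef_unitmx (R : realType) n (A : 'M[R]_n) : posdef A -> A \in unitmx.
Proof.
move=> [_ pA]; rewrite -row_free_unit -kermx_eq0 -submx0; apply/row_subP => i.
rewrite submx0; apply/eqP; set v := row i _.
have vA : v *m A = 0 by rewrite -row_mul mulmx_ker row0.
apply: contrapT => /eqP v0; have : v^T != 0 by rewrite -(inj_eq trmx_inj) trmxK trmx0.
by move=> /pA; rewrite trmxK vA mul0mx mxE ltxx.
Qed.

Theorem proposition5p2 (R : realType) (n k d : nat)
    (n_gt0 : (0 < n)%N) (k_gt0 : (0 < k)%N) (d_gt0 : (0 < d)%N)
    (L1 : 'M[R]_k) (L1_psd : psd L1)
    (L2 : 'M[R]_n) (L2_pd : posdef L2)
    (L0 : {linear 'M[R]_n -> 'M[R]_(n, k)})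
    (Lx : 'I_d -> {linear 'M[R]_n -> 'M[R]_(n, k)})
    (L0_id : L0 1%:M = 0)
    (Om : set 'rV[R]_d) (Om_compact : compact Om) (Om_int : Om° !=set0)
    (Om_smooth : smooth_boundary Om) :
  let MOm := measures Om psd : set (mxmeasure 'rV[R]_d n n) in
  let dist := WB L0 Lx L1 L2 Om in
  [/\ is_metric MOm eq_mxmeasure dist,
      is_complete MOm dist &
      forall (u : nat -> mxmeasure 'rV[R]_d n n) (G : mxmeasure 'rV[R]_d n n),
        (forall j, MOm (u j)) -> MOm G ->
        dist (u j) G @[j --> \oo] --> 0%E ->
        weak_star Om symm u G].
Proof.
have [sL1 _] := L1_psd; have [sL2 _] := L2_pd; have uL2 := posdef_unitmx L2_pd.
split.
- exact: dist_metric.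
- exact: dist_complete.
- exact: dist_weak_star.
Qed.
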